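(* Let $n \geq 1$ and $\ell > 1$ be integers, and assume that $K \subset \mathbb{R}^n_+$ is a $(1/\ell)$-convex set with a non-empty interior. Then, for any locally Lipschitz, integrable function $f: K \rightarrow \mathbb{R}$ with $\int_K f = 0$, $$\int_K f^2 \, dx \leq \frac{\ell^2}{\ell-1} \sum_{i=1}^n \int_{K} x_i^{2} \left| \partial^i f(x) \right|^2 dx.$$
   Context: $\mathbb{R}^n_+$ denotes the set of all $x \in \mathbb{R}^n$ with positive coordinates. A subset $K \subset \mathbb{R}^n_+$ is called $p$-convex, for $0 < p \leq 1$, if $\{ (x_1^p,\ldots,x_n^p) \ ; \ (x_1,\ldots,x_n) \in K \}$ is a convex set. $\partial^i f = \partial f/\partial x_i$ (defined almost everywhere). Integrals are with respect to Lebesgue measure, and the right-hand side may be $+\infty$. *)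

(* Defs.v *)
From HB Require Import structures.
From mathcomp Require Import all_boot all_order all_algebra.
From mathcomp Require Import all_classical all_reals all_analysis.
Import Order.TTheory GRing.Theory Num.Theory.
Import numFieldNormedType.Exports.

Set Implicit Arguments.
Unset Strict Implicit.
Unset Printing Implicit Defensive.

Local Open Scope classical_set_scope.
Local Open Scope ring_scope.

Definition rV_display : measure_display. Proof. exact: default_measure_display. Qed.

(* Row vectors carry the sigma-algebra generated by the coordinates, as the
   library does for [n.-tuple T]; on R^n it is the Borel sigma-algebra. *)
Section measurable_rV.
Context {R : realType} (n : nat).

Let coors (i : 'I_n) (x : 'rV[R]_n) : measurableTypeR R := x ord0 i.

Let rV_set0 : g_sigma_preimage coors set0.
Proof. exact: sigma_algebra0. Qed.

Let rV_setC A : g_sigma_preimage coors A -> g_sigma_preimage coors (~` A).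
Proof. exact: sigma_algebraC. Qed.

Let rV_bigcup (F : _^nat) : (forall i, g_sigma_preimage coors (F i)) ->
  g_sigma_preimage coors (\bigcup_i (F i)).
Proof. exact: sigma_algebra_bigcup. Qed.

HB.instance Definition _ := @isMeasurable.Build rV_display
  'rV[R]_n (g_sigma_preimage coors) rV_set0 rV_setC rV_bigcup.

Lemma measurable_coord (i : 'I_n) :
  measurable_fun [set: 'rV[R]_n]
    (fun x : 'rV[R]_n => x ord0 i : measurableTypeR R).
Proof.
move=> _ Y mY; rewrite setTI; apply: sub_sigma_algebra => /=.
rewrite -bigcup_seq/=; exists i => /=; first by rewrite mem_index_enum.
by exists Y => //; rewrite setTI.
Qed.

Lemma measurable_fun_rVP d (T : measurableType d) (f : T -> 'rV[R]_n) :
  (forall i, measurable_fun [set: T]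
    (fun t => f t ord0 i : measurableTypeR R)) ->
  measurable_fun [set: T] f.
Proof.
move=> mf.
have sub : g_sigma_preimage (fun i => coors i \o f) `<=` measurable.
  apply: smallest_sub; first exact: sigma_algebra_measurable.
  rewrite -bigcup_seq; apply: bigcup_sub => i _ A [B mB <-].
  exact: (mf i).
rewrite g_sigma_preimage_comp in sub.
by move=> _ A mA; apply: sub; exists A.
Qed.

End measurable_rV.

Section lebesgue_rV.
Context {R : realType}.

Definition cons_rV n (p : measurableTypeR R * 'rV[R]_n) : 'rV[R]_n.+1 :=
  row_mx (const_mx p.1) p.2 : 'rV[R]_(1 + n).

Definition uncons_rV n (v : 'rV[R]_n.+1) : measurableTypeR R * 'rV[R]_n :=
  (v ord0 ord0, \row_i v ord0 (lift ord0 i)).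

Lemma cons_rV0 n p : @cons_rV n p ord0 ord0 = p.1.
Proof.
rewrite /cons_rV mxE; case: splitP => [j _|j /= /eqP]; last by rewrite eqn_leq.
by rewrite ord1 mxE.
Qed.

Lemma cons_rVS n p i : @cons_rV n p ord0 (lift ord0 i) = p.2 ord0 i.
Proof.
rewrite /cons_rV mxE; case: splitP => [j|j /= /eqP].
  by rewrite ord1 /= => /eqP; rewrite eq_sym (negbTE (neq_bump 0 i)).
by rewrite eqSS => /eqP ij; congr (p.2 _ _); apply/val_inj.
Qed.

Lemma cons_rVK n : cancel (@cons_rV n) (@uncons_rV n).
Proof.
move=> [x v]; rewrite /uncons_rV cons_rV0; congr pair.
by apply/rowP => i; rewrite mxE cons_rVS.
Qed.

Lemma uncons_rVK n : cancel (@uncons_rV n) (@cons_rV n).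
Proof.
move=> v; apply/rowP => i; case: (unliftP ord0 i) => [j ->|->].
  by rewrite cons_rVS mxE.
by rewrite cons_rV0.
Qed.

Lemma measurable_cons_rV n : measurable_fun setT (@cons_rV n).
Proof.
apply: measurable_fun_rVP => i; case: (unliftP ord0 i) => [j ->|->].
  under eq_fun do rewrite cons_rVS.
  exact: (measurableT_comp (measurable_coord j) measurable_snd).
under eq_fun do rewrite cons_rV0.
exact: measurable_fst.
Qed.

Lemma measurable_uncons_rV n : measurable_fun setT (@uncons_rV n).
Proof.
apply: measurable_fun_pair; first exact: measurable_coord.
apply: measurable_fun_rVP => i.
under eq_fun do rewrite mxE.
exact: measurable_coord.
Qed.

Section step.
Variables (n : nat) (mu : {sigma_finite_measure set 'rV[R]_n -> \bar R}).

Definition lebesgue_rV_step : set 'rV[R]_n.+1 -> \bar R :=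
  pushforward (@lebesgue_measure R \x mu)%E (@cons_rV n).

Let step0 : lebesgue_rV_step set0 = 0%E.
Proof. by rewrite /lebesgue_rV_step /pushforward preimage_set0 measure0. Qed.

Let step_ge0 A : (0 <= lebesgue_rV_step A)%E.
Proof. exact: (measure_ge0 (lebesgue_measure \x mu)%E). Qed.

Let step_sigma_additive : semi_sigma_additive lebesgue_rV_step.
Proof.
move=> F mF tF mUF; rewrite /lebesgue_rV_step /pushforward preimage_bigcup.
apply: measure_semi_sigma_additive.
- by move=> k; rewrite -[X in measurable X]setTI; exact: measurable_cons_rV.
- apply/trivIsetP => /= i j _ _ ij; rewrite -preimage_setI.
  by move/trivIsetP : tF => /(_ _ _ _ _ ij) ->//; rewrite preimage_set0.
- by rewrite -preimage_bigcup -[X in measurable X]setTI; exact: measurable_cons_rV.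
Qed.

HB.instance Definition _ := isMeasure.Build _ _ _ lebesgue_rV_step
  step0 step_ge0 step_sigma_additive.

Let step_sigma_finite : sigma_finite setT lebesgue_rV_step.
Proof.
have /sigma_finiteP[F [TF ndF Foo]] := sigma_finiteT (@lebesgue_measure R).
have /sigma_finiteP[G [TG ndG Goo]] := sigma_finiteT mu.
exists (fun k => @uncons_rV n @^-1` (F k `*` G k)).
  rewrite -preimage_bigcup (_ : \bigcup_k _ = setT) ?preimage_setT//.
  rewrite -subTset => -[x y] _.
  have [k _ Fkx] : (\bigcup_k F k) x by rewrite -TF.
  have [l _ Gly] : (\bigcup_k G k) y by rewrite -TG.
  exists (maxn k l) => //; split.
  - by move: x Fkx; exact/subsetPset/ndF/leq_maxl.
  - by move: y Gly; exact/subsetPset/ndG/leq_maxr.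
move=> k; have [mF Fk] := Foo k; have [mG Gk] := Goo k; split.
  rewrite -[X in measurable X]setTI; apply: measurable_uncons_rV => //.
  exact: measurableX.
rewrite /lebesgue_rV_step /pushforward -comp_preimage.
rewrite (_ : _ \o _ = id) ?preimage_id; last by apply/funext; exact: cons_rVK.
by rewrite product_measure1E// lte_mul_pinfty// ge0_fin_numE.
Qed.

HB.instance Definition _ := Measure_isSigmaFinite.Build _ _ _ lebesgue_rV_step
  step_sigma_finite.

End step.

Fixpoint lebesgue_rV_rec n : {sigma_finite_measure set 'rV[R]_n -> \bar R} :=
  if n is n'.+1 then lebesgue_rV_step (lebesgue_rV_rec n')
  else \d_ (0 : 'rV[R]_0).

Definition borel_lebesgue_rV n : set 'rV[R]_n -> \bar R := lebesgue_rV_rec n.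

HB.instance Definition _ n :=
  SigmaFiniteMeasure.on (@borel_lebesgue_rV n).

(* A p-convex set need not be Borel (its boundary is null but arbitrary), hence
   the completion: measurable sets are the Lebesgue-measurable subsets of R^n. *)
Definition lebesgue_rV n := @completed_measure_extension _ _ _ (@borel_lebesgue_rV n).

HB.instance Definition _ n := Measure.on (@lebesgue_rV n).

Lemma lebesgue_rV_sigma_finite n : sigma_finite setT (@lebesgue_rV n).
Proof. exact/completed_measure_extension_sigma_finite/sigma_finiteT. Qed.

HB.instance Definition _ n := Measure_isSigmaFinite.Build _ _ _ (@lebesgue_rV n)
  (@lebesgue_rV_sigma_finite n).

Lemma lebesgue_rVE n (A : set 'rV[R]_n) :
  measurable A -> lebesgue_rV A = borel_lebesgue_rV A.
Proof. by move=> mA; rewrite /lebesgue_rV; exact: measurable_mu_extE. Qed.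

Lemma borel_lebesgue_rV_box n (A : 'I_n -> set (measurableTypeR R)) :
  (forall i, measurable (A i)) ->
  borel_lebesgue_rV [set v : 'rV[R]_n | forall i, A i (v ord0 i)] =
  (\prod_(i < n) lebesgue_measure (A i))%E.
Proof.
elim: n A => [|n IH] A mA.
  rewrite big_ord0 /borel_lebesgue_rV /= diracE.
  by rewrite mem_set// => -[].
rewrite big_ord_recl -IH//.
rewrite -product_measure1E//; last first.
  rewrite (_ : [set _ | _] = \big[setI/setT]_(i < n)
     ((fun x : 'rV[R]_n => x ord0 i : measurableTypeR R) @^-1` A (lift ord0 i))).
    apply: bigsetI_measurable => i _; rewrite -[X in measurable X]setTI.
    exact: measurable_coord.
  rewrite -bigcap_seq; apply/seteqP; split => v /= H.
    by move=> i _; exact: H.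
  by move=> i; apply: (H i); rewrite /= mem_index_enum.
rewrite /borel_lebesgue_rV /= /lebesgue_rV_step /pushforward; congr product_measure1.
apply/seteqP; split => -[x v] /= H.
  split; first by have := H ord0; rewrite cons_rV0.
  by move=> i; have := H (lift ord0 i); rewrite cons_rVS.
move=> i; case: (unliftP ord0 i) => [j ->|->].
  by rewrite cons_rVS; exact: H.2.
by rewrite cons_rV0; exact: H.1.
Qed.

End lebesgue_rV.
Arguments lebesgue_rV {R} n.

Definition positive_orthant (R : realType) n : set 'rV[R]_n :=
  [set x | forall i, 0 < x ord0 i].
Arguments positive_orthant R n : clear implicits.

Definition powR_rV {R : realType} n (p : R) (x : 'rV[R]_n) : 'rV[R]_n :=
  \row_i (x ord0 i `^ p).

Definition p_convex {R : realType} n (p : R) (K : set 'rV[R]_n) : Prop :=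
  convex_set (powR_rV p @` K).

(* For f only given on K, any extension of f to R^n may be used: on K this
   differs only at boundary points of K. There, and where f has no i-th partial
   derivative, the value is irrelevant junk; for K p-convex and f locally
   Lipschitz on K these points form a null set. *)
Definition partial {R : realType} n (i : 'I_n) (f : 'rV[R]_n -> R)
    (x : 'rV[R]_n) : R :=
  'D_(delta_mx ord0 i) f x.

(* Main.v *)
(* In the coordinates y_i = x_i^(1/l) the set K is convex and Lebesgue measure
   has the log-concave density prod_i l y_i^(l-1), whose potential has Hessian
   diag((l - 1) / y_i^2).  Since y_i d/dy_i = l x_i d/dx_i, the claim is the
   Brascamp-Lieb variance inequality for this density.  It is obtained from
   Prekopa-Leindler for the mean x, y |-> ((x^(1/l) + y^(1/l)) / 2)^l, applied
   to e^(eps g), e^(-eps g) and e^(eps^2 q / 2) with eps -> 0.  This needs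
   uniform control of the increments of g, so g is a mollification of a
   Lipschitz function F; then the mollifier is shrunk.  Finally the interior of
   K is exhausted by compact cores stable under the mean, f being Lipschitz on
   each of them; F is its McShane extension.  That K minus its interior is null
   is Prekopa-Leindler again, for the indicators of the closure and of the
   interior. *)
Require Import Defs.
From HB Require Import structures.
From mathcomp Require Import all_boot all_order all_algebra.
From mathcomp Require Import interval_inference.
From mathcomp Require Import all_classical all_reals all_analysis.
From mathcomp Require Import measurable_realfun ring lra.
Import Order.TTheory GRing.Theory Num.Theory.
Import numFieldNormedType.Exports.

Set Implicit Arguments.
Unset Strict Implicit.
Unset Printing Implicit Defensive.

Local Open Scope classical_set_scope.
Local Open Scope ring_scope.

(** * The Prekopa-Leindler inequality in root coordinates *)

(** Points keep their original coordinates: the Jacobian of x = y^l is carried by the factor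
    [rdefect], so only a one-dimensional substitution is ever made and the dimension is handled by
    slicing. The constant arises coordinate by coordinate. Let p, q be the roots of x_k, y_k and d =
    (p - q) / (p + q). The defect is at least e^((l - 1) d^2), while x_k - y_k is about 2 l d m_k at
    the mean m; the maximum over d of 2 eps l d m_k |A_k| - (l - 1) d^2 is eps^2 (l^2 / (l - 1))
    m_k^2 A_k^2. The Lipschitz constant of the mollified derivatives may blow up as the mollifier
    shrinks; this is harmless because eps tends to 0 first, at a fixed mollifier. Derivatives are
    taken along coordinate lines only, where a Lipschitz function is the integral of its derivative.
    Two measures occur because [K] need not be Borel: the inequalities are proved on compact cores
    for the Borel measure and are transferred to its completion at the end. *)

Section lebesgue_affine.
Local Open Scope ereal_scope.
Context {R : realType}.
Local Notation mu := (@lebesgue_measure R).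

Let measurable_affine (c b : R) : measurable_fun [set: measurableTypeR R]
  (fun x : measurableTypeR R => (c * x + b)%R : measurableTypeR R).
Proof.
by apply: measurable_funD => //; exact: measurable_funM.
Qed.

(** By uniqueness: [c] times the pushforward of Lebesgue measure under the affine map has the right
    value on half-open intervals. *)
Lemma lebesgue_measure_affine (c b : R) (A : set R) : (0 < c)%R ->
  measurable A -> mu ((fun x => c * x + b)%R @^-1` A) = (c^-1)%:E * mu A.
Proof.
move=> c0 mA.
pose phi : measurableTypeR R -> measurableTypeR R := fun x => (c * x + b)%R.
have mphi : measurable_fun setT phi by exact: measurable_affine.
have c0' : (0 <= c)%R by exact: ltW.
pose m : {measure set (measurableTypeR R) -> \bar R} :=
  mscale (NngNum c0') (pushforward mu phi).
have -> : mu A = m mphi A.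
  apply: lebesgue_measure_unique => // _ [[u v] _ <-] /=.
  rewrite /m /mscale /= /pushforward.
  have -> : phi @^-1` `]u, v] = `]((u - b) / c)%R, ((v - b) / c)%R]%classic.
    apply/seteqP; split => x /=; rewrite !in_itv/= /phi.
      by move=> /andP[h1 h2]; apply/andP; split; rewrite ?ltr_pdivrMr ?ler_pdivlMr//; lra.
    move=> /andP[]; rewrite ltr_pdivrMr// ler_pdivlMr// => h1 h2.
    by apply/andP; split; lra.
  rewrite !lebesgue_measure_itv /= !lte_fin ltr_pM2r ?invr_gt0// ltrBlDr subrK.
  case: ifPn => _; last by rewrite mule0.
  rewrite -!EFinB -EFinM; congr EFin; field; exact: lt0r_neq0.
rewrite /m /mscale /= muleA -EFinM mulVf ?mul1e ?lt0r_neq0//.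
Qed.

(** One-dimensional Brunn-Minkowski. For compact sets, the midpoints of [K1] with the least point
    [b] of [K2] lie left of [m], those of [K2] with the greatest point [a] of [K1] lie right of it,
    and each family has half the measure of the set it comes from. Inner regularity extends this to
    measurable sets; the set of all midpoints is never formed, only a measurable [C] containing
    it. *)
Lemma lebesgue_midpoint (A B C : set R) :
  measurable A -> measurable B -> measurable C -> A !=set0 -> B !=set0 ->
  (forall a b, A a -> B b -> C ((a + b) / 2)%R) ->
  mu A + mu B <= 2%:E * mu C.
Proof.
move=> mA mB mC [a0 Aa0] [b0 Bb0] ABC.
have key (K1 K2 : set R) : compact K1 -> compact K2 -> K1 !=set0 -> K2 !=set0 ->
    K1 `<=` A -> K2 `<=` B -> mu K1 + mu K2 <= 2%:E * mu C.
  move=> cK1 cK2 K10 K20 KA KB.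
  have cid D : {within D, continuous (@idfun R)}.
    by apply: continuous_subspaceT => x; exact: cvg_id.
  have [a K1a amax] := compact_EVT_max K10 cK1 (cid _).
  have [b K2b bmin] := compact_EVT_min K20 cK2 (cid _).
  move: K1a K2b; rewrite !inE => K1a K2b.
  pose m := ((a + b) / 2)%R.
  have mC1 : measurable (C `&` `]-oo, m]) by apply: measurableI => //; exact: measurable_itv.
  have mC2 : measurable (C `&` `[m, +oo[) by apply: measurableI => //; exact: measurable_itv.
  have mC2' : measurable (C `&` `]m, +oo[) by apply: measurableI => //; exact: measurable_itv.
  have i2 : (0 < 2^-1 :> R)%R by rewrite invr_gt0.
  have mK (K : set R) : compact K -> measurable K.
    by move=> cK; apply: closed_measurable; apply: compact_closed => //; exact: Rhausdorff.
  have h1 : mu K1 <= 2%:E * mu (C `&` `]-oo, m]).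
    rewrite -{1}[2%R]invrK -(lebesgue_measure_affine (b / 2) i2 mC1).
    apply: le_measure; rewrite ?inE; [exact: mK|rewrite -[X in measurable X]setTI; exact: measurable_affine|].
    move=> x K1x /=; split; last first.
      rewrite /= in_itv/=; have := amax x; rewrite inE => /(_ K1x) /=; rewrite /m; lra.
    have -> : (2^-1 * x + b / 2 = (x + b) / 2)%R by lra.
    by apply: ABC; [exact: KA|exact: KB].
  have h2 : mu K2 <= 2%:E * mu (C `&` `]m, +oo[).
    (* The two families share at most the point [m]; it is given to the left half, at no cost since
       it is null. *)
    have -> : mu (C `&` `]m, +oo[) = mu (C `&` `[m, +oo[).
      rewrite -[in RHS](setU1itv false)//.
      rewrite setIUr; have [Cm|Cm] := pselect (C m); last first.
        rewrite (_ : C `&` [set m] = set0) ?set0U//.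
        by apply/seteqP; split => // x [Cx] /= xm; apply: Cm; rewrite -xm.
      rewrite (_ : C `&` [set m] = [set m]); last by apply/seteqP; split => x //=; [move=> []|move=> ->].
      have dis : [set m] `&` (C `&` `]m, +oo[) = set0.
        by apply/seteqP; split => // x /= [-> [_]]; rewrite in_itv/= ltxx.
      by rewrite measureU// -?[X in _ = X + _]/(mu [set m]) ?lebesgue_measure_set1 ?add0e.
    rewrite -{1}[2%R]invrK -(lebesgue_measure_affine (a / 2) i2 mC2).
    apply: le_measure; rewrite ?inE; [exact: mK|rewrite -[X in measurable X]setTI; exact: measurable_affine|].
    move=> x K2x /=; split; last first.
      rewrite /= in_itv/= andbT; have := bmin x; rewrite inE => /(_ K2x) /=; rewrite /m; lra.
    have -> : (2^-1 * x + a / 2 = (a + x) / 2)%R by lra.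
    by apply: ABC; [exact: KA|exact: KB].
  have -> : mu C = mu (C `&` `]-oo, m]) + mu (C `&` `]m, +oo[).
    rewrite -measureU//; last first.
      apply/seteqP; split => // x /= [[_ +] [_ +]]; rewrite !in_itv/= andbT => h3 h4.
      by move: (lt_le_trans h4 h3); rewrite ltxx.
    congr mu; rewrite -setIUr -[LHS]setIT; congr (_ `&` _); apply/esym/seteqP; split => // x _ /=.
    by rewrite !in_itv/= andbT; case: (leP x m); [left|right].
  by rewrite ge0_muleDr// leeD.
have keyA (K2 : set R) : compact K2 -> K2 !=set0 -> K2 `<=` B -> mu A + mu K2 <= 2%:E * mu C.
  move=> cK2 K20 K2B.
  have K2fin : mu K2 \is a fin_num.
    by rewrite ge0_fin_numE//; exact: compact_finite_measure.
  rewrite -leeBrDr// (lebesgue_regularity_inner_sup mA); apply: ge_ereal_sup => _ [K [cK KA] <-].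
  rewrite leeBrDr//.
  (* The supremum ranges over all compact subsets, the empty one included; [a0] is added because
     [key] asks for a nonempty set. *)
  have h : mu (K `|` [set a0]) + mu K2 <= 2%:E * mu C.
    apply: key => //; first by apply: compactU => //; exact: compact_set1.
      by exists a0; right.
    by move=> x [/KA//|->].
  apply: le_trans h; rewrite leeD2r//.
  by apply: le_outer_measure; exact: subsetUl.
have [Cy|Cfin] := eqVneq (mu C) +oo; first by rewrite Cy gt0_muley ?lte_fin// leey.
have Cfin' : 2%:E * mu C < +oo.
  by rewrite lte_mul_pinfty// ltey.
(* Comparison with the singleton of [b0] makes [mu A] finite, so that it can be subtracted while [B]
   is exhausted. *)
have Afin : mu A \is a fin_num.
  rewrite ge0_fin_numE//; apply: le_lt_trans Cfin'.
  apply: (@le_trans _ _ (mu A + mu [set b0])); first by rewrite leeDl.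
  by apply: keyA; [exact: compact_set1|exists b0|move=> x ->].
rewrite addeC -leeBrDr// (lebesgue_regularity_inner_sup mB).
apply: ge_ereal_sup => _ [K [cK KB] <-].
rewrite leeBrDr// addeC; apply: (@le_trans _ _ (mu A + mu (K `|` [set b0]))); last apply: keyA.
- by rewrite leeD2l//; apply: le_outer_measure; exact: subsetUl.
- by apply: compactU => //; exact: compact_set1.
- by exists b0; right.
- by move=> x [/KB//|->].
Qed.

End lebesgue_affine.

(** A passage to the limit [t] -> 1: if [y < x], the value [t = (x + y) / (2 x)] makes [t x] the
    midpoint of [x] and [y], a contradiction. *)
Lemma ler_ltscale {R : realFieldType} (x y : R) : 0 <= y ->
  (forall t, 0 < t -> t < 1 -> t * x <= y) -> x <= y.
Proof.
move=> y0 h; rewrite leNgt; apply/negP => yx.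
have x0 : 0 < x by exact: le_lt_trans yx.
have xy0 : 0 < x + y by lra.
have xx0 : 0 < 2 * x by lra.
have e : (x + y) / (2 * x) * x = (x + y) / 2 by field; exact: lt0r_neq0.
have t1 : (x + y) / (2 * x) < 1 by rewrite ltr_pdivrMr// mul1r; lra.
by have := h _ (divr_gt0 xy0 xx0) t1; rewrite e; lra.
Qed.

(** * The one-dimensional inequality for the arithmetic midpoint *)

Section prekopa_leindler_1d.
Local Open Scope ereal_scope.
Context {R : realType}.
Local Notation mu := (@lebesgue_measure R).

(** Tonelli for the region [E] under the graph of the truncated function. Levels are measured in
    units of [a], so that functions with different suprema can be compared at the same parameter [s]
    in (0, 1). *)
Lemma layer_cake d (T : measurableType d) (m : {sigma_finite_measure set T -> \bar R})
    (w : T -> \bar R) (a : R) : (0 < a)%R ->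
  measurable_fun setT w -> (forall x, 0 <= w x) ->
  \int[m]_x mine (w x) a%:E =
  a%:E * \int[mu]_(s in `]0%R, 1%R[) m [set x | (a * s)%:E < w x].
Proof.
move=> a0 mw w0.
pose E := [set p : T * measurableTypeR R | (0 < p.2 < 1)%R /\ (a * p.2)%:E < w p.1].
have mE : measurable E.
  rewrite (_ : E = (setT `*` `]0%R, 1%R[) `&` [set p | (a * p.2)%:E < w p.1]); last first.
    by apply/seteqP; split => -[x s]/=; rewrite /E/= in_itv/=; [move=> []|move=> [[_]]].
  apply: measurableI.
    by apply: measurableX => //; exact: measurable_itv.
  rewrite -[X in measurable X]setTI; apply: measurable_lte => //.
    apply/measurable_EFinP; apply: measurable_funM => //; exact: measurable_snd.
  exact: (measurableT_comp mw measurable_fst).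
have h1 : \int[m]_x mine (w x) a%:E = \int[m]_x (a%:E * mu (xsection E x)).
  apply: eq_integral => x _.
  have xE : xsection E x = [set s | (0 < s < 1)%R /\ (a * s)%:E < w x].
    by apply/seteqP; split => s; rewrite /xsection/= inE.
  have big : a%:E <= w x -> mine (w x) a%:E = a%:E * mu (xsection E x).
    move=> aw; have -> : xsection E x = `]0%R, 1%R[%classic.
      rewrite xE; apply/seteqP; split => s /=; rewrite in_itv/=; first by move=> [].
      move=> s01; split=> //; apply: lt_le_trans aw; rewrite lte_fin gtr_pMr//.
      by case/andP: s01.
    by rewrite lebesgue_measure_itv/= lte_fin ltr01 oppr0 adde0 mule1 min_r.
  have := w0 x; case wx : (w x) => [r| |]// => r0; last by rewrite -wx; apply: big; rewrite wx leey.
  have [ar|ra] := leP a r; first by rewrite -wx; apply: big; rewrite wx lee_fin.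
  rewrite min_l ?lee_fin ?ltW//.
  have -> : xsection E x = `]0%R, (r / a)%R[%classic.
    rewrite xE wx; apply/seteqP; split => s /=; rewrite in_itv/= lte_fin ltr_pdivlMr// (mulrC s).
      by move=> [/andP[-> _] ->].
    move=> /andP[s0 asr]; rewrite s0 asr; split => //=.
    rewrite -(ltr_pM2l a0) mulr1; exact: lt_trans asr ra.
  rewrite lebesgue_measure_itv/= lte_fin.
  move: r0; rewrite lee_fin le_eqVlt => /orP[/eqP<-|r0]; first by rewrite mul0r ltxx mule0.
  rewrite divr_gt0// oppr0 adde0 -EFinM; congr EFin; field; exact: lt0r_neq0.
rewrite h1 ge0_integralZl_EFin ?(ltW a0)//; last exact: measurable_fun_xsection.
congr (_ * _).
have := indic_fubini_tonelli m mu mE.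
rewrite indic_fubini_tonelli_FE// indic_fubini_tonelli_GE// => ->.
rewrite [RHS]integral_mkcond; apply: eq_integral => s _ /=.
rewrite patchE; case: ifPn => [|]; rewrite ?inE => /= s01.
  congr (m _); apply/seteqP; split => x; rewrite /ysection/= inE/=.
    by move=> [].
  by move=> ?; split=> //; move: s01; rewrite in_itv.
rewrite (_ : ysection E s = set0) ?measure0//; apply/seteqP; split => // x.
rewrite /ysection/= inE/= => -[h _]; move: s01; rewrite notin_setE /=; apply.
by rewrite in_itv.
Qed.

(** The level-set argument. With levels in units of the suprema [a] and [b], midpoints of the
    superlevel sets of [u] and [v] at the same relative level lie in that of [h], in units of
    [c = sqrt (a b)], and [lebesgue_midpoint] applies. Integration over the level bounds an
    arithmetic mean of the normalised integrals, hence their geometric mean. The bound [B] makes the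
    suprema finite. *)
Lemma prekopa_leindler_midpoint (u v h : R -> \bar R) (B : R) :
  measurable_fun setT u -> measurable_fun setT v -> measurable_fun setT h ->
  (forall x, 0 <= u x <= B%:E) -> (forall x, 0 <= v x <= B%:E) ->
  (forall x, 0 <= h x) ->
  (forall x y, u x * v y <= h ((x + y) / 2)%R * h ((x + y) / 2)%R) ->
  (\int[mu]_x u x) * (\int[mu]_x v x) <= (\int[mu]_x h x) * (\int[mu]_x h x).
Proof.
move=> mu_ mv mh u0B v0B h0 uvh.
have u0 x : 0 <= u x by case/andP: (u0B x).
have v0 x : 0 <= v x by case/andP: (v0B x).
have Iu0 : 0 <= \int[mu]_x u x by exact: integral_ge0.
have Iv0 : 0 <= \int[mu]_x v x by exact: integral_ge0.
have Ih0 : 0 <= \int[mu]_x h x by exact: integral_ge0.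
have supE (w : R -> \bar R) : (forall x, 0 <= w x <= B%:E) -> 0 < \int[mu]_x w x ->
    exists a : R, [/\ (0 < a)%R, forall x, w x <= a%:E &
      forall t, (t < a)%R -> exists x, t%:E < w x].
  move=> w0B Iw.
  have supB : ereal_sup (range w) <= B%:E.
    by apply: ge_ereal_sup => _ [x _ <-]; case/andP: (w0B x).
  have wsup x : w x <= ereal_sup (range w) by apply: ereal_sup_ubound; exists x.
  have sup0 : 0 < ereal_sup (range w).
    rewrite ltNge; apply/negP => s0; move: Iw; rewrite integral0_eq ?ltxx// => x _.
    apply/eqP; rewrite eq_le; apply/andP; split; last by case/andP: (w0B x).
    exact: le_trans (wsup x) s0.
  have supfin : ereal_sup (range w) \is a fin_num.
    rewrite ge0_fin_numE ?ltW//; exact: le_lt_trans supB (ltry _).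
  exists (fine (ereal_sup (range w))); split.
  - by rewrite -lte_fin fineK.
  - by move=> x; rewrite fineK.
  - move=> t; rewrite -lte_fin fineK// => /ereal_sup_gt[_ [x _ <-] tx]; by exists x.
have [|Iu] := leP (\int[mu]_x u x) 0.
  move=> Iu; have -> : \int[mu]_x u x = 0 by apply/eqP; rewrite eq_le Iu Iu0.
  by rewrite mul0e mule_ge0.
have [|Iv] := leP (\int[mu]_x v x) 0.
  move=> Iv; have -> : \int[mu]_x v x = 0 by apply/eqP; rewrite eq_le Iv Iv0.
  by rewrite mule0 mule_ge0.
have [a [a0 ua asup]] := supE u u0B Iu.
have [b [b0 vb bsup]] := supE v v0B Iv.
have [Ihy|Ihfin] := eqVneq (\int[mu]_x h x) +oo.
  by rewrite Ihy mulyy leey.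
pose c := Num.sqrt (a * b).
have c0 : (0 < c)%R by rewrite sqrtr_gt0 mulr_gt0.
have c2 : (c * c = a * b)%R by rewrite -expr2 sqr_sqrtr// mulr_ge0// ltW.
have key (t : R) : (0 < t)%R -> (t < 1)%R ->
   a^-1%:E * \int[mu]_x u x + b^-1%:E * \int[mu]_x v x <=
     (2 / (t * c))%:E * \int[mu]_x h x.
  move=> t0 t1.
  have lev (w : R -> \bar R) (r : R) : (0 < r)%R -> measurable_fun setT w ->
     (forall x, 0 <= w x) -> (forall x, w x <= r%:E) ->
     r^-1%:E * \int[mu]_x w x <=
       \int[mu]_(s in `]0%R, 1%R[) mu [set x | (t * r * s)%:E < w x].
    move=> r0 mw w0 wr.
    have tr0 : (0 < t * r)%R by rewrite mulr_gt0.
    have -> : \int[mu]_(s in `]0%R, 1%R[) mu [set x | (t * r * s)%:E < w x] =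
        (t * r)^-1%:E * \int[mu]_x mine (w x) (t * r)%:E.
      by rewrite (layer_cake mu tr0 mw w0) muleA -EFinM mulVf ?mul1e ?lt0r_neq0.
    rewrite invfM mulrC EFinM -muleA lee_pmul2l ?lte_fin ?invr_gt0//.
    rewrite -ge0_integralZl_EFin ?invr_ge0 ?(ltW t0)//; last 2 first.
    - by move=> x _; rewrite le_min w0/= lee_fin ltW.
    - by apply: measurable_mine.
    apply: ge0_le_integral => //.
    - apply: measurable_funeM; exact: measurable_mine.
    - move=> x _; rewrite lee_pdivlMl//.
      rewrite le_min; apply/andP; split.
        have := w0 x; case: (w x) => [q| |]//; rewrite ?lee_fin => q0.
          by rewrite ler_piMl// ltW.
        by rewrite gt0_muley.
      rewrite EFinM lee_pmul2l//.
  have -> : (2 / (t * c))%:E * \int[mu]_x h x =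
      2%:E * ((t * c)^-1%:E * \int[mu]_x h x) by rewrite muleA -EFinM.
  have tc0 : (0 < t * c)%R by rewrite mulr_gt0.
  apply: (@le_trans _ _ (2%:E * \int[mu]_(s in `]0%R, 1%R[)
        mu [set x | (t * c * s)%:E < h x])); last first.
    rewrite lee_pmul2l// lee_pdivlMl// -(layer_cake mu tc0 mh h0).
    apply: ge0_le_integral => //.
    - by move=> x _; rewrite le_min h0/= lee_fin ltW.
    - exact: measurable_mine.
    - by move=> x _; rewrite ge_min lexx.
  have mlev (w : R -> \bar R) (r : R) : measurable_fun setT w ->
     measurable_fun setT (fun s : measurableTypeR R => mu [set x | (r * s)%:E < w x]).
    move=> mw.
    pose E := [set p : measurableTypeR R * measurableTypeR R | (r * p.2)%:E < w p.1].
    have mE : measurable E.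
      rewrite -[X in measurable X]setTI; apply: measurable_lte => //.
        apply/measurable_EFinP; apply: measurable_funM => //; exact: measurable_snd.
      exact: (measurableT_comp mw measurable_fst).
    rewrite (_ : (fun _ => _) = mu \o ysection E); first exact: measurable_fun_ysection.
    apply/funext => s /=; congr (mu _); apply/seteqP; split => x; by rewrite /ysection/= inE.
  apply: le_trans (leeD (lev u a a0 mu_ u0 ua) (lev v b b0 mv v0 vb)) _.
  rewrite -ge0_integralD//; [|apply: measurable_funTS; exact: mlev..].
  rewrite -ge0_integralZl_EFin//; last (by apply: measurable_funTS; exact: mlev).
  have ms (w : R -> \bar R) (r : R) : measurable_fun setT w -> measurable [set x | r%:E < w x].
    by move=> mw; rewrite -[X in measurable X]setTI; exact: emeasurable_fun_o_infty.
  apply: ge0_le_integral => //.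
  - by move=> s _; rewrite adde_ge0.
  - by apply: emeasurable_funD; apply: measurable_funTS; exact: mlev.
  - by apply: measurable_funeM; apply: measurable_funTS; exact: mlev.
  move=> s /=; rewrite in_itv/= => /andP[s0 s1].
  have ts1 : (t * s < 1)%R by rewrite mulr_ilt1// ltW.
  apply: lebesgue_midpoint.
  - exact: ms.
  - exact: ms.
  - exact: ms.
  - by apply: asup; rewrite mulrAC gtr_pMl.
  - by apply: bsup; rewrite mulrAC gtr_pMl.
  move=> x y /= ux vy.
  rewrite ltNge; apply/negP => hle.
  have := uvh x y; rewrite leNgt => /negP; apply.
  have hh : h ((x + y) / 2)%R * h ((x + y) / 2)%R <= (t * c * s)%:E * (t * c * s)%:E.
    by apply: lee_pmul.
  apply: le_lt_trans hh _.
  rewrite -EFinM (_ : t * c * s * (t * c * s) = (t * a * s) * (t * b * s))%R; last first.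
    by transitivity (t * t * s * s * (c * c))%R; [ring|rewrite c2; ring].
  have ufin : u x \is a fin_num.
    by rewrite ge0_fin_numE//; apply: le_lt_trans (ua x) (ltry _).
  have vfin : v y \is a fin_num.
    by rewrite ge0_fin_numE//; apply: le_lt_trans (vb y) (ltry _).
  move: ux vy; rewrite -(fineK ufin) -(fineK vfin) -EFinM !lte_fin => ux vy.
  by apply: ltr_pM => //; rewrite !mulr_ge0// ltW.
(* Once the integral of [h] is finite, [key] at a single value of [t], here 1/2, forces those of [u]
   and [v] to be finite. *)
have half : (0 < 2^-1 :> R)%R by rewrite invr_gt0.
have half1 : (2^-1 < 1 :> R)%R by rewrite invf_lt1// ltr1n.
have Ihf : \int[mu]_x h x \is a fin_num by rewrite ge0_fin_numE// ltey.
have hfin : (2 / (2^-1 * c))%:E * \int[mu]_x h x < +oo by rewrite ltey_eq fin_numM.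
have Iuf : \int[mu]_x u x \is a fin_num.
  rewrite ge0_fin_numE// ltNge leye_eq; apply/negP => /eqP Iuy.
  have := le_lt_trans (key _ half half1) hfin.
  by rewrite Iuy gt0_muley ?lte_fin ?invr_gt0// addye ?ltxx// gt_eqF// (lt_le_trans (ltNyr 0))// mule_ge0// lee_fin invr_ge0 ltW.
have Ivf : \int[mu]_x v x \is a fin_num.
  rewrite ge0_fin_numE// ltNge leye_eq; apply/negP => /eqP Ivy.
  have := le_lt_trans (key _ half half1) hfin.
  by rewrite Ivy gt0_muley ?lte_fin ?invr_gt0// addey ?ltxx// gt_eqF// (lt_le_trans (ltNyr 0))// mule_ge0// lee_fin invr_ge0 ltW.
move: Iuf Ivf Ihf key Iu0 Iv0 Ih0.
case: (\int[mu]_x u x) => [U| |]//; case: (\int[mu]_x v x) => [V| |]//.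
case: (\int[mu]_x h x) => [H| |]// _ _ _ key; rewrite -!EFinM !lee_fin => U0 V0 H0.
have keyr t : (0 < t)%R -> (t < 1)%R -> (t * (a^-1 * U + b^-1 * V) * c <= 2 * H)%R.
  move=> t0 t1; have := key t t0 t1; rewrite -!EFinM -EFinD lee_fin.
  rewrite mulrAC ler_pdivlMr ?mulr_gt0//; congr (_ <= _)%R; ring.
have key1 : ((a^-1 * U + b^-1 * V) * c <= 2 * H)%R.
  apply: ler_ltscale; first by rewrite mulr_ge0.
  by move=> t t0 t1; rewrite mulrA; exact: keyr.
pose p := (a^-1 * U)%R; pose q := (b^-1 * V)%R.
have UE : (U = a * p)%R by rewrite /p mulrA mulfV ?mul1r ?lt0r_neq0.
have VE : (V = b * q)%R by rewrite /q mulrA mulfV ?mul1r ?lt0r_neq0.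
have p0 : (0 <= p)%R by rewrite mulr_ge0// invr_ge0 ltW.
have q0 : (0 <= q)%R by rewrite mulr_ge0// invr_ge0 ltW.
move: key1; rewrite -/p -/q => key1.
have key2 : (((p + q) * c) ^+ 2 <= (2 * H) ^+ 2)%R.
  by rewrite lerXn2r// nnegrE ?mulr_ge0 ?addr_ge0// ltW.
(* What remains is [4 p q <= (p + q)^2] for the normalised integrals [p] and [q]. *)
rewrite UE VE (_ : a * p * (b * q) = (a * b) * (p * q))%R; last by ring.
rewrite -c2 -(ler_pM2l (ltr0n R 4)).
apply: le_trans (_ : (((p + q) * c) ^+ 2 <= _)%R); last first.
  by apply: le_trans key2 _; rewrite le_eqVlt; apply/orP; left; apply/eqP; ring.
rewrite -subr_ge0 (_ : (_ - _ = ((p - q) * c) ^+ 2)%R) ?sqr_ge0//; ring.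
Qed.

End prekopa_leindler_1d.

Section real_root.
Context {R : realType}.
Implicit Types (l : nat) (x y : R).

Definition rootr l x : R := x `^ l%:R^-1.

Lemma rootr_ge0 l x : 0 <= rootr l x. Proof. exact: powR_ge0. Qed.

Lemma rootr_gt0 l x : 0 < x -> 0 < rootr l x. Proof. exact: powR_gt0. Qed.

Lemma rootrK l x : (0 < l)%N -> 0 <= x -> rootr l x ^+ l = x.
Proof.
move=> l0 x0; rewrite -powR_mulrn ?rootr_ge0// /rootr -powRrM mulVf ?powRr1//.
by rewrite pnatr_eq0 -lt0n.
Qed.

Lemma exprnK l x : (0 < l)%N -> 0 <= x -> rootr l (x ^+ l) = x.
Proof.
move=> l0 x0; rewrite /rootr -powR_mulrn// -powRrM mulfV ?powRr1//.
by rewrite pnatr_eq0 -lt0n.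
Qed.

Lemma ltr_rootr l x y : (0 < l)%N -> 0 <= x -> 0 <= y ->
  (rootr l x < y) = (x < y ^+ l).
Proof.
move=> l0 x0 y0; rewrite -{2}(rootrK l0 x0).
by rewrite ltr_pXn2r// nnegrE rootr_ge0.
Qed.

Lemma ler_rootr l x y : (0 < l)%N -> 0 <= x -> 0 <= y ->
  (y <= rootr l x) = (y ^+ l <= x).
Proof. by move=> l0 x0 y0; rewrite leNgt ltr_rootr// -leNgt. Qed.

End real_root.

(** * The change of variables x = y^l on the half-line *)

Section exprn_substitution.
Local Open Scope ereal_scope.
Context {R : realType}.
Local Notation mu := (@lebesgue_measure R).
Variables (l : nat).
Hypothesis l0 : (0 < l)%N.

Let g (y : R) : R := (l%:R * y ^+ l.-1)%R.
Let b (p : measurableTypeR R * measurableTypeR R) : bool :=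
  [&& (0 < p.1)%R, (0 < p.2)%R & (p.2 < g p.1)%R].
(** The density [g] is realised as an area: on the half-line [D], the pushforward by [phi] of planar
    Lebesgue measure sees only the region below the graph of [g], because all other points go to -1,
    outside [D]. *)
Let phi (p : measurableTypeR R * measurableTypeR R) : measurableTypeR R :=
  if b p then (p.1 ^+ l)%R else (-1)%R.
Let D : set (measurableTypeR R) := `]0%R, +oo[%classic.

Let mg d (T : measurableType d) (f : T -> measurableTypeR R) :
  measurable_fun setT f -> measurable_fun setT (fun t => g (f t) : measurableTypeR R).
Proof.
by move=> mf; apply: measurable_funM => //; exact: measurable_funX.
Qed.

Let mb : measurable_fun setT b.
Proof.
apply: measurable_and; first exact: measurable_fun_ltr.
apply: measurable_and; first exact: measurable_fun_ltr.
by apply: measurable_fun_ltr => //; apply: mg; exact: measurable_fst.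
Qed.

Let mphi : measurable_fun setT phi.
Proof.
apply: measurable_fun_ifT => //.
by apply: measurable_funX; exact: measurable_fst.
Qed.

Let mD : measurable D. Proof. exact: measurable_itv. Qed.

Let nu := pushforward (mu \x mu) phi.

Let in_phi (i : interval R) p : (p \in phi @^-1` [set` i]) = (phi p \in i).
Proof. by apply/idP/idP; rewrite inE. Qed.

Let integral_section x (c : \bar R) : 0 <= c ->
  \int[mu]_y (if b (x, y) then c else 0) = if (0 < x)%R then c * (g x)%:E else 0.
Proof.
move=> c0; rewrite /b/=; case: (ltP 0%R x) => x0 /=; last by rewrite integral0_eq.
have gx0 : (0 < g x)%R by rewrite mulr_gt0 ?ltr0n// exprn_gt0.
transitivity (\int[mu]_(y in `]0%R, (g x)%R[) c).
  rewrite [RHS]integral_mkcond; apply: eq_integral => y _.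
  by rewrite patchE mem_setE in_itv.
rewrite integral_cst//.
congr (_ * _); transitivity (mu `]0%R, (g x)%R[%classic) => //.
by rewrite lebesgue_measure_itv/= lte_fin gx0 oppr0 adde0.
Qed.

(** The slice of the region at [x] is an interval of length [g x], so the measure is the integral of
    [g] between the two roots, and [g] is the derivative of [x ^+ l]. *)
Let nu_itv (s t : R) : (0 <= s)%R -> (s < t)%R -> nu `]s, t] = (t - s)%:E.
Proof.
move=> s0 st; have t0 : (0 <= t)%R by rewrite (le_trans s0)// ltW.
have st' : (rootr l s < rootr l t)%R.
  by rewrite ltr_rootr// ?rootr_ge0// rootrK.
rewrite /nu /pushforward /product_measure1/=.
transitivity (\int[mu]_(x in `](rootr l s), (rootr l t)]) (g x)%:E).
  rewrite [RHS]integral_mkcond; apply: eq_integral => x _ /=.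
  rewrite patchE mem_setE in_itv/=.
  rewrite -[LHS]mul1e -integral_cst; last first.
    by apply: measurable_xsection; rewrite -[X in measurable X]setTI; apply: mphi => //; exact: measurable_itv.
  rewrite integral_mkcond.
  transitivity (if (rootr l s < x <= rootr l t)%R then
     \int[mu]_y (if b (x, y) then 1 else 0) else 0); last first.
    case: ifPn => // /andP[sx _]; rewrite integral_section// mul1e.
    by rewrite (le_lt_trans (rootr_ge0 _ _) sx).
  have [x0|x0] := leP x 0%R.
    rewrite [RHS](_ : _ = 0); last first.
      by case: ifPn => // /andP[_ _]; rewrite integral_section// ltNge x0.
    apply: integral0_eq => y _; rewrite patchE mem_xsection.
    case: ifPn => //; rewrite in_phi in_itv/= /phi /b /= (ltNge 0%R x) x0/= => /andP[+ _].
    by move=> /(le_lt_trans s0); rewrite ltr0N1.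
  case: ifPn => xst.
    apply: eq_integral => y _; rewrite patchE mem_xsection in_phi in_itv/= /phi.
    case: (boolP (b (x, y))) => bxy /=; last by rewrite ltNge (le_trans _ s0)// lerN10.
    case/andP: xst => sx xt; by rewrite -(ltr_rootr l0 s0 (ltW x0)) sx/= -(ler_rootr l0 t0 (ltW x0)) xt.
  apply: integral0_eq => y _; rewrite patchE mem_xsection in_phi in_itv/= /phi.
  case: (boolP (b (x, y))) => bxy /=; last by rewrite ltNge (le_trans _ s0)// lerN10.
  by rewrite -(ltr_rootr l0 s0 (ltW x0)) -(ler_rootr l0 t0 (ltW x0)) (negbTE xst).
rewrite integral_itv_obnd_cbnd; last first.
  by apply: measurable_funTS; apply/measurable_EFinP; exact: mg.
have cg : continuous g.
  move=> x; apply: cvgM; [exact: cvg_cst|exact: exprn_continuous].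
rewrite (@continuous_FTC2 _ g (fun x => x ^+ l)%R)//.
- by rewrite !rootrK.
- exact: continuous_subspaceT.
- split.
  + by move=> x _; exact: exprn_derivable.
  + by apply: cvg_at_right_filter; exact: exprn_continuous.
  + by apply: cvg_at_left_filter; exact: exprn_continuous.
- by move=> x _; rewrite exp_derive1.
Qed.

(** Uniqueness of Lebesgue measure concerns the whole line, so [nu] on [D] is glued to Lebesgue
    measure off [D]. *)
Let nuE (A : set R) : measurable A -> A `<=` D -> mu A = nu A.
Proof.
move=> mA AD.
have mDc : measurable (~` D) by exact: measurableC.
pose m3 : {measure set (measurableTypeR R) -> \bar R} :=
  measure_add (mrestr (pushforward (mu \x mu) phi : {measure set _ -> \bar R}) mD) (mrestr mu mDc).
have m3E B : m3 mphi B = nu (B `&` D) + mu (B `&` ~` D) by exact: measure_addE.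
have -> : mu A = m3 mphi A.
  apply: lebesgue_measure_unique => // _ [[s t] _ <-].
  rewrite m3E [in LHS]/= [`](_, _).1, _]%classic]/=.
  pose s' := Num.max s 0%R.
  have s'0 : (0 <= s')%R by rewrite le_max lexx orbT.
  have -> : `]s, t] `&` D = `]s', t]%classic.
    apply/seteqP; split => x; rewrite /D /= !in_itv/= /s' andbT gt_max.
      by move=> [/andP[-> ->] ->].
    by move=> /andP[/andP[-> ->] ->].
  have -> : `]s, t] `&` ~` D = `]s, Num.min t 0%R]%classic.
    apply/seteqP; split => x; rewrite /D /= !in_itv/= andbT le_min.
      by move=> [/andP[-> ->] /negP]; rewrite -leNgt.
    by move=> /andP[-> /andP[-> ?]]; split => //; apply/negP; rewrite -leNgt.
  have [ts'|s't] := leP t s'.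
    rewrite (_ : `]s', t]%classic = set0); last first.
      apply/seteqP; split => // x /=; rewrite in_itv/= => /andP[h1 h2].
      by move: (lt_le_trans h1 (le_trans h2 ts')); rewrite ltxx.
    rewrite {1}/nu /pushforward preimage_set0 measure0 add0e; congr (mu _); apply/seteqP; split => x /=; rewrite !in_itv/= le_min.
      move=> /andP[sx xt]; rewrite sx xt/=; move: ts'; rewrite le_max => /orP[ts|/(le_trans xt)//].
      by move: (lt_le_trans sx (le_trans xt ts)); rewrite ltxx.
    by move=> /andP[-> /andP[->]].
  rewrite nu_itv// !lebesgue_measure_itv/= !lte_fin.
  have t0 : (0 < t)%R by exact: le_lt_trans s't.
  have st : (s < t)%R by rewrite (le_lt_trans _ s't)// le_max lexx.
  rewrite st (min_r (ltW t0)) /s'; case: (ltP s 0%R) => s0.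
    by rewrite subr0 add0e.
  by rewrite adde0.
by rewrite m3E setIidl// (_ : A `&` ~` D = set0) ?measure0 ?adde0//; apply/disjoints_subset; rewrite setCK.
Qed.

(** In the integral against the pushforward, the second planar variable runs over (0, g x) with a
    constant integrand and supplies the Jacobian. *)
Lemma ge0_integral_exprn (u : R -> \bar R) :
  measurable_fun [set: R] u -> (forall x, 0 <= u x) ->
  \int[mu]_(x in `]0%R, +oo[) u x =
  \int[mu]_(y in `]0%R, +oo[) (u (y ^+ l)%R * (l%:R * y ^+ l.-1)%:E).
Proof.
move=> mu_ u0.
rewrite (eq_measure_integral (pushforward (mu \x mu) phi : {measure set _ -> \bar R})); last first.
  by move=> A mA AD; exact: nuE.
rewrite ge0_integral_pushforward//; last exact: measurable_funTS.
rewrite integral_mkcond fubini_tonelli1//; last 2 first.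
- apply/(measurable_restrictT _ _).1.
    by rewrite -[X in measurable X]setTI; exact: mphi.
  by apply: measurable_funTS; exact: measurableT_comp.
- by move=> p; rewrite patchE; case: ifPn => //= _; exact: u0.
rewrite [RHS]integral_mkcond; apply: eq_integral => x _.
rewrite patchE mem_setE in_itv/= andbT.
transitivity (\int[mu]_y (if b (x, y) then u (x ^+ l)%R else 0)).
  apply: eq_integral => y _; rewrite patchE.
  rewrite (_ : (_ \in _) = b (x, y)); last first.
    by rewrite in_phi in_itv/= andbT /phi; case: ifPn => [/and3P[x0 _ _]|]; rewrite ?ltr0N1 ?exprn_gt0//.
  by case: ifPn => // bxy; rewrite /= /phi bxy.
by rewrite integral_section//; case: ifPn.
Qed.

End exprn_substitution.

(** * The inequality for the root mean, in all dimensions *)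

Section prekopa_leindler_nd.
Local Open Scope ereal_scope.
Context {R : realType}.
Local Notation mu := (@lebesgue_measure R).
Variable l : nat.
Hypothesis l0 : (0 < l)%N.

Definition rmean (x y : R) : R := (((rootr l x + rootr l y) / 2) ^+ l)%R.

(* The Jacobian defect of the mean [rmean]: the square of the density
   [y ^+ l.-1] at the midpoint divided by its values at the two end points. *)
Definition rdefect (x y : R) : R :=
  ((((rootr l x + rootr l y) / 2) ^+ 2 / (rootr l x * rootr l y)) ^+ l.-1)%R.

Definition rmean_rV n (x y : 'rV[R]_n) : 'rV[R]_n :=
  \row_i rmean (x ord0 i) (y ord0 i).

Definition rdefect_rV n (x y : 'rV[R]_n) : R :=
  (\prod_i rdefect (x ord0 i) (y ord0 i))%R.

Lemma rdefect_gt0 x y : (0 < x)%R -> (0 < y)%R -> (0 < rdefect x y)%R.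
Proof.
move=> x0 y0; rewrite /rdefect exprn_gt0// divr_gt0//.
  by rewrite exprn_gt0// divr_gt0// addr_gt0 ?rootr_gt0.
by rewrite mulr_gt0 ?rootr_gt0.
Qed.

Lemma rmean_gt0 x y : (0 < x)%R -> (0 < y)%R -> (0 < rmean x y)%R.
Proof. by move=> x0 y0; rewrite /rmean exprn_gt0// divr_gt0// addr_gt0 ?rootr_gt0. Qed.

(** Under x = y^l the mean [rmean] becomes the midpoint [m] of the roots [y], [z], and [rdefect] is
    exactly g(m)^2 / (g(y) g(z)) for the Jacobian [g]; the hypothesis thus becomes that of
    [prekopa_leindler_midpoint]. *)
Let prekopa_leindler1 (u v h : R -> \bar R) (B : R) :
  measurable_fun setT u -> measurable_fun setT v -> measurable_fun setT h ->
  (forall x, 0 <= u x <= B%:E) -> (forall x, 0 <= v x <= B%:E) ->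
  (forall x, u x != 0 -> (0 < x <= B)%R) ->
  (forall x, v x != 0 -> (0 < x <= B)%R) ->
  (forall x, 0 <= h x) ->
  (forall x y, (0 < x)%R -> (0 < y)%R ->
    u x * v y <= (rdefect x y)%:E * (h (rmean x y) * h (rmean x y))) ->
  (\int[mu]_x u x) * (\int[mu]_x v x) <= (\int[mu]_x h x) * (\int[mu]_x h x).
Proof.
move=> mu_ mv mh u0B v0B uS vS h0 uvh.
have u0 x : 0 <= u x by case/andP: (u0B x).
have v0 x : 0 <= v x by case/andP: (v0B x).
pose g (y : R) : R := (l%:R * y ^+ l.-1)%R.
have g0 y : (0 <= y)%R -> (0 <= g y)%R by move=> ?; rewrite mulr_ge0// exprn_ge0.
pose t (w : R -> \bar R) (y : R) := if (0 < y)%R then w (y ^+ l)%R * (g y)%:E else 0.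
have t0 w y : (forall x, 0 <= w x) -> 0 <= t w y.
  move=> w0; rewrite /t; case: ifPn => // y0; rewrite mule_ge0// lee_fin g0// ltW//.
have mt w : measurable_fun setT w -> measurable_fun setT (t w).
  move=> mw; apply: measurable_fun_ifT => //; first exact: measurable_fun_ltr.
  apply: emeasurable_funM; first by apply: measurableT_comp => //; exact: measurable_funX.
  by apply/measurable_EFinP; apply: measurable_funM => //; exact: measurable_funX.
have It w : measurable_fun setT w -> (forall x, 0 <= w x) ->
    \int[mu]_(x in `]0%R, +oo[) w x = \int[mu]_x t w x.
  move=> mw w0; rewrite (ge0_integral_exprn l0)// integral_mkcond.
  by apply: eq_integral => y _; rewrite patchE mem_setE in_itv/= andbT /t; case: ifPn.
have Is w : (forall x, w x != 0 -> (0 < x <= B)%R) ->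
    \int[mu]_x w x = \int[mu]_(x in `]0%R, +oo[) w x.
  move=> wS; rewrite [RHS]integral_mkcond; apply: eq_integral => x _.
  rewrite patchE mem_setE in_itv/= andbT; case: ifPn => // x0.
  by apply/eqP/negPn/negP => /wS /andP[x0' _]; rewrite x0' in x0.
have Ih : \int[mu]_x t h x <= \int[mu]_x h x.
  rewrite -It//; apply: ge0_subset_integral => //.
rewrite (Is u)// (Is v)// (It u)// (It v)//.
apply: le_trans (_ : (\int[mu]_x t h x) * (\int[mu]_x t h x) <= _); last first.
  by apply: lee_pmul => //; apply: integral_ge0 => x _; exact: t0.
(* On the support either [y <= 1] or [y <= y ^+ l <= B], which bounds the Jacobian; the maximum with
   0 covers the points where [t w] vanishes. *)
pose B' := (Num.max 0 (B * (l%:R * (Num.max 1 B) ^+ l.-1)))%R.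
have tB (w : R -> \bar R) : (forall x, 0 <= w x <= B%:E) ->
   (forall x, w x != 0 -> (0 < x <= B)%R) -> forall y, 0 <= t w y <= B'%:E.
  move=> w0B wS y; apply/andP; split.
    by apply: t0 => x; case/andP: (w0B x).
  rewrite /t; case: ifPn => [y0|_]; last by rewrite lee_fin /B' le_max lexx.
  have [w0|w0] := eqVneq (w (y ^+ l)%R) 0.
    by rewrite w0 mul0e lee_fin /B' le_max lexx.
  have /andP[_ ylB] := wS _ w0.
  have yB : (y <= Num.max 1 B)%R.
    rewrite le_max; have [//|y1] := leP y 1%R; rewrite (le_trans _ ylB)//.
    by rewrite -{1}(expr1 y) ler_weXn2l// ltW.
  apply: (@le_trans _ _ (B%:E * (l%:R * (Num.max 1 B) ^+ l.-1)%:E)).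
    apply: lee_pmul => //; [by case/andP: (w0B (y ^+ l)%R)|by rewrite lee_fin g0// ltW|by case/andP: (w0B (y ^+ l)%R)|].
    by rewrite lee_fin /g ler_wpM2l// lerXn2r// nnegrE ?(ltW y0)// (le_trans (ltW y0)).
  by rewrite -EFinM lee_fin /B' le_max lexx orbT.
apply: (@prekopa_leindler_midpoint _ _ _ _ B').
- exact: mt.
- exact: mt.
- exact: mt.
- exact: tB.
- exact: tB.
- by move=> x; exact: t0.
move=> y z; rewrite /t.
case: ifPn => [y0|_]; last first.
  by rewrite mul0e mule_ge0//; case: ifPn => // m0; rewrite mule_ge0// lee_fin g0// ltW.
case: ifPn => [z0|_]; last first.
  by rewrite mule0 mule_ge0//; case: ifPn => // m0; rewrite mule_ge0// lee_fin g0// ltW.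
have m0 : (0 < (y + z) / 2)%R by rewrite divr_gt0// addr_gt0.
rewrite m0.
have := uvh _ _ (exprn_gt0 l y0) (exprn_gt0 l z0).
rewrite /rmean /rdefect (exprnK l0 (ltW y0)) (exprnK l0 (ltW z0)); set m := ((y + z) / 2)%R => uvm.
rewrite muleACA -EFinM [leRHS]muleACA -EFinM.
have gyz : (0 < g y * g z)%R by rewrite !mulr_gt0 ?exprn_gt0 ?ltr0n.
apply: (@le_trans _ _ ((((m ^+ 2 / (y * z)) ^+ l.-1)%:E * (h (m ^+ l)%R * h (m ^+ l)%R)) * (g y * g z)%:E)).
  by rewrite lee_pmul2r ?lte_fin.
rewrite [leLHS]muleAC -EFinM muleC (_ : _ * (g y * g z) = g m * g m)%R//.
rewrite /g (_ : _ * _ = (l%:R * l%:R) * ((m ^+ 2 / (y * z)) * (y * z)) ^+ l.-1)%R; last first.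
  by rewrite !exprMn; ring.
rewrite divfK ?mulf_neq0 ?lt0r_neq0// exprAC; ring.
Qed.

Lemma ge0_integral_cons_rV n (f : 'rV[R]_n.+1 -> \bar R) :
  measurable_fun setT f -> (forall x, 0 <= f x) ->
  \int[@borel_lebesgue_rV R n.+1]_x f x =
  \int[mu]_a \int[@borel_lebesgue_rV R n]_v f (cons_rV (a, v)).
Proof.
move=> mf f0.
transitivity (\int[pushforward (mu \x (@borel_lebesgue_rV R n)) (@cons_rV R n)]_x f x) => //.
rewrite ge0_integral_pushforward//; last exact: measurable_cons_rV.
rewrite preimage_setT fubini_tonelli1//; last by move=> x; exact: f0.
by apply: measurableT_comp => //; exact: measurable_cons_rV.
Qed.

Lemma measurable_fun_cons_rV n d (T : measurableType d) (f : 'rV[R]_n.+1 -> T) a :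
  measurable_fun setT f -> measurable_fun setT (fun v => f (cons_rV (a, v))).
Proof.
move=> mf; apply: measurableT_comp => //.
apply: (measurableT_comp (@measurable_cons_rV R n)); exact: measurable_pair1.
Qed.

Lemma measurable_integral_cons_rV n (f : 'rV[R]_n.+1 -> \bar R) :
  measurable_fun setT f -> (forall x, 0 <= f x) ->
  measurable_fun setT (fun a : measurableTypeR R =>
    \int[@borel_lebesgue_rV R n]_v f (cons_rV (a, v))).
Proof.
move=> mf f0.
apply: (@measurable_fun_fubini_tonelli_F _ _ _ _ _ (@borel_lebesgue_rV R n) (f \o @cons_rV R n)) => //; last by move=> x; exact: f0.
by apply: measurableT_comp => //; exact: measurable_cons_rV.
Qed.

Lemma rmean_cons_rV n a b (v w : 'rV[R]_n) :
  rmean_rV (cons_rV (a, v)) (cons_rV (b, w)) = cons_rV (rmean a b, rmean_rV v w).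
Proof.
apply/rowP => i; rewrite mxE; case: (unliftP ord0 i) => [j ->|->].
  by rewrite !cons_rVS mxE.
by rewrite !cons_rV0.
Qed.

Lemma rdefect_cons_rV n a b (v w : 'rV[R]_n) :
  rdefect_rV (cons_rV (a, v)) (cons_rV (b, w)) = (rdefect a b * rdefect_rV v w)%R.
Proof.
rewrite /rdefect_rV big_ord_recl !cons_rV0; congr (_ * _)%R.
by apply: eq_bigr => i _; rewrite !cons_rVS.
Qed.

Lemma cons_rV_positive n a (v : 'rV[R]_n) :
  positive_orthant R n.+1 (cons_rV (a, v)) <-> (0 < a)%R /\ positive_orthant R n v.
Proof.
split=> [h|[a0 v0] i].
  split=> [|i]; first by have := h ord0; rewrite cons_rV0.
  by have := h (lift ord0 i); rewrite cons_rVS.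
case: (unliftP ord0 i) => [j ->|->]; first by rewrite cons_rVS.
by rewrite cons_rV0.
Qed.

(** Induction on the dimension: for fixed first coordinates [a] and [b], the conclusion for the
    slices is the one-dimensional hypothesis for the marginals. The bound and the support condition
    keep the marginals bounded, so that the step can be repeated. *)
Theorem prekopa_leindler n (u v h : 'rV[R]_n -> \bar R) (B : R) :
  measurable_fun setT u -> measurable_fun setT v -> measurable_fun setT h ->
  (forall x, 0 <= u x <= B%:E) -> (forall x, 0 <= v x <= B%:E) ->
  (forall x, u x != 0 -> forall i, (0 < x ord0 i <= B)%R) ->
  (forall x, v x != 0 -> forall i, (0 < x ord0 i <= B)%R) ->
  (forall x, 0 <= h x) ->
  (forall x y, positive_orthant R n x -> positive_orthant R n y ->
    u x * v y <= (rdefect_rV x y)%:E * (h (rmean_rV x y) * h (rmean_rV x y))) ->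
  (\int[@borel_lebesgue_rV R n]_x u x) * (\int[@borel_lebesgue_rV R n]_x v x) <=
  (\int[@borel_lebesgue_rV R n]_x h x) * (\int[@borel_lebesgue_rV R n]_x h x).
Proof.
elim: n u v h B => [|n IH] u v h B mu_ mv mh u0B v0B uS vS h0 uvh.
  have I0 w : measurable_fun setT w -> \int[@borel_lebesgue_rV R 0]_x w x = w 0%R.
    move=> mw; rewrite -[X in \int[X]_x _]/(\d_(0%R : 'rV[R]_0)).
    by rewrite integral_dirac// diracE in_setT mul1e.
  rewrite !I0//; have := uvh 0%R 0%R.
  rewrite /rdefect_rV big_ord0 mul1e (_ : rmean_rV _ _ = 0%R); last by apply/rowP => -[].
  by apply; move=> -[].
have u0 x : 0 <= u x by case/andP: (u0B x).
have v0 x : 0 <= v x by case/andP: (v0B x).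
rewrite (ge0_integral_cons_rV mu_ u0) (ge0_integral_cons_rV mv v0) (ge0_integral_cons_rV mh h0).
(* A marginal is at most [B] times the volume of the box (0, B]^n; the maximum with [B] preserves
   the support condition on the first coordinate. *)
pose B' := (Num.max B (B * (Num.max 0 B) ^+ n))%R.
have bnd (w : 'rV[R]_n.+1 -> \bar R) : measurable_fun setT w -> (forall x, 0 <= w x <= B%:E) ->
    (forall x, w x != 0 -> forall i, (0 < x ord0 i <= B)%R) ->
    forall a, 0 <= \int[@borel_lebesgue_rV R n]_v w (cons_rV (a, v)) <= B'%:E.
  move=> mw w0B wS a.
  have w0 x : 0 <= w x by case/andP: (w0B x).
  have B0 : (0 <= B)%R.
    by rewrite -lee_fin; case/andP: (w0B 0%R) => h1 h2; exact: le_trans h1 h2.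
  rewrite integral_ge0//=.
  pose box := [set v : 'rV[R]_n | forall i, `]0%R, B]%classic (v ord0 i)].
  have mbox : measurable box.
    rewrite (_ : box = \bigcap_(i in [set: 'I_n])
        ((fun v : 'rV[R]_n => v ord0 i : measurableTypeR R) @^-1` `]0%R, B])); last first.
      by apply/seteqP; split => [z h1 i _|z h1 i]; [exact: h1|exact: (h1 i I)].
    apply: fin_bigcap_measurable => // i _; rewrite -[X in measurable X]setTI.
    apply: measurable_coord => //; exact: measurable_itv.
  apply: (@le_trans _ _ (\int[@borel_lebesgue_rV R n]_(v in box) B%:E)).
    rewrite [leRHS]integral_mkcond; apply: ge0_le_integral => //.
    - exact: measurable_fun_cons_rV.
    - by apply/(measurable_restrictT _ _).1 => //; exact: measurable_cst.
    - move=> v0' _; rewrite patchE; case: ifPn => [_|]; first by case/andP: (w0B (cons_rV (a, v0'))).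
      rewrite notin_setE => vbox; rewrite (_ : w _ = 0)//.
      apply/eqP/negPn/negP => /wS h1; apply: vbox => i /=.
      by rewrite in_itv/=; have := h1 (lift ord0 i); rewrite cons_rVS.
  have boxE : borel_lebesgue_rV box = (B ^+ n)%:E.
    rewrite /box (@borel_lebesgue_rV_box _ _ (fun=> `]0%R, B]%classic))//.
    rewrite (eq_bigr (fun=> B%:E)); last first.
      move=> i _; rewrite lebesgue_measure_itv/= lte_fin oppr0 adde0.
      by case: ltgtP B0 => // <-.
    transitivity (\prod_(i < n) B)%R%:E; last by rewrite prodr_const card_ord.
    by apply/esym/(big_morph EFin EFinM erefl).
  rewrite integral_cst// [X in _ * X]boxE -EFinM lee_fin le_max; apply/orP; right.
  by rewrite max_r.
apply: (@prekopa_leindler1 _ _ _ B').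
- exact: measurable_integral_cons_rV.
- exact: measurable_integral_cons_rV.
- exact: measurable_integral_cons_rV.
- exact: bnd.
- exact: bnd.
- move=> a; apply: contraNT => aB; apply/eqP/integral0_eq => w _.
  apply/eqP/negPn/negP => /uS /(_ ord0); rewrite cons_rV0 => /andP[a0 aB'].
  by move: aB; rewrite a0/= le_max aB'.
- move=> a; apply: contraNT => aB; apply/eqP/integral0_eq => w _.
  apply/eqP/negPn/negP => /vS /(_ ord0); rewrite cons_rV0 => /andP[a0 aB'].
  by move: aB; rewrite a0/= le_max aB'.
- by move=> a; exact: integral_ge0.
move=> a b a0 b0.
(* The defect is a product over coordinates and [h] enters twice, so each copy of [h] takes the
   square root of the first factor. *)
pose c := Num.sqrt (rdefect a b).
have c0 : (0 <= c)%R by rewrite sqrtr_ge0.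
have cc : (c * c = rdefect a b)%R by rewrite -expr2 sqr_sqrtr// ltW// rdefect_gt0.
pose h' w := c%:E * h (cons_rV (rmean a b, w)).
have Ih' : \int[@borel_lebesgue_rV R n]_w h' w =
    c%:E * \int[@borel_lebesgue_rV R n]_w h (cons_rV (rmean a b, w)).
  by rewrite ge0_integralZl_EFin//; exact: measurable_fun_cons_rV.
rewrite -cc EFinM muleACA -!Ih'.
apply: (IH _ _ _ B).
- exact: measurable_fun_cons_rV.
- exact: measurable_fun_cons_rV.
- by apply: measurable_funeM; exact: measurable_fun_cons_rV.
- by [].
- by [].
- by move=> w /uS h1 i; have := h1 (lift ord0 i); rewrite cons_rVS.
- by move=> w /vS h1 i; have := h1 (lift ord0 i); rewrite cons_rVS.
- by move=> w; rewrite mule_ge0.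
move=> x y x0 y0; have -> : (rdefect_rV x y)%:E * (h' (rmean_rV x y) * h' (rmean_rV x y)) =
    (c * c * rdefect_rV x y)%:E * (h (cons_rV (rmean a b, rmean_rV x y)) *
      h (cons_rV (rmean a b, rmean_rV x y))).
  have -> : h' (rmean_rV x y) = c%:E * h (cons_rV (rmean a b, rmean_rV x y)) by [].
  by rewrite !EFinM (muleACA c%:E _ c%:E) [LHS]muleA (muleC (rdefect_rV x y)%:E).
by rewrite cc -rdefect_cons_rV -rmean_cons_rV; apply: uvh; apply/cons_rV_positive.
Qed.

End prekopa_leindler_nd.

(** * From Prekopa-Leindler to a variance inequality *)

Section variance.
Context {R : realType}.

(** The difference of the two sides vanishes at 0 and has derivative (e^x - 1)^2 e^(-x). *)
Lemma expR_sinh_ge (s : R) : 0 <= s -> 2 * s <= expR s - expR (- s).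
Proof.
move=> s0; pose f (x : R) := expR x - expR (- x) - 2 * x.
have df (x : R) : is_derive x 1 f (expR x + expR (- x) - 2).
  rewrite /f; apply: is_derive_eq.
  by rewrite /GRing.scale/= !(mulrN, mulNr, mulr1, opprK, mulr0, mul0r, add0r, addr0).
suff : f 0 <= f s by rewrite /f oppr0 subrr mulr0 subr0 subr_ge0.
apply: (@ger0_derive1_le_cc _ f 0 s).
- by move=> x _; have [] := df x.
- move=> x _; rewrite derive1E; have [_ ->] := df x.
  rewrite (_ : _ - 2 = (expR x - 1) ^+ 2 * expR (- x)).
    by rewrite mulr_ge0 ?sqr_ge0 ?expR_ge0.
  rewrite sqrrB1 mulrDl mulrBl mul1r expr2 -mulrA expRxMexpNx_1 mulr1.
  by rewrite mulrnAl expRxMexpNx_1; ring.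
- apply: continuous_subspaceT => x; apply: differentiable_continuous.
  by apply/derivable1_diffP; have [] := df x.
- by rewrite in_itv/= lexx.
- by rewrite in_itv/= s0 lexx.
- by [].
Qed.

(** The square of [expR_sinh_ge] at [t / 2], since e^t + e^(-t) - 2 is (e^(t/2) - e^(-t/2))^2. *)
Lemma expR_cosh_ge (t : R) : 2 + t ^+ 2 <= expR t + expR (- t).
Proof.
wlog t0 : t / 0 <= t.
  move=> h; have [/h//|t0] := leP 0 t.
  by have := h (- t); rewrite oppr_ge0 ltW// sqrrN opprK addrC [leRHS]addrC; apply.
have s0 : 0 <= t / 2 by rewrite divr_ge0.
have := expR_sinh_ge s0; rewrite mulrC divfK ?pnatr_eq0// => h.
have h2 : t ^+ 2 <= (expR (t / 2) - expR (- (t / 2))) ^+ 2.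
  by rewrite lerXn2r ?nnegrE// (le_trans t0).
have e1 : expR t = expR (t / 2) * expR (t / 2) by rewrite -expRD; congr expR; field.
have e2 : expR (- t) = expR (- (t / 2)) * expR (- (t / 2)) by rewrite -expRD; congr expR; field.
have e3 := expRxMexpNx_1 (t / 2).
rewrite e1 e2; move: h2; rewrite sqrrB e3 !expr2; lra.
Qed.

(** From e^t <= 1 / (1 - t), because (1 + t + 2 t^2) (1 - t) = 1 + t^2 (1 - 2 t) is at least 1 up to
    t = 1/2. *)
Lemma expR_le_quadratic (t : R) : 0 <= t <= 2^-1 -> expR t <= 1 + t + 2 * t ^+ 2.
Proof.
move=> /andP[t0 t1].
have ht : 0 < 1 - t by lra.
have h : expR t <= (1 - t)^-1.
  rewrite -(invrK (expR t)) lef_pV2 ?posrE ?invr_gt0 ?expR_gt0//.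
  by rewrite -expRN; have := expR_ge1Dx (- t).
apply: le_trans h _; rewrite -[leLHS]mul1r ler_pdivrMr//.
have : 0 <= t ^+ 2 * (1 - 2 * t) by rewrite mulr_ge0 ?sqr_ge0//; lra.
rewrite !expr2; lra.
Qed.

Variable l : nat.
Hypothesis l0 : (0 < l)%N.
Variable n : nat.
Local Notation mu := (@borel_lebesgue_rV R n).

Lemma borel_lebesgue_rV_bounded (D : set 'rV[R]_n) (B : R) : measurable D ->
  (forall x, D x -> forall i, 0 < x ord0 i <= B) -> (mu D < +oo)%E.
Proof.
move=> mD DB.
pose box := [set v : 'rV[R]_n | forall i, `]0, B]%classic (v ord0 i)].
have mbox : measurable box.
  rewrite (_ : box = \bigcap_(i in [set: 'I_n])
      ((fun v : 'rV[R]_n => v ord0 i : measurableTypeR R) @^-1` `]0, B])); last first.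
    by apply/seteqP; split => [z h1 i _|z h1 i]; [exact: h1|exact: (h1 i I)].
  apply: fin_bigcap_measurable => // i _; rewrite -[X in measurable X]setTI.
  apply: measurable_coord => //; exact: measurable_itv.
apply: (@le_lt_trans _ _ (mu box)).
  by apply: le_measure; rewrite ?inE// => x /DB h i /=; rewrite in_itv/=.
rewrite /box (@borel_lebesgue_rV_box _ _ (fun=> `]0, B]%classic))//.
rewrite (_ : (\prod_i _)%E = (\prod_(i < n) fine (lebesgue_measure `]0%R, B]%classic))%:E) ?ltry//.
rewrite (big_morph EFin EFinM erefl); apply: eq_bigr => i _; rewrite fineK//.
rewrite lebesgue_measure_itv/=; by case: ifP.
Qed.

(* Linearisation of Prekopa-Leindler: with [u = e^(eps g)], [v = e^(-eps g)] and
   [h = e^(eps^2 (q + eta) / 2)], the terms of order [eps^2] give the claim. *)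
Lemma variance_le_of_defect (D : set 'rV[R]_n) (g q : 'rV[R]_n -> R) (B C : R) :
  measurable D ->
  (forall x, D x -> forall i, 0 < x ord0 i <= B) ->
  (forall x y, D x -> D y -> D (rmean_rV l x y)) ->
  measurable_fun setT g -> measurable_fun setT q ->
  (forall x, D x -> `|g x| <= C) -> (forall x, D x -> 0 <= q x <= C) ->
  (forall eta, 0 < eta -> exists2 e0, 0 < e0 & forall e, 0 < e -> e < e0 ->
     forall x y, D x -> D y ->
     expR (e * (g x - g y)) <=
       rdefect_rV l x y * expR (e ^+ 2 * (q (rmean_rV l x y) + eta))) ->
  fine (mu D) * \int[mu]_(x in D) (g x ^+ 2) - (\int[mu]_(x in D) g x) ^+ 2 <=
  fine (mu D) * \int[mu]_(x in D) q x.
Proof.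
move=> mD DB Dmean mg mq gC qC hyp.
have muDoo := borel_lebesgue_rV_bounded mD DB.
have integ (f : 'rV[R]_n -> R) M : measurable_fun setT f ->
    (forall x, D x -> `|f x| <= M) -> mu.-integrable D (EFin \o f).
  move=> mf fM; apply: measurable_bounded_integrable => //.
    exact: measurable_funTS.
  exists M; split; first by rewrite num_real.
  by move=> M' MM' x Dx /=; rewrite (le_trans (fM x Dx))// ltW.
set V := fine (mu D).
have V0 : 0 <= V by rewrite fine_ge0.
have muDE : mu D = V%:E by rewrite fineK// ge0_fin_numE.
have ig := integ g C mg gC.
have iq : mu.-integrable D (EFin \o q).
  apply: (integ q C mq) => x Dx; have /andP[q0 qC'] := qC x Dx; by rewrite ger0_norm.
have [V00|Vpos] := eqVneq V 0.
  rewrite V00 !mul0r sub0r oppr_le0 sqr_ge0//.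
have {}Vpos : 0 < V by rewrite lt_neqAle eq_sym Vpos.
(* Centring: [f] has integral zero on [D], so the terms of first order in [e] vanish, and [V * J] is
   the left-hand side of the claim ([JE]). *)
pose c := V^-1 * \int[mu]_(x in D) g x.
pose f x := g x - c.
have mf : measurable_fun setT f by exact: measurable_funB.
pose K := C + `|c|.
have fK x : D x -> `|f x| <= K.
  by move=> Dx; rewrite (le_trans (ler_normB _ _))// lerD2r gC.
have ifi := integ f K mf fK.
have cstE (k : R) : \int[mu]_(x in D) k = k * V by rewrite Rintegral_cst.
have icst (k : R) : mu.-integrable D (EFin \o cst k).
  by apply: (integ _ `|k|) => //; exact: measurable_cst.
have mf2 : measurable_fun setT (fun x => f x ^+ 2) by exact: measurable_funX.
have mg2 : measurable_fun setT (fun x => g x ^+ 2) by exact: measurable_funX.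
have if2 : mu.-integrable D (EFin \o (fun x => f x ^+ 2)).
  apply: (integ _ (K ^+ 2)) => // x Dx; rewrite normrX lerXn2r ?nnegrE ?fK//.
  exact: le_trans (normr_ge0 _) (fK _ Dx).
have ig2 : mu.-integrable D (EFin \o (fun x => g x ^+ 2)).
  apply: (integ _ (C ^+ 2)) => // x Dx; rewrite normrX lerXn2r ?nnegrE ?gC//.
  exact: le_trans (normr_ge0 _) (gC _ Dx).
have f0 : \int[mu]_(x in D) f x = 0.
  transitivity (\int[mu]_(x in D) g x - \int[mu]_(x in D) c).
    exact: (RintegralB mD ig (icst c)).
  by rewrite cstE /c mulrAC mulVf ?lt0r_neq0// mul1r subrr.
set J := \int[mu]_(x in D) (f x ^+ 2).
set Q := \int[mu]_(x in D) q x.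
have JE : V * J = V * \int[mu]_(x in D) (g x ^+ 2) - (\int[mu]_(x in D) g x) ^+ 2.
  have icg : mu.-integrable D (EFin \o (fun x => 2 * c * g x)).
    apply: (integ _ (`|2 * c| * C)); first by apply: measurable_funM.
    by move=> x Dx; rewrite normrM ler_wpM2l// gC.
  have icg2 : mu.-integrable D (EFin \o (fun x => g x ^+ 2 - 2 * c * g x)).
    exact: (@integrableB _ _ _ mu D mD (EFin \o _) (EFin \o _)).
  have -> : J = \int[mu]_(x in D) (g x ^+ 2) - 2 * c * \int[mu]_(x in D) g x + c ^+ 2 * V.
    rewrite -cstE -RintegralZl//.
    transitivity (\int[mu]_(x in D) (g x ^+ 2 - 2 * c * g x) + \int[mu]_(x in D) c ^+ 2).
      transitivity (\int[mu]_(x in D) ((g x ^+ 2 - 2 * c * g x) + c ^+ 2)); last exact: (RintegralD mD icg2 (icst (c ^+ 2))).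
      by apply: eq_Rintegral => x _; rewrite /f; ring.
    by congr (_ + _); exact: (RintegralB mD ig2 icg).
  rewrite /c; field; exact: lt0r_neq0.
rewrite -JE.
suff key eta : 0 < eta -> V * J <= V * (Q + eta * V).
  rewrite ler_pM2l//; apply/ler_addgt0Pr => e e0.
  have := key (e / V) (divr_gt0 e0 Vpos).
  by rewrite ler_pM2l// divfK ?lt0r_neq0.
move=> eta0.
have [e0 e00 he] := hyp eta eta0.
have [d Dd] : exists d, D d.
  apply/set0P; apply: contra_neq (lt0r_neq0 Vpos) => D0.
  by rewrite /V D0 measure0.
have C0 : 0 <= C by case/andP: (qC d Dd) => h1 h2; exact: le_trans h1 h2.
have K0 : 0 <= K by rewrite addr_ge0.
(* [e^2 M] bounds the exponent of [h]. For [e <= 1], what the final estimate leaves beyond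
   [V (Q + eta V)] is at most [e^2 W]. *)
pose M := (C + eta) / 2.
have M0 : 0 <= M by rewrite divr_ge0// addr_ge0// ltW.
pose Z1 := (Q + eta * V) / 2 + 2 * M ^+ 2 * V.
pose W := 4 * M ^+ 2 * V ^+ 2 + Z1 ^+ 2.
have Q0 : 0 <= Q by apply: Rintegral_ge0 => x /qC /andP[].
have W0 : 0 <= W.
  by apply: addr_ge0; [apply: mulr_ge0; [apply: mulr_ge0 => //|]|]; exact: sqr_ge0.
apply/ler_addgt0Pr => delta delta0.
(* The four bounds give, in turn: [e < e0]; [e^2 <= e]; an exponent of [h] at most 1/2, as
   [expR_le_quadratic] requires; a remainder at most [delta]. *)
pose e := Num.min (Num.min (e0 / 2) 1) (Num.min (2 * (M + 1))^-1 (delta / (W + 1))).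
have M1 : 0 < 2 * (M + 1) by lra.
have W1 : 0 < W + 1 by lra.
have e_gt0 : 0 < e by rewrite !lt_min ltr01 invr_gt0 M1 !divr_gt0.
have ee0 : e < e0.
  by rewrite (@le_lt_trans _ _ (e0 / 2))// ?ge_min ?lexx//; lra.
have e1 : e <= 1 by rewrite !ge_min lexx orbT.
have eM : e * (2 * (M + 1)) <= 1.
  by rewrite -ler_pdivlMr// mul1r /e !ge_min lexx !orbT.
have eW : e * (W + 1) <= delta by rewrite -ler_pdivlMr// /e !ge_min lexx !orbT.
clearbody e.
have ege0 := ltW e_gt0.
have e2e : e ^+ 2 <= e by rewrite expr2 ler_piMr.
have e2M : e ^+ 2 * M <= 2^-1.
  rewrite (@le_trans _ _ (e * M))//; first by rewrite ler_wpM2r.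
  move: eM; rewrite mulrCA mulrDr mulr1; lra.
pose u x := expR (e * f x); pose v x := expR (- (e * f x)).
pose h x := expR (e ^+ 2 * (q x + eta) / 2).
have mef : measurable_fun setT (fun x => e * f x) by exact: measurable_funM.
have mu_ : measurable_fun setT u by apply: measurableT_comp => //; exact: measurable_expR.
have mv : measurable_fun setT v.
  by apply: measurableT_comp; [exact: measurable_expR|exact: measurable_funN].
have mtau : measurable_fun setT (fun x => e ^+ 2 * (q x + eta) / 2).
  by apply: measurable_funM => //; apply: measurable_funM => //; exact: measurable_funD.
have mh : measurable_fun setT h by apply: measurableT_comp => //; exact: measurable_expR.
have uB x : D x -> `|u x| <= expR (e * K).
  move=> Dx; rewrite ger0_norm ?expR_ge0// ler_expR ler_wpM2l//.
  exact: le_trans (ler_norm _) (fK x Dx).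
have vB x : D x -> `|v x| <= expR (e * K).
  move=> Dx; rewrite ger0_norm ?expR_ge0// ler_expR -mulrN ler_wpM2l//.
  by rewrite (le_trans (ler_norm _))// normrN fK.
have tauB x : D x -> 0 <= e ^+ 2 * (q x + eta) / 2 <= e ^+ 2 * M.
  move=> Dx; have /andP[q0 qc] := qC x Dx.
  rewrite divr_ge0 ?mulr_ge0 ?addr_ge0 ?sqr_ge0 ?(ltW eta0)//= -mulrA.
  by rewrite ler_wpM2l ?sqr_ge0// ler_pM2r// lerD2r.
have hB x : D x -> `|h x| <= expR (2^-1).
  move=> Dx; rewrite ger0_norm ?expR_ge0// ler_expR (le_trans _ e2M)//.
  by case/andP: (tauB x Dx).
have iu := integ _ _ mu_ uB.
have iv := integ _ _ mv vB.
have ih := integ _ _ mh hB.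
set a := \int[mu]_(x in D) u x.
set b := \int[mu]_(x in D) v x.
set H := \int[mu]_(x in D) h x.
have toE (w : 'rV[R]_n -> R) : mu.-integrable D (EFin \o w) ->
    (\int[mu]_x ((EFin \o w) \_ D) x = (\int[mu]_(x in D) w x)%:E)%E.
  by move=> iw; rewrite -integral_mkcond fineK//; exact: integrable_fin_num.
have mtoE (w : 'rV[R]_n -> R) : measurable_fun setT w ->
    measurable_fun setT ((EFin \o w) \_ D).
  move=> mw; apply/(measurable_restrictT _ _).1 => //.
  by apply: measurable_funTS; exact/measurable_EFinP.
pose B' := Num.max B (expR (e * K)).
have abH : a * b <= H * H.
  rewrite -lee_fin !EFinM -(toE _ iu) -(toE _ iv) -(toE _ ih).
  apply: (prekopa_leindler l0 (B := B')).
  - exact: mtoE.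
  - exact: mtoE.
  - exact: mtoE.
  - move=> x; rewrite patchE; case: ifPn => [|_]; last by rewrite lexx lee_fin le_max expR_ge0 orbT.
    rewrite inE /= => Dx; rewrite !lee_fin expR_ge0/= le_max; apply/orP; right.
    by have := uB x Dx; rewrite ger0_norm ?expR_ge0.
  - move=> x; rewrite patchE; case: ifPn => [|_]; last by rewrite lexx lee_fin le_max expR_ge0 orbT.
    rewrite inE /= => Dx; rewrite !lee_fin expR_ge0/= le_max; apply/orP; right.
    by have := vB x Dx; rewrite ger0_norm ?expR_ge0.
  - move=> x; rewrite patchE; case: ifPn => [|_]; rewrite ?eqxx// inE => Dx _ i.
    by have /andP[-> /= xB] := DB x Dx i; rewrite le_max xB.
  - move=> x; rewrite patchE; case: ifPn => [|_]; rewrite ?eqxx// inE => Dx _ i.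
    by have /andP[-> /= xB] := DB x Dx i; rewrite le_max xB.
  - by move=> x; rewrite patchE; case: ifPn => //= _; rewrite lee_fin expR_ge0.
  move=> x y x0 y0.
  have R0 : (0 <= (rdefect_rV l x y)%:E *
     (((EFin \o h) \_ D) (rmean_rV l x y) * ((EFin \o h) \_ D) (rmean_rV l x y)))%E.
    rewrite mule_ge0//.
      by rewrite lee_fin prodr_ge0// => i _; rewrite ltW// rdefect_gt0.
    by rewrite mule_ge0// patchE; case: ifPn => //= _; rewrite lee_fin expR_ge0.
  rewrite !(patchE _ _ x) !(patchE _ _ y).
  case: ifPn => [|_]; last by rewrite mul0e.
  rewrite inE => Dx; case: ifPn => [|_]; last by rewrite mule0.
  rewrite inE => Dy; rewrite patchE mem_set; last exact: Dmean.
  rewrite /= -!EFinM lee_fin /u /v /h -!expRD.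
  rewrite (_ : e * f x + - (e * f y) = e * (g x - g y)); last by rewrite /f; ring.
  rewrite (_ : _ / 2 + _ = e ^+ 2 * (q (rmean_rV l x y) + eta)); last by field.
  exact: he.
(* Since [f] has integral zero, integrating e^s >= 1 + s gives this, and likewise the bound for
   [b]. *)
have aV : V <= a.
  have -> : V = \int[mu]_(x in D) (1 + e * f x).
    transitivity (\int[mu]_(x in D) 1 + \int[mu]_(x in D) (e * f x)).
      by rewrite cstE mul1r RintegralZl// f0 mulr0 addr0.
    by apply/esym; apply: (RintegralD mD (icst 1)); exact: (@integrableZl _ _ _ mu D mD e (EFin \o f)).
  apply: le_Rintegral => //; last by move=> x _; exact: expR_ge1Dx.
  apply: (integ _ (1 + e * K)); first exact: measurable_funD.
  move=> x Dx; rewrite (le_trans (ler_normD _ _))// normr1 lerD2l normrM (ger0_norm ege0).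
  by rewrite ler_wpM2l// fK.
have bV : V <= b.
  have -> : V = \int[mu]_(x in D) (1 + (- e) * f x).
    transitivity (\int[mu]_(x in D) 1 + \int[mu]_(x in D) ((- e) * f x)).
      by rewrite cstE mul1r RintegralZl// f0 mulr0 addr0.
    by apply/esym; apply: (RintegralD mD (icst 1)); exact: (@integrableZl _ _ _ mu D mD (- e) (EFin \o f)).
  apply: le_Rintegral => //; last by move=> x _; rewrite mulNr; exact: expR_ge1Dx.
  apply: (integ _ (1 + e * K)).
    by apply: measurable_funD => //; exact: measurable_funM.
  move=> x Dx; rewrite (le_trans (ler_normD _ _))// normr1 lerD2l normrM normrN (ger0_norm ege0).
  by rewrite ler_wpM2l// fK.
have abJ : 2 * V + e ^+ 2 * J <= a + b.
  have -> : a + b = \int[mu]_(x in D) (u x + v x) by rewrite RintegralD.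
  have i3 : mu.-integrable D (EFin \o (fun x => e ^+ 2 * f x ^+ 2)).
    exact: (@integrableZl _ _ _ mu D mD (e ^+ 2) (EFin \o (fun x => f x ^+ 2))).
  have -> : 2 * V + e ^+ 2 * J = \int[mu]_(x in D) (2 + e ^+ 2 * f x ^+ 2).
    rewrite -RintegralZl// -cstE; apply/esym; exact: (RintegralD mD (icst 2) i3).
  apply: le_Rintegral => //.
  - exact: (@integrableD _ _ _ mu D mD (EFin \o cst 2) (EFin \o _)).
  - exact: (@integrableD _ _ _ mu D mD (EFin \o u) (EFin \o v)).
  - by move=> x _; rewrite -exprMn; exact: expR_cosh_ge.
have HZ : H <= V + e ^+ 2 * ((Q + eta * V) / 2 + 2 * e ^+ 2 * M ^+ 2 * V).
  pose c1 := 1 + e ^+ 2 * eta / 2 + 2 * (e ^+ 2 * M) ^+ 2.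
  have i3 : mu.-integrable D (EFin \o (fun x => e ^+ 2 / 2 * q x)).
    exact: (@integrableZl _ _ _ mu D mD (e ^+ 2 / 2) (EFin \o q)).
  have -> : V + e ^+ 2 * ((Q + eta * V) / 2 + 2 * e ^+ 2 * M ^+ 2 * V) =
      \int[mu]_(x in D) (c1 + e ^+ 2 / 2 * q x).
    transitivity (\int[mu]_(x in D) c1 + \int[mu]_(x in D) (e ^+ 2 / 2 * q x)).
      by rewrite RintegralZl// cstE /c1 -/Q; field.
    apply/esym; exact: (RintegralD mD (icst c1) i3).
  apply: le_Rintegral => //.
    exact: (@integrableD _ _ _ mu D mD (EFin \o cst c1) (EFin \o _)).
  move=> x Dx; have /andP[t0 t1] := tauB x Dx.
  rewrite /h (le_trans (expR_le_quadratic _))//; first by rewrite t0 (le_trans t1).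
  have : (e ^+ 2 * (q x + eta) / 2) ^+ 2 <= (e ^+ 2 * M) ^+ 2.
    by rewrite lerXn2r// nnegrE (le_trans t0).
  rewrite /c1; lra.
set Z := _ / 2 + _ in HZ.
have Z0 : 0 <= Z.
  rewrite addr_ge0 ?mulr_ge0 ?divr_ge0 ?addr_ge0 ?mulr_ge0 ?sqr_ge0// ltW//.
have ZZ1 : Z <= Z1.
  rewrite /Z /Z1 lerD2l ler_wpM2r// ler_wpM2r ?sqr_ge0//.
  by rewrite ger_pMr// (le_trans e2e).
have H0 : 0 <= H by apply: Rintegral_ge0 => x _; exact: expR_ge0.
have HH : H * H <= (V + e ^+ 2 * Z) * (V + e ^+ 2 * Z) by rewrite ler_pM.
(* As [a] and [b] are at least [V], [a b >= V (a + b) - V^2 >= V^2 + e^2 V J]. Against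
   [(V + e^2 Z)^2] the terms [V^2] cancel and [e^2] can be divided out. *)
have ab1 : 0 <= (a - V) * (b - V) by rewrite mulr_ge0// subr_ge0.
have ab2 : V * (2 * V + e ^+ 2 * J) <= V * (a + b) by rewrite ler_wpM2l.
have step : e ^+ 2 * (V * J) <= e ^+ 2 * (2 * V * Z + e ^+ 2 * Z ^+ 2).
  move: ab1 ab2 HH abH; rewrite !expr2; lra.
have {}step : V * J <= 2 * V * Z + e ^+ 2 * Z ^+ 2.
  by move: step; rewrite ler_pM2l// exprn_gt0.
apply: le_trans step _.
have ZZ : Z ^+ 2 <= Z1 ^+ 2 by rewrite lerXn2r// nnegrE// (le_trans Z0).
have e2W : e ^+ 2 * W <= delta.
  apply: le_trans eW; apply: (@le_trans _ _ (e * W)); first by rewrite ler_wpM2r.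
  by rewrite ler_wpM2l// lerDl.
have : e ^+ 2 * Z ^+ 2 <= e ^+ 2 * Z1 ^+ 2 by rewrite ler_wpM2l// sqr_ge0.
move: e2W; rewrite /W /Z; lra.
Qed.

End variance.

(** * The gain of the density at a mean, against the increments of [g] *)

Section defect_bound.
Context {R : realType}.
Variable l : nat.
Hypothesis l1 : (1 < l)%N.
Let l0 : (0 < l)%N. Proof. exact: ltnW. Qed.
Local Notation L := (l%:R - 1 : R).
Let L0 : 0 < L. Proof. by rewrite subr_gt0 ltr1n. Qed.

Lemma ler_dist_expr (y z M : R) (k : nat) : `|y| <= M -> `|z| <= M ->
  `|y ^+ k - z ^+ k| <= `|y - z| * (k%:R * M ^+ k.-1).
Proof.
move=> yM zM; rewrite subrXX normrM ler_wpM2l//.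
rewrite (le_trans (ler_norm_sum _ _ _))//.
rewrite (@le_trans _ _ (\sum_(i < k) M ^+ k.-1))//; last first.
  by rewrite sumr_const card_ord mulr_natl.
apply: ler_sum => i _; have ik : (i <= k.-1)%N by rewrite -ltnS (leq_trans (ltn_ord i))// leqSpred.
rewrite normrM !normrX -[X in _ <= _ ^+ X](subnK ik) exprD.
have M0 : 0 <= M by exact: le_trans yM.
by rewrite ler_pM ?exprn_ge0// lerXn2r.
Qed.

(** With d = (p - q) / (p + q), 4 p q / (p + q)^2 = 1 - d^2 <= e^(-d^2); invert and raise to the
    power [l - 1]. This is the log-concavity of the density y^(l-1) in quantitative form, valid at
    all distances. *)
Lemma rdefect_lower (x y : R) : 0 < x -> 0 < y ->
  expR (L * ((rootr l x - rootr l y) / (rootr l x + rootr l y)) ^+ 2) <= rdefect l x y.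
Proof.
move=> x0 y0; rewrite /rdefect.
have := rootr_gt0 l x0; have := rootr_gt0 l y0.
set p := rootr l x; set q := rootr l y => q0 p0.
have LE : L = (l.-1)%:R by rewrite -subn1 natrB.
rewrite LE expRM_natl lerXn2r ?nnegrE ?expR_ge0//.
  by rewrite divr_ge0 ?sqr_ge0// mulr_ge0// ltW.
have pq : 0 < p + q by rewrite addr_gt0.
rewrite -[leLHS]invrK -expRN -[leRHS]invrK lef_pV2 ?posrE ?expR_gt0 ?invr_gt0//; last first.
  by rewrite divr_gt0 ?mulr_gt0// exprn_gt0// divr_gt0.
apply: le_trans (expR_ge1Dx _).
rewrite le_eqVlt; apply/orP; left; apply/eqP; field.
by rewrite !lt0r_neq0.
Qed.

Lemma continuous_small (f : R -> R) (e : R) : continuous f -> f 0 < e ->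
  exists2 r, 0 < r & f r < e.
Proof.
move=> cf f0e; have : \forall x \near (0 : R)^'+, f x < e.
  have := cf 0 => /(cvgr_lt _) /(_ _ f0e); exact: cvg_within.
move=> near; near (0 : R)^'+ => r; exists r; [by []|by near: r].
Unshelve. all: by end_near. Qed.

Variable n : nat.

Definition shift_rV (k : 'I_n) (t : R) (x : 'rV[R]_n) : 'rV[R]_n :=
  x + t *: delta_mx ord0 k.

Lemma shift_rVE k t x i : shift_rV k t x ord0 i = x ord0 i + t * (i == k)%:R.
Proof. by rewrite !mxE. Qed.

(** [A k] acts as the k-th partial derivative of [g], with an error linear in the distance [r] to a
    reference point [m]. If the roots of [x] and [y] are more than [rho] apart in some coordinate,
    the defect alone beats [e (g x - g y)] for small [e]. Otherwise [x] and [y] are joined one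
    coordinate at a time, and each increment is split by 2 |d| Y <= L d^2 + Y^2 / L: the first term
    is paid by the defect, the second is the gradient term with its constant l^2 / L. *)
Lemma defect_of_modulus (D : set 'rV[R]_n) (g : 'rV[R]_n -> R)
    (A : 'I_n -> 'rV[R]_n -> R) (al B C CA c : R) :
  0 < al -> al <= B -> 0 <= C -> 0 <= CA -> 0 <= c ->
  (forall x, D x -> forall i, al <= x ord0 i <= B) ->
  (forall x, D x -> `|g x| <= C) ->
  (forall k (x : 'rV[R]_n), `|A k x| <= CA) ->
  (forall k (x : 'rV[R]_n) t (m : 'rV[R]_n) r, (forall i, `|x ord0 i - m ord0 i| <= r) ->
     (forall i, `|shift_rV k t x ord0 i - m ord0 i| <= r) ->
     `|g (shift_rV k t x) - g x| <= `|t| * (`|A k m| + c * r)) ->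
  forall eta, 0 < eta -> exists2 e0, 0 < e0 & forall e, 0 < e -> e < e0 ->
     forall x y, D x -> D y ->
     expR (e * (g x - g y)) <= rdefect_rV l x y *
       expR (e ^+ 2 * (\sum_k l%:R ^+ 2 / L *
          (rmean_rV l x y ord0 k ^+ 2 * A k (rmean_rV l x y) ^+ 2) + eta)).
Proof.
move=> al0 alB C0 CA0 c0 DB gC ACA gA eta eta0.
pose a := rootr l al; pose b := rootr l B.
have a0 : 0 < a by exact: rootr_gt0.
have B0 : 0 < B by exact: lt_le_trans alB.
have b0 : 0 < b by exact: rootr_gt0.
have b20 : 0 < 2 * b by rewrite mulr_gt0.
pose K := l%:R * b ^+ l.-1.
have K0 : 0 <= K by rewrite mulr_ge0// exprn_ge0// ltW.
(* The share of [eta] for one coordinate, after division by the factor [l^2 / L] and by a bound for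
   the weight [m_k^2 <= B^2]. *)
pose eta' := eta / (n%:R + 1) * (L / l%:R ^+ 2) / (B ^+ 2 + 1).
have n1 : 0 < n%:R + 1 :> R by rewrite ltr_wpDl.
have lR : 0 < l%:R :> R by rewrite ltr0n.
have l2 : 0 < l%:R ^+ 2 :> R by rewrite exprn_gt0.
have lL0 : 0 <= l%:R ^+ 2 / L := divr_ge0 (ltW l2) (ltW L0).
have B1 : 0 < B ^+ 2 + 1 by rewrite ltr_wpDl// sqr_ge0.
have eta'0 : 0 < eta' by rewrite divr_gt0// mulr_gt0// divr_gt0.
(* The value of [P] at [r] is [T^2 (CA + s)^2 - CA^2], where [T] and [s] are the distortions defined
   below, for roots at distance [r] instead of [rho]. It vanishes at 0, so some [rho > 0] keeps it
   below [eta']. *)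
pose P : {poly R} := ((1 + (2 * a)^-1 *: 'X) ^+ (l.-1 * 2) - 1) *
   (CA%:P + (c * K) *: 'X) ^+ 2 + (2 * CA * (c * K)) *: 'X + (c * K) ^+ 2 *: 'X^2.
have PrE r : P.[r] = ((1 + r / (2 * a)) ^+ (l.-1 * 2) - 1) * (CA + c * (K * r)) ^+ 2 +
    2 * CA * (c * (K * r)) + (c * (K * r)) ^+ 2.
  rewrite /P !(hornerE, horner_exp) /= [_^-1 * r]mulrC; ring.
have P0 : P.[0] < eta'.
  by rewrite PrE mul0r addr0 expr1n subrr !mulr0 expr0n/= mul0r !addr0.
have [rho rho0 Prho] := continuous_small (@continuous_horner R P) P0.
pose T := (1 + rho / (2 * a)) ^+ l.-1.
pose s := c * (K * rho).
have s0 : 0 <= s := mulr_ge0 c0 (mulr_ge0 K0 (ltW rho0)).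
have a20 : 0 < 2 * a by rewrite mulr_gt0.
have T1 : 1 <= T by rewrite /T exprn_ege1// lerDl divr_ge0 ?(ltW rho0) ?(ltW a20).
have PE : (T ^+ 2 - 1) * (CA + s) ^+ 2 + 2 * CA * s + s ^+ 2 < eta'.
  by move: Prho; rewrite PrE exprM.
have AP (x : R) : 0 <= x <= CA -> T ^+ 2 * (x + s) ^+ 2 <= x ^+ 2 + eta'.
  move=> /andP[x0 xCA].
  have T2 : 0 <= T ^+ 2 - 1 by rewrite subr_ge0 exprn_ege1.
  have h1 : (T ^+ 2 - 1) * (x + s) ^+ 2 <= (T ^+ 2 - 1) * (CA + s) ^+ 2.
    by rewrite ler_wpM2l// lerXn2r ?nnegrE ?addr_ge0// lerD2r.
  have h2 : x * s <= CA * s by rewrite ler_wpM2r.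
  move: PE h1 h2; rewrite !expr2; lra.
(* A lower bound for the exponent of the defect in the far case, since the sum of two roots is at
   most [2 b]. *)
pose gam := L * (rho / (2 * b)) ^+ 2.
have gam0 : 0 < gam by rewrite mulr_gt0// exprn_gt0// divr_gt0// mulr_gt0.
exists (gam / (2 * C + 1)); first by rewrite divr_gt0// ltr_wpDl// mulr_ge0.
move=> e e0; rewrite ltr_pdivlMr ?ltr_wpDl ?mulr_ge0// => egam x y Dx Dy.
set m := rmean_rV l x y.
pose p k := rootr l (x ord0 k); pose q k := rootr l (y ord0 k).
have pab k : a <= p k <= b.
  have /andP[h1 h2] := DB x Dx k; have h0 := lt_le_trans al0 h1.
  rewrite /p ler_rootr ?rootrK ?rootr_ge0 ?(ltW al0) ?(ltW h0)// h1/=.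
  by rewrite /b ler_rootr ?rootrK ?rootr_ge0 ?(ltW B0) ?(ltW h0).
have qab k : a <= q k <= b.
  have /andP[h1 h2] := DB y Dy k; have h0 := lt_le_trans al0 h1.
  rewrite /q ler_rootr ?rootrK ?rootr_ge0 ?(ltW al0) ?(ltW h0)// h1/=.
  by rewrite /b ler_rootr ?rootrK ?rootr_ge0 ?(ltW B0) ?(ltW h0).
have xE k : x ord0 k = p k ^+ l.
  by rewrite rootrK//; have /andP[h1 _] := DB x Dx k; rewrite (le_trans _ h1)// ltW.
have yE k : y ord0 k = q k ^+ l.
  by rewrite rootrK//; have /andP[h1 _] := DB y Dy k; rewrite (le_trans _ h1)// ltW.
have mE k : m ord0 k = ((p k + q k) / 2) ^+ l by rewrite mxE.
pose dl k := (p k - q k) / (p k + q k).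
have dfct : expR (\sum_k L * dl k ^+ 2) <= rdefect_rV l x y.
  rewrite expR_sum /rdefect_rV; apply: ler_prod => k _; rewrite expR_ge0/=.
  apply: rdefect_lower; first by rewrite xE exprn_gt0// (lt_le_trans a0)//; case/andP: (pab k).
  by rewrite yE exprn_gt0// (lt_le_trans a0)//; case/andP: (qab k).
apply: (@le_trans _ _ (expR (\sum_k L * dl k ^+ 2) * expR (e ^+ 2 * (\sum_k l%:R ^+ 2 / L *
          (m ord0 k ^+ 2 * A k m ^+ 2) + eta)))); last by rewrite ler_wpM2r// expR_ge0.
rewrite -expRD ler_expR.
have SL0 : 0 <= \sum_k L * dl k ^+ 2.
  by apply: sumr_ge0 => k _; rewrite mulr_ge0 ?sqr_ge0// ltW.
have [[k far]|near] := pselect (exists k, rho < `|p k - q k|).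
  have R0 : 0 <= e ^+ 2 * (\sum_k l%:R ^+ 2 / L * (m ord0 k ^+ 2 * A k m ^+ 2) + eta).
    rewrite mulr_ge0 ?sqr_ge0// addr_ge0 ?(ltW eta0)//; apply: sumr_ge0 => i _.
    exact: mulr_ge0 lL0 (mulr_ge0 (sqr_ge0 _) (sqr_ge0 _)).
  apply: (@le_trans _ _ gam); last first.
    rewrite -[leLHS]addr0 lerD// (bigD1 k)//= -[leLHS]addr0 lerD//; last first.
      by apply: sumr_ge0 => i _; rewrite mulr_ge0 ?sqr_ge0// ltW.
    rewrite /gam ler_pM2l// -[leRHS]real_normK ?num_real// lerXn2r// ?nnegrE//.
      exact: divr_ge0 (ltW rho0) (ltW b20).
    rewrite /dl normrM normfV ler_pM ?invr_ge0 ?(ltW rho0) ?(ltW b20) ?(ltW far)//.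
    have /andP[pa pb] := pab k; have /andP[qa qb] := qab k.
    have pq0 : 0 < p k + q k by rewrite addr_gt0// (lt_le_trans a0).
    by rewrite gtr0_norm// lef_pV2 ?posrE//; lra.
  apply: le_trans (ltW egam); rewrite ler_wpM2l ?(ltW e0)//.
  have := gC x Dx; have := gC y Dy; rewrite !ler_norml => /andP[h1 h2] /andP[h3 h4]; lra.
have {}near k : `|p k - q k| <= rho by rewrite leNgt; apply/negP => h; apply: near; exists k.
have mid k : a <= (p k + q k) / 2 <= b.
  have /andP[pa pb] := pab k; have /andP[qa qb] := qab k; apply/andP; split; lra.
have xm k : `|x ord0 k - m ord0 k| <= K * rho.
  have /andP[pa pb] := pab k; have /andP[ma mb] := mid k.
  rewrite xE mE (le_trans (@ler_dist_expr _ _ b _ _ _))//.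
  - by rewrite ger0_norm ?pb// (le_trans (ltW a0)).
  - by rewrite ger0_norm ?mb// (le_trans (ltW a0)).
  rewrite mulrC ler_wpM2l// (le_trans _ (near k))//.
  rewrite (_ : _ - _ = (p k - q k) / 2); last by field.
  by rewrite normrM [X in _ * X]ger0_norm// ler_piMr// invf_le1// ler1n.
have ym k : `|y ord0 k - m ord0 k| <= K * rho.
  have /andP[pa pb] := qab k; have /andP[ma mb] := mid k.
  rewrite yE mE (le_trans (@ler_dist_expr _ _ b _ _ _))//.
  - by rewrite ger0_norm ?pb// (le_trans (ltW a0)).
  - by rewrite ger0_norm ?mb// (le_trans (ltW a0)).
  rewrite mulrC ler_wpM2l// (le_trans _ (near k))//.
  rewrite (_ : _ - _ = (q k - p k) / 2); last by field.
  rewrite normrM [X in _ * X]ger0_norm// distrC ler_piMr// invf_le1// ler1n//.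
(* [z j] takes its first [j] coordinates from [x] and the others from [y]. These points may leave
   [D], which is why the modulus hypothesis is not restricted to [D]; they stay close to [m] in
   every coordinate. *)
pose z (j : nat) : 'rV[R]_n := \row_i (if (i < j)%N then x ord0 i else y ord0 i).
have zm j i : `|z j ord0 i - m ord0 i| <= K * rho by rewrite mxE; case: ifP.
have zS (k : 'I_n) : z k.+1 = shift_rV k (x ord0 k - y ord0 k) (z k).
  apply/rowP => i; rewrite shift_rVE !mxE ltnS leq_eqVlt.
  case: eqVneq => [/val_inj ->|ik]/=; first by rewrite ltnn eqxx mulr1 addrC subrK.
  by rewrite (_ : (i == k) = false) ?mulr0 ?addr0//; apply/negP => /eqP ii; rewrite ii eqxx in ik.
have tele : g x - g y <= \sum_(k < n) `|x ord0 k - y ord0 k| * (`|A k m| + s).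
  have -> : g x - g y = \sum_(k < n) (g (z k.+1) - g (z k)).
    rewrite -(big_mkord xpredT (fun k => g (z k.+1) - g (z k))) telescope_sumr//.
    by congr (g _ - g _); apply/rowP => i; rewrite mxE ?ltn_ord.
  apply: ler_sum => k _; apply: le_trans (ler_norm _) _.
  rewrite {1}zS; apply: gA => i; first exact: zm.
  by rewrite -zS; exact: zm.
have coord k : e * (`|x ord0 k - y ord0 k| * (`|A k m| + s)) <=
    L * dl k ^+ 2 + e ^+ 2 * (l%:R ^+ 2 / L * (m ord0 k ^+ 2 * A k m ^+ 2 + B ^+ 2 * eta')).
  have /andP[pa pb] := pab k; have /andP[qa qb] := qab k; have /andP[ma mb] := mid k.
  set M := (p k + q k) / 2 in ma mb.
  have M0 : 0 < M by exact: lt_le_trans ma.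
  have pq0 : p k + q k != 0 by rewrite lt0r_neq0// addr_gt0// (lt_le_trans a0).
  have mk : m ord0 k = M * M ^+ l.-1 by rewrite mE -exprS prednK.
  have m0 : 0 <= m ord0 k by rewrite mE exprn_ge0// ltW.
  have mB : m ord0 k <= B.
    rewrite mE -/M -(rootrK l0 (ltW B0)) lerXn2r// nnegrE ?rootr_ge0// ltW//.
  have rM : rho / 2 <= M * (rho / (2 * a)).
    rewrite (_ : M * _ = (M / a) * (rho / 2)); last by field; exact: lt0r_neq0.
    by rewrite ler_peMl ?divr_ge0 ?(ltW rho0)// ler_pdivlMr// mul1r.
  have pM : p k <= M * (1 + rho / (2 * a)).
    have := near k; rewrite ler_norml => /andP[h1 h2].
    move: rM; rewrite mulrDr mulr1 /M => rM; lra.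
  have qM : q k <= M * (1 + rho / (2 * a)).
    have := near k; rewrite ler_norml => /andP[h1 h2].
    move: rM; rewrite mulrDr mulr1 /M => rM; lra.
  have dE : `|p k - q k| = 2 * `|dl k| * M.
    rewrite /dl normrM normfV (gtr0_norm (_ : 0 < p k + q k)); last first.
      by rewrite addr_gt0// (lt_le_trans a0).
    by rewrite /M; field.
  have xy : `|x ord0 k - y ord0 k| <= 2 * `|dl k| * (l%:R * m ord0 k * T).
    rewrite xE yE (le_trans (@ler_dist_expr _ _ (M * (1 + rho / (2 * a))) _ _ _))//.
    - by rewrite ger0_norm ?pM ?(le_trans (ltW a0)).
    - by rewrite ger0_norm ?qM ?(le_trans (ltW a0)).
    rewrite dE exprMn mk -/T le_eqVlt; apply/orP; left; apply/eqP; ring.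
  set Ak := `|A k m|; pose Y := e * (l%:R * m ord0 k * T * (Ak + s)).
  have As0 : 0 <= Ak + s := addr_ge0 (normr_ge0 _) s0.
  apply: (@le_trans _ _ (2 * `|dl k| * Y)).
    rewrite /Y (_ : 2 * _ * _ = e * (2 * `|dl k| * (l%:R * m ord0 k * T) * (Ak + s))); last by ring.
    by rewrite ler_pM2l// ler_wpM2r.
  apply: (@le_trans _ _ (L * dl k ^+ 2 + Y ^+ 2 / L)).
    have LY : L * (Y ^+ 2 / L) = Y ^+ 2 by field; exact: lt0r_neq0.
    rewrite -(ler_pM2l L0) [leRHS]mulrDr LY.
    have : 0 <= (L * `|dl k| - Y) ^+ 2 by exact: sqr_ge0.
    have <- : `|dl k| ^+ 2 = dl k ^+ 2 by rewrite real_normK// num_real.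
    rewrite !expr2; lra.
  rewrite lerD2l (_ : Y ^+ 2 / L = e ^+ 2 * (l%:R ^+ 2 / L * (m ord0 k ^+ 2 * (T ^+ 2 * (Ak + s) ^+ 2)))); last first.
    by rewrite /Y; field; exact: lt0r_neq0.
  rewrite ler_wpM2l ?sqr_ge0// ler_wpM2l ?divr_ge0 ?sqr_ge0 ?(ltW L0)//.
  apply: (@le_trans _ _ (m ord0 k ^+ 2 * (Ak ^+ 2 + eta'))).
    by rewrite ler_wpM2l ?sqr_ge0// AP// normr_ge0 ACA.
  rewrite mulrDr real_normK ?num_real// lerD2l ler_wpM2r ?(ltW eta'0)//.
  by rewrite lerXn2r// nnegrE// ltW.
apply: le_trans (_ : e * \sum_(k < n) `|x ord0 k - y ord0 k| * (`|A k m| + s) <= _).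
  by rewrite ler_wpM2l// ltW.
rewrite mulr_sumr; apply: le_trans (ler_sum _ (fun k _ => coord k)) _.
rewrite big_split/= lerD2l -mulr_sumr ler_wpM2l ?sqr_ge0//.
rewrite [leLHS](eq_bigr _ (fun k _ => mulrDr _ _ _)).
rewrite big_split/= lerD2l sumr_const card_ord.
rewrite -[leLHS]mulr_natl /eta'.
rewrite [leLHS](_ : _ = eta * ((n%:R / (n%:R + 1)) * (B ^+ 2 / (B ^+ 2 + 1)))); last first.
  by field; rewrite !lt0r_neq0.
rewrite ler_piMr ?(ltW eta0)// mulr_ile1 ?divr_ge0 ?sqr_ge0 ?(ltW n1) ?(ltW B1)//.
  by rewrite ler_pdivrMr// mul1r lerDl.
by rewrite ler_pdivrMr// mul1r lerDl.
Qed.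

End defect_bound.

(** * Lipschitz functions and their mollification *)

Section rV_topology.
Context {R : realType} (n : nat).
Implicit Types x y : 'rV[R]_n.

Lemma nbhs_rVP x (U : set 'rV[R]_n) : nbhs x U <->
  exists2 e, 0 < e & forall y, (forall i, `|x ord0 i - y ord0 i| < e) -> U y.
Proof.
split=> [/nbhs_ballP[e /= e0 eU]|[e e0 eU]].
  by exists e => // y xy; apply: eU; split => // i j; rewrite ord1; exact: xy.
by apply/nbhs_ballP; exists e => //= y [_ xy]; apply: eU => i; exact: xy.
Qed.

Lemma ler_norm_coord x i : `|x ord0 i| <= `|x|.
Proof.
rewrite [leRHS]/Num.norm /= mx_normrE; apply/bigmax_geP; right => /=.
by exists (ord0, i).
Qed.

Lemma ler_norm_rV x (r : R) : 0 <= r -> (forall i, `|x ord0 i| <= r) -> `|x| <= r.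
Proof.
move=> r0 xr; rewrite [leLHS]/Num.norm /= mx_normrE; apply/bigmax_leP; split => //=.
by move=> [i j] _ /=; rewrite ord1.
Qed.

Lemma measurable_box_rV (A : 'I_n -> set (measurableTypeR R)) :
  (forall i, measurable (A i)) ->
  measurable [set x : 'rV[R]_n | forall i, A i (x ord0 i)].
Proof.
move=> mA; rewrite (_ : [set _ | _] = \bigcap_(i in [set: 'I_n])
    ((fun v : 'rV[R]_n => v ord0 i : measurableTypeR R) @^-1` A i)); last first.
  by apply/seteqP; split => [z h1 i _|z h1 i]; [exact: h1|exact: (h1 i I)].
apply: fin_bigcap_measurable => // i _; rewrite -[X in measurable X]setTI.
exact: measurable_coord.
Qed.

(** The sigma-algebra is generated by the coordinates, so second countability enters: an open set is
    the union of the countably many boxes with rational centre and radius 1 / (k + 1) that it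
    contains. Around [x] the radius is taken below [e / 2], so that a box through [x] fits into the
    [e]-ball. *)
Lemma open_measurable_rV (U : set 'rV[R]_n) : open U -> measurable U.
Proof.
move=> oU.
pose box (p : 'rV[rat]_n * nat) : set 'rV[R]_n :=
  [set x | forall i, ball (ratr (p.1 ord0 i) : R) p.2.+1%:R^-1 (x ord0 i)].
pose F p := if pselect (box p `<=` U) then box p else set0.
rewrite (_ : U = \bigcup_p F p).
  apply: countable_bigcupT_measurable; first exact: countableP.
  move=> p; rewrite /F; case: pselect => [h|h] //=.
  apply: (@measurable_box_rV (fun i => ball (ratr (p.1 ord0 i) : R) p.2.+1%:R^-1)) => i.
  exact: measurable_ball.
apply/seteqP; split => [x Ux|x [p _]]; last by rewrite /F; case: pselect => [h|h] //= /h.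
have /nbhs_rVP[e e0 eU] : nbhs x U by exact: open_nbhs_nbhs.
pose k := Num.bound (2 / e).
have k1 : 0 < k.+1%:R^-1 :> R by rewrite invr_gt0.
have ke : 2 * k.+1%:R^-1 < e.
  rewrite ltr_pdivrMr// mulrC -ltr_pdivrMr//.
  apply: lt_le_trans (archi_boundP _) _; first by rewrite divr_ge0// ltW.
  by rewrite ler_nat.
have [d dE] : {d : R | d = k.+1%:R^-1} by exists (k.+1%:R^-1).
rewrite -dE in k1 ke.
have /choice[c cx] (i : 'I_n) : exists q : rat, `|ratr q - x ord0 i| < d.
  have [q] := @rat_in_itvoo R (x ord0 i - d) (x ord0 i + d) ltac:(lra).
  rewrite in_itv/= => /andP[h1 h2]; exists q; rewrite ltr_norml; apply/andP; split; lra.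
have bx : box (\row_i c i, k) x by move=> i /=; rewrite mxE -dE; exact: cx.
exists (\row_i c i, k) => //; rewrite /F; case: pselect => [h|[]] //= y by_.
apply: eU => i; have := by_ i; rewrite /ball/= mxE -dE => cy.
rewrite (_ : _ - _ = (ratr (c i) - y ord0 i) - (ratr (c i) - x ord0 i)); last by ring.
rewrite (le_lt_trans (ler_normB _ _))//; apply: lt_trans ke.
by have := cx i; move: cy; lra.
Qed.

Lemma continuous_measurable_rV (f : 'rV[R]_n -> R) :
  continuous f -> measurable_fun setT f.
Proof.
move=> /continuousP cf; apply: (measurability _ (RGenOpens.measurableE R)) => //.
move=> _ [_ [a [b ->] <-]]; rewrite setTI; apply: open_measurable_rV.
exact/cf/interval_open.
Qed.

Lemma measurable_funD_rV d (T : measurableType d) (f g : T -> 'rV[R]_n) :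
  measurable_fun setT f -> measurable_fun setT g ->
  measurable_fun setT (fun t => f t + g t).
Proof.
move=> mf mg; apply: measurable_fun_rVP => i.
rewrite (_ : (fun _ => _) = fun t => f t ord0 i + g t ord0 i); last first.
  by apply/funext => t; rewrite mxE.
by apply: measurable_funD; [exact: (measurableT_comp (measurable_coord i) mf)|
  exact: (measurableT_comp (measurable_coord i) mg)].
Qed.

End rV_topology.

(** * Translation invariance of Lebesgue measure *)

Section translation.
Local Open Scope ereal_scope.
Context {R : realType}.

Lemma ge0_integral_translation1 (f : R -> \bar R) (b : R) :
  measurable_fun setT f -> (forall x, 0 <= f x) ->
  \int[@lebesgue_measure R]_x f (x + b)%R = \int[@lebesgue_measure R]_x f x.
Proof.
move=> mf f0.
pose phi : measurableTypeR R -> measurableTypeR R := fun x => (x + b)%R.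
have mphi : measurable_fun setT phi by exact: measurable_funD.
pose nu : {measure set (measurableTypeR R) -> \bar R} := pushforward lebesgue_measure phi.
rewrite [RHS](eq_measure_integral (nu mphi)); last first.
  move=> A mA _; rewrite /nu/= /pushforward.
  have := @lebesgue_measure_affine R 1 b A ltr01 mA; rewrite invr1 mul1e => <-.
  by congr (lebesgue_measure _); apply/seteqP; split => x /=; rewrite mul1r.
by rewrite ge0_integral_pushforward.
Qed.

Lemma ge0_integral_translation n (f : 'rV[R]_n -> \bar R) (s : 'rV[R]_n) :
  measurable_fun setT f -> (forall x, 0 <= f x) ->
  \int[@borel_lebesgue_rV R n]_x f (x + s)%R = \int[@borel_lebesgue_rV R n]_x f x.
Proof.
elim: n f s => [|n IH] f s mf f0.
  apply: eq_integral => x _; congr f; by apply/rowP => -[].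
have mfs : measurable_fun setT (fun x : 'rV[R]_n.+1 => f (x + s)%R).
  apply: measurableT_comp => //; apply: measurable_funD_rV => //.
rewrite (ge0_integral_cons_rV mfs (fun x => f0 _)) (ge0_integral_cons_rV mf f0).
pose s' : 'rV[R]_n := \row_i s ord0 (lift ord0 i).
have consD (a : measurableTypeR R) (v : 'rV[R]_n) :
    (cons_rV (a, v) + s = cons_rV ((a + s ord0 ord0)%R, (v + s')%R))%R.
  apply/rowP => i; rewrite mxE; case: (unliftP ord0 i) => [j ->|->].
    by rewrite !cons_rVS !mxE.
  by rewrite !cons_rV0.
rewrite -[RHS](ge0_integral_translation1 (s ord0 ord0)); last 2 first.
- exact: measurable_integral_cons_rV.
- by move=> a; exact: integral_ge0.
apply: eq_integral => a _.
rewrite -[RHS](IH _ s'); last 2 first.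
- exact: measurable_fun_cons_rV.
- by [].
by apply: eq_integral => v _; rewrite consD.
Qed.

End translation.

(** * The fundamental theorem of calculus for Lipschitz functions *)

Section lipschitz_ftc.
Context {R : realType}.
Local Notation mu := (@lebesgue_measure R).

Lemma lipschitz_continuous (V : normedModType R) (phi : V -> R) (Lam : R) :
  (forall x y, `|phi x - phi y| <= Lam * `|x - y|) -> continuous phi.
Proof.
move=> lip x; apply/cvgrPdist_lt => e e0.
have L1 : 0 < `|Lam| + 1 by rewrite ltr_wpDl.
near=> y; apply: le_lt_trans (lip x y) _.
have : `|x - y| < e / (`|Lam| + 1).
  by near: y; apply: cvgr_dist_lt => //; rewrite divr_gt0.
rewrite ltr_pdivlMr// => h; apply: le_lt_trans h.
by rewrite mulrC ler_wpM2l// (le_trans (ler_norm _))// lerDl.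
Unshelve. all: by end_near. Qed.

(** [Lam x + phi x] and [Lam x - phi x] are both nondecreasing, and their Stieltjes measures add up
    to [2 Lam] times Lebesgue measure. Hence the first one is absolutely continuous; [r] is its
    Radon-Nikodym density minus [Lam], and Lebesgue differentiation makes [r] the derivative almost
    everywhere. *)
Lemma lipschitz_ftc (phi : R -> R) (Lam a b : R) : 0 < Lam -> a < b ->
  (forall x y, `|phi x - phi y| <= Lam * `|x - y|) ->
  exists r : R -> R, [/\ measurable_fun setT r,
    mu.-integrable `]a, b] (EFin \o r),
    forall y, a <= y <= b -> phi y - phi a = \int[mu]_(t in `]a, y]) r t &
    {ae mu, forall x, a < x < b -> is_derive x 1 phi (r x)}].
Proof.
move=> L0 ab lip.
pose gp x := Lam * x + phi x; pose gm x := Lam * x - phi x.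
have cphi := lipschitz_continuous lip.
have gpnd : {homo gp : x y / x <= y}.
  move=> x y xy; have := lip x y; rewrite ler_norml ler0_norm ?subr_le0// => /andP[h1 h2].
  rewrite /gp; lra.
have gmnd : {homo gm : x y / x <= y}.
  move=> x y xy; have := lip x y; rewrite ler_norml ler0_norm ?subr_le0// => /andP[h1 h2].
  rewrite /gm; lra.
have cLam : continuous (fun x : R => Lam * x).
  by move=> x; apply: cvgM; [exact: cvg_cst|exact: cvg_id].
have gpc : right_continuous gp.
  by apply: right_continuousW => x; apply: cvgD; [exact: cLam|exact: cphi].
have gmc : right_continuous gm.
  by apply: right_continuousW => x; apply: cvgB; [exact: cLam|exact: cphi].
pose Gp : cumulative R R := HB.pack gp (isCumulative.Build R _ R gp gpnd gpc).
pose Gm : cumulative R R := HB.pack gm (isCumulative.Build R _ R gm gmnd gmc).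
pose np := lebesgue_stieltjes_measure Gp; pose nm := lebesgue_stieltjes_measure Gm.
have Lv0 : 0 <= (2 * Lam)^-1 by rewrite invr_ge0 mulr_ge0// ltW.
have npE u v : u <= v -> np `]u, v]%classic = (gp v - gp u)%:E.
  move=> uv; rewrite /np /lebesgue_stieltjes_measure /measure_extension measurable_mu_extE//=.
    by rewrite wlength_itv_bnd.
  exact: is_ocitv.
have nmE u v : u <= v -> nm `]u, v]%classic = (gm v - gm u)%:E.
  move=> uv; rewrite /nm /lebesgue_stieltjes_measure /measure_extension measurable_mu_extE//=.
    by rewrite wlength_itv_bnd.
  exact: is_ocitv.
pose m : {measure set (measurableTypeR R) -> \bar R} :=
  mscale (NngNum Lv0) (measure_add np nm).
have mE A : m A = ((2 * Lam)^-1%:E * (np A + nm A))%E.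
  by rewrite -measure_addE.
have muE A : measurable A -> mu A = m A.
  move=> mA; apply: lebesgue_measure_unique => // _ [[u v] _ <-]; rewrite mE/=.
  have [uv|vu] := leP u v; last first.
    have np0 : np set0 = 0%E by exact: measure0.
    have nm0 : nm set0 = 0%E by exact: measure0.
    by rewrite set_itv_ge -?leNgt ?bnd_simp ?ltW// np0 nm0 measure0 adde0 mule0.
  rewrite npE// nmE// lebesgue_measure_itv/= lte_fin -EFinD -EFinM.
  rewrite (_ : _^-1 * _ = v - u); last by rewrite /gp /gm; field; exact: lt0r_neq0.
  by case: ifPn => //; rewrite -leNgt => vu; rewrite (@le_anti _ _ u v) ?subrr// uv.
have mab : measurable (`]a, b]%classic : set (measurableTypeR R)) by exact: measurable_itv.
have npoo : (np `]a, b]%classic < +oo)%E by rewrite npE ?ltry// ltW.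
(* Restriction to ]a, b] makes the measure finite, and its density integrable on the whole line. *)
pose nu : {finite_measure set (measurableTypeR R) -> \bar R} := mfrestr mab npoo.
have numu : nu `<< mu.
  apply/null_content_dominatesP => A mA muA0; have : m A = 0%E by rewrite -muE//; exact: muA0.
  rewrite mE => /eqP.
  rewrite mule_eq0 eqe invr_eq0 mulf_eq0 pnatr_eq0/= (gt_eqF L0)/= padde_eq0// => /andP[/eqP A0 _].
  apply/eqP; rewrite eq_le measure_ge0 andbT -A0.
  by apply: le_measure; rewrite ?inE//; exact: measurableI.
have [r0 [r00 r0fin ir0 r0E]] := radon_nikodym_sigma_finite numu.
have ir : mu.-integrable setT (EFin \o (fine \o r0)).
  by apply: eq_integrable ir0 => // x _ /=; rewrite fineK.
have mr0 : measurable_fun setT (fine \o r0).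
  by apply/measurable_EFinP; case/integrableP: ir.
have gE y : a <= y <= b -> \int[mu]_(t in `]a, y]) (fine (r0 t)) = gp y - gp a.
  move=> /andP[ay yb]; rewrite /Rintegral.
  have -> : (\int[mu]_(t in `]a, y]) (fine (r0 t))%:E = nu `]a, y]%classic)%E.
    by rewrite r0E//; apply: eq_integral => x _; rewrite fineK.
  rewrite /nu/= /mfrestr /mrestr setIidl; last by apply: subset_itvl; rewrite bnd_simp.
  by rewrite -/np npE.
have icst u v : mu.-integrable `]u, v] (EFin \o cst Lam).
  apply: measurable_bounded_integrable => //.
    have : (mu `]u, v]%classic < +oo)%E.
      by rewrite lebesgue_measure_itv/=; case: ifP => _; rewrite ?ltry// -EFinB ltry.
    exact.
  exists Lam; split; first by rewrite num_real.
  by move=> M LM x _ /=; rewrite gtr0_norm// ltW.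
exists (fun x => fine (r0 x) - Lam); split.
- exact: measurable_funB.
- apply: (@integrableB _ _ _ mu _ _ (EFin \o (fine \o r0)) (EFin \o cst Lam)) => //.
  exact: integrableS ir.
- move=> y /andP[ay yb].
  transitivity (\int[mu]_(t in `]a, y]) (fine (r0 t)) - \int[mu]_(t in `]a, y]) Lam).
    have itvE : mu `]a, y]%classic = (y - a)%:E.
      rewrite lebesgue_measure_itv/= lte_fin -EFinB.
      by move: ay; rewrite le_eqVlt => /predU1P[<-|->//]; rewrite ltxx subrr.
    have cE : \int[mu]_(t in `]a, y]) Lam = Lam * (y - a).
      by rewrite Rintegral_cst//; congr (_ * _); transitivity (fine (mu `]a, y]%classic)); [by []|rewrite itvE].
    by rewrite gE ?ay// cE /gp; ring.
  apply/esym; apply: (@RintegralB _ _ _ mu _ (fine \o r0) (cst Lam)) => //.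
  exact: integrableS ir.
have ifin y : mu.-integrable [set` Interval (BRight a) (BRight y)] (EFin \o (fine \o r0)).
  exact: integrableS ir.
have := FTC1 ifin (open_integrable_locally openT ir).
apply: filterS; first exact: (ae_filter_ringOfSetsType mu).
move=> x /= h /andP[ax xb]; have [dF F'] : _ /\ _ := h ax.
set F := (fun y => _) in dF F'.
have near_eq : \near x, (F \- (fun y => Lam * y) \+ cst (phi a + Lam * a)) x = phi x.
  near=> y; rewrite /F /= gE /gp; first ring.
  apply/andP; split; apply: ltW; near: y; [exact: lt_nbhsr|exact: lt_nbhsl].
apply: (near_eq_is_derive near_eq).
have dFx : is_derive x 1 F (fine (r0 x)).
  by split; [exact: dF|rewrite -derive1E F'].
apply: is_derive_eq; rewrite /GRing.scale/=; ring.
Unshelve. all: by end_near. Qed.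

End lipschitz_ftc.

Section lipschitz_rV.
Context {R : realType} (n : nat).
Local Notation mu := (@lebesgue_measure R).
Local Notation muN := (@borel_lebesgue_rV R n).
Implicit Types x y : 'rV[R]_n.

Lemma shift_rVD (k : 'I_n) (s t : R) x : shift_rV k s (shift_rV k t x) = shift_rV k (s + t) x.
Proof. by rewrite /shift_rV scalerDl -addrA (addrC (t *: _)). Qed.

Lemma shift_rV0 (k : 'I_n) x : shift_rV k 0 x = x.
Proof. by rewrite /shift_rV scale0r addr0. Qed.

Lemma norm_shift_rV (k : 'I_n) (s t : R) x : `|shift_rV k s x - shift_rV k t x| <= `|s - t|.
Proof.
apply: ler_norm_rV => // i; rewrite !mxE opprD addrACA subrr add0r -mulrBl.
by case: (i == k); rewrite ?andbT ?andbF ?eqxx ?mulr1// mulr0 normr0.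
Qed.

Lemma measurable_shift_rV (k : 'I_n) d (T : measurableType d) (f : T -> R) (g : T -> 'rV[R]_n) :
  measurable_fun setT f -> measurable_fun setT g ->
  measurable_fun setT (fun t => shift_rV k (f t) (g t)).
Proof.
move=> mf mg; apply: measurable_fun_rVP => i.
rewrite (_ : (fun _ => _) = fun t => g t ord0 i + f t * (i == k)%:R); last first.
  by apply/funext => t; rewrite shift_rVE.
apply: measurable_funD; first exact: (measurableT_comp (measurable_coord i) mg).
exact: measurable_funM.
Qed.

Lemma closed_measurable_rV (U : set 'rV[R]_n) : closed U -> measurable U.
Proof.
move=> cU; rewrite -[U]setCK; apply: measurableC; apply: open_measurable_rV.
exact: closed_openC.
Qed.

Variables (F : 'rV[R]_n -> R) (Lam : R) (k : 'I_n).
Hypothesis L0 : 0 < Lam.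
Hypothesis lip : forall x y, `|F x - F y| <= Lam * `|x - y|.

Let quot (h : R) x : R := h^-1 * (F (shift_rV k h x) - F x).

Let quot_bound h x : `|quot h x| <= Lam.
Proof.
have [->|h0] := eqVneq h 0; first by rewrite /quot invr0 mul0r normr0 ltW.
rewrite /quot normrM normfV ler_pdivrMl ?normr_gt0//.
apply: le_trans (lip _ _) _; rewrite mulrC ler_wpM2r ?(ltW L0)//.
by have := norm_shift_rV k h 0 x; rewrite shift_rV0 subr0.
Qed.

Let lip_quot h x y : `|quot h x - quot h y| <= (2 * Lam * `|h|^-1) * `|x - y|.
Proof.
rewrite /quot -mulrBr normrM normfV.
rewrite (_ : 2 * Lam * _ * _ = `|h|^-1 * (2 * Lam * `|x - y|)); last by ring.
rewrite ler_wpM2l ?invr_ge0//.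
rewrite (_ : _ - _ = (F (shift_rV k h x) - F (shift_rV k h y)) - (F x - F y)); last by ring.
apply: le_trans (ler_normB _ _) _.
have := lip x y; have := lip (shift_rV k h x) (shift_rV k h y).
rewrite {2}/shift_rV opprD addrACA subrr addr0; lra.
Qed.

(** A Cauchy condition on the difference quotients: oscillation at most 1 / (m + 1) for increments
    below 1 / (p + 1). The quotients of a Lipschitz function are continuous in [x], so these sets
    are closed, and derivability is a countable combination of them. *)
Let C (m p : nat) : set 'rV[R]_n := [set x | forall h h' : R,
  0 < `|h| < p.+1%:R^-1 -> 0 < `|h'| < p.+1%:R^-1 ->
  `|quot h x - quot h' x| <= m.+1%:R^-1].

Let closedC m p : closed (C m p).
Proof.
rewrite (_ : C m p = \bigcap_(hh in [set hh : R * R |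
     0 < `|hh.1| < p.+1%:R^-1 /\ 0 < `|hh.2| < p.+1%:R^-1])
  ((fun x => `|quot hh.1 x - quot hh.2 x|) @^-1` [set t | t <= m.+1%:R^-1])).
  apply: closed_bigI => -[h h'] _; apply: preimage_closed; last exact: closed_le.
  move=> x _; move: x; pose q := (2 * Lam * `|h|^-1) + (2 * Lam * `|h'|^-1).
  apply: (@lipschitz_continuous _ _ _ q) => x y /=.
  apply: le_trans (ler_dist_dist _ _) _.
  rewrite (_ : _ - _ = (quot h x - quot h y) - (quot h' x - quot h' y)); last by ring.
  by apply: le_trans (ler_normB _ _) _; rewrite mulrDl lerD.
apply/seteqP; split => x /= Cx; first by move=> [h h'] /= [h0 h1]; exact: Cx.
by move=> h h' h0 h1; exact: (Cx (h, h')).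
Qed.

Let quotE x :
  (fun h => h^-1 *: ((F \o shift x) (h *: delta_mx ord0 k) - F x)) = quot^~ x.
Proof. by apply/funext => h; rewrite /quot /shift_rV /= [X in F X]addrC. Qed.

Let derivableE x : derivable F x (delta_mx ord0 k) = cvg (quot h x @[h --> 0^']).
Proof.
by rewrite /derivable quotE.
Qed.

Let deriveE x : 'D_(delta_mx ord0 k) F x = lim (quot h x @[h --> 0^']).
Proof.
by rewrite /derive quotE.
Qed.

Definition derivability_set : set 'rV[R]_n := [set x | derivable F x (delta_mx ord0 k)].

Lemma measurable_derivability_set : measurable derivability_set.
Proof.
rewrite (_ : derivability_set = \bigcap_m \bigcup_p C m p).
  apply: bigcapT_measurable => m; apply: bigcupT_measurable => p.
  exact: (closed_measurable_rV (@closedC m p)).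
apply/seteqP; split => x; rewrite /derivability_set /= derivableE.
  move=> /cvg_ex[c cc] m _.
  have m0 : 0 < (2 * m.+1%:R)^-1 :> R by rewrite invr_gt0 mulr_gt0.
  have /nbhs_ballP[e /= e0 eh] : \forall h \near 0^', `|c - quot h x| < (2 * m.+1%:R)^-1.
    exact: cvgr_dist_lt.
  exists (Num.bound e^-1) => // h h' hb h'b.
  have be (t : R) : 0 < `|t| < (Num.bound e^-1).+1%:R^-1 -> `|c - quot t x| < (2 * m.+1%:R)^-1.
    move=> /andP[t0 tb]; apply: eh; last by rewrite -normr_gt0.
    rewrite /ball /= sub0r normrN (lt_trans tb)// invf_plt ?posrE//.
    apply: lt_le_trans (archi_boundP _) _; first by rewrite invr_ge0 ltW.
    by rewrite (ler_nat R (Num.bound e^-1) (Num.bound e^-1).+1).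
  rewrite (_ : _ - _ = (c - quot h' x) - (c - quot h x)); last by ring.
  apply: le_trans (ler_normB _ _) _; apply: ltW.
  rewrite (lt_le_trans (ltrD (be _ h'b) (be _ hb)))// invfM -mulrDl.
  by rewrite (_ : 2^-1 + 2^-1 = 1) ?mul1r//; field.
move=> Cx; apply/cauchy_cvgP/cauchy_exP => e e0.
pose m := Num.bound e^-1.
have me : m.+1%:R^-1 < e.
  rewrite invf_plt ?posrE//; apply: lt_le_trans (archi_boundP _) _; first by rewrite invr_ge0 ltW.
  by rewrite (ler_nat R m m.+1).
have [p _ Cmp] := Cx m I.
have p0 : 0 < p.+1%:R^-1 :> R by rewrite invr_gt0.
exists (quot (p.+1%:R^-1 / 2) x).
have h0 : 0 < `|p.+1%:R^-1 / 2 : R| < p.+1%:R^-1.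
  rewrite gtr0_norm ?divr_gt0//= ltr_pdivrMr// ltr_pMr// ltr1n//.
apply/nbhs_ballP; exists p.+1%:R^-1 => //= h.
rewrite /ball /= sub0r normrN => hp hn0.
apply: le_lt_trans me; apply: Cmp => //.
by rewrite hp normr_gt0 hn0.
Qed.

(** [partial] is junk where the limit does not exist; with the value 0 there, it becomes a Borel
    function bounded by the Lipschitz constant. *)
Definition partial_on (x : 'rV[R]_n) : R :=
  if x \in derivability_set then partial k F x else 0.

Let cvg_quot x : derivability_set x ->
  (quot j.+1%:R^-1 x @[j --> \oo] --> partial k F x).
Proof.
move=> dx.
have : quot h x @[h --> 0^'] --> partial k F x.
  by have := dx; rewrite /derivability_set/= derivableE /partial deriveE.
move=> /cvgrPdist_lt qc; apply/cvgrPdist_lt => e e0.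
have /nbhs_ballP[d /= d0 dh] := qc e e0.
near=> j; apply: dh; last by rewrite gt_eqF// invr_gt0.
rewrite /ball/= sub0r normrN gtr0_norm ?invr_gt0//.
by near: j; exact: near_infty_natSinv_lt (PosNum d0).
Unshelve. all: by end_near. Qed.

Lemma partial_on_bound x : `|partial_on x| <= Lam.
Proof.
rewrite /partial_on; case: ifPn => [|_]; last by rewrite normr0 ltW.
rewrite inE => /cvg_quot qc.
have nqc : `|quot j.+1%:R^-1 x| @[j --> \oo] --> `|partial k F x| by exact: cvg_norm.
rewrite -(cvg_lim _ nqc)//; apply: limr_le; first by apply/cvg_ex; exists `|partial k F x|.
by near=> j; exact: quot_bound.
Unshelve. all: by end_near. Qed.

Lemma measurable_partial_on : measurable_fun setT partial_on.
Proof.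
pose f (j : nat) x := quot j.+1%:R^-1 x * \1_derivability_set x.
apply: (@measurable_fun_cvg _ _ _ _ f).
  move=> j; apply: measurable_funM.
    apply: continuous_measurable_rV; exact: (lipschitz_continuous (lip_quot _)).
  by apply: measurable_indic; exact: measurable_derivability_set.
move=> x _; rewrite /f /partial_on indicE; case: ifPn => [|_].
  rewrite inE => dx; under eq_fun do rewrite mulr1; exact: cvg_quot.
under eq_fun do rewrite mulr0; exact: cvg_cst.
Qed.

Let line x (r : R) := F (shift_rV k r x).

Let lip_line x r s : `|line x r - line x s| <= Lam * `|r - s|.
Proof.
apply: le_trans (lip _ _) _; rewrite ler_wpM2l ?(ltW L0)//; exact: norm_shift_rV.
Qed.

Let derive_line x (r d : R) : is_derive r 1 (line x) d ->
  derivability_set (shift_rV k r x) /\ partial_on (shift_rV k r x) = d.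
Proof.
move=> [dl dE].
have e : (fun h : R => h^-1 *: ((line x \o shift r) (h *: 1) - line x r)) =
         quot^~ (shift_rV k r x).
  apply/funext => h; rewrite /quot /line /= shift_rVD.
  by congr (_ * (F (shift_rV k _ x) - _)); rewrite [_ *: _]mulr1.
have ds : derivability_set (shift_rV k r x).
  by move: dl; rewrite /derivability_set/= derivableE /derivable e.
split => //; rewrite /partial_on mem_set// /partial deriveE.
by move: dE; rewrite /derive e.
Qed.

(** On the line through [x] in direction [k], the density given by [lipschitz_ftc] is almost
    everywhere the derivative, hence [partial_on]. Exceptional sets are null within the line, so the
    identity holds for every [x]. *)
Lemma lipschitz_line_ftc x (t : R) : 0 < t ->
  F (shift_rV k t x) - F x = \int[mu]_(r in `]0, t]) partial_on (shift_rV k r x).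
Proof.
move=> t0; have [r [mr ir rE dr]] := lipschitz_ftc L0 t0 (lip_line x).
transitivity (line x t - line x 0); first by rewrite /line shift_rV0.
rewrite rE ?(ltW t0) ?lexx//; rewrite /Rintegral; congr fine.
apply: ae_eq_integral => //.
- by apply: measurable_funTS; exact/measurable_EFinP.
- apply: measurable_funTS; apply/measurable_EFinP.
  apply: (measurableT_comp measurable_partial_on).
  by apply: measurable_shift_rV => //; exact: measurable_id.
(* The derivative is known only strictly inside the interval; the endpoint [t] is discarded as a
   null set. *)
have tn : {ae mu, forall s, s != t}.
  exists [set t]; split; [exact: measurable_set1|exact: lebesgue_measure_set1|].
  by move=> s /= /negP; rewrite negbK => /eqP.
apply: (filterS2 (ae_filter_ringOfSetsType mu) _ dr tn) => s /= ds st; rewrite in_itv/= => /andP[s0 st'].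
have s1 : 0 < s < t by rewrite s0 lt_neqAle st.
by have [_ ->] := derive_line (ds s1).
Qed.

End lipschitz_rV.

Section signed_translation.
Context {R : realType} (n : nat).
Local Notation muN := (@borel_lebesgue_rV R n).

Lemma integral_translation (f : 'rV[R]_n -> R) (s : 'rV[R]_n) :
  measurable_fun setT f -> \int[muN]_x f (x + s) = \int[muN]_x f x.
Proof.
move=> mf; rewrite /Rintegral; congr fine.
have mEf : measurable_fun setT (EFin \o f) by exact/measurable_EFinP.
rewrite [LHS]integralE [RHS]integralE; congr (_ - _)%E.
  have h := @ge0_integral_translation _ _ (EFin \o f)^\+%E s (measurable_funepos mEf).
  apply: eq_trans (h _).
    by apply: eq_integral => x _; rewrite !funeposE.
  by move=> x; exact: funepos_ge0.
have h := @ge0_integral_translation _ _ (EFin \o f)^\-%E s (measurable_funeneg mEf).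
apply: eq_trans (h _).
  by apply: eq_integral => x _; rewrite !funenegE.
by move=> x; exact: funeneg_ge0.
Qed.

Lemma measurable_addr_rV (x : 'rV[R]_n) : measurable_fun setT (fun s => x + s).
Proof. by apply: measurable_funD_rV => //; exact: measurable_id. Qed.

Lemma measurable_cube (a b : R) :
  measurable [set s : 'rV[R]_n | forall i, `[a, b]%classic (s ord0 i)].
Proof. by apply: (@measurable_box_rV _ _ (fun=> `[a, b]%classic)) => i; exact: measurable_itv. Qed.

Lemma borel_lebesgue_rV_cube (a b : R) : a < b ->
  muN [set s : 'rV[R]_n | forall i, `[a, b]%classic (s ord0 i)] = ((b - a) ^+ n)%:E.
Proof.
move=> ab; rewrite (borel_lebesgue_rV_box (fun=> measurable_itv `[a, b])).
transitivity (\prod_(i < n) (b - a)%:E)%E.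
  by apply: eq_bigr => i _; rewrite lebesgue_measure_itv/= lte_fin ab -EFinB.
rewrite big_const_ord; elim: (n) => [|m IH]//=.
by rewrite IH exprS EFinM.
Qed.

End signed_translation.

(** * Mollification by a Lipschitz kernel supported in a small cube *)

Section mollification.
Context {R : realType} (n : nat).
Local Notation mu := (@lebesgue_measure R).
Local Notation muN := (@borel_lebesgue_rV R n).
Implicit Types (F H P : 'rV[R]_n -> R) (C : R) (x y s : 'rV[R]_n).
Variables (rho : 'rV[R]_n -> R) (d Lr : R).
Hypotheses (d0 : 0 < d) (Lr0 : 0 <= Lr) (rho0 : forall s, 0 <= rho s)
  (rhoS : forall s, rho s != 0 -> forall i, 0 <= s ord0 i <= d)
  (rhoL : forall x y, `|rho x - rho y| <= Lr * `|x - y|)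
  (rho1 : (\int[muN]_s (rho s)%:E = 1)%E).

(** A convolution with the reflected kernel: only points [x + s] with [s] in the cube [0, d]^n
    contribute, so points are moved in nonnegative directions only. *)
Definition mollify (H : 'rV[R]_n -> R) x : R := \int[muN]_s (rho s * H (x + s)).

Let mrho : measurable_fun setT rho.
Proof. by apply: continuous_measurable_rV; exact: lipschitz_continuous rhoL. Qed.

Let irho : muN.-integrable setT (EFin \o rho).
Proof.
apply/integrableP; split; first exact/measurable_EFinP.
under eq_integral do rewrite /= ger0_norm//.
by rewrite rho1 ltry.
Qed.

Let irhoM (c : R) : muN.-integrable setT (EFin \o (fun s => c * rho s)).
Proof. exact: (@integrableZl _ _ _ muN setT measurableT c (EFin \o rho)). Qed.

Let RrhoM (c : R) : \int[muN]_s (c * rho s) = c.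
Proof. by rewrite RintegralZl// /Rintegral rho1 mulr1. Qed.

Let mrhoM H : measurable_fun setT H -> measurable_fun setT (fun s => rho s * H s).
Proof. by move=> mH; exact: measurable_funM. Qed.

(** The bound is asked only where [rho] does not vanish, so it covers Lipschitz functions, which may
    be unbounded on the whole space. *)
Lemma integrable_mul_mollifier H C : measurable_fun setT H -> (forall s, rho s != 0 -> `|H s| <= C) ->
  muN.-integrable setT (EFin \o (fun s => rho s * H s)).
Proof.
move=> mH HC; apply: (le_integrable measurableT _ _ (irhoM C)).
  by apply/measurable_EFinP; exact: mrhoM.
move=> s _ /=; rewrite lee_fin [leRHS]normrM normrM mulrC.
have [->|s0] := eqVneq (rho s) 0; first by rewrite normr0 !mulr0.
by rewrite ler_wpM2r// (le_trans (HC s s0))// ler_norm.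
Qed.

Let RrhoH H C : measurable_fun setT H -> (forall s, rho s != 0 -> `|H s| <= C) ->
  `|\int[muN]_s (rho s * H s)| <= C.
Proof.
move=> mH HC; have iH := integrable_mul_mollifier mH HC.
apply: le_trans (le_normr_Rintegral measurableT iH) _.
rewrite -[leRHS]RrhoM; apply: le_Rintegral => //.
  by have := integrable_abse iH; apply: eq_integrable.
move=> s _; rewrite normrM (ger0_norm (rho0 s)) mulrC.
have [->|s0] := eqVneq (rho s) 0; first by rewrite !mulr0.
by rewrite ler_wpM2r// HC.
Qed.

Let mH_shift H x : measurable_fun setT H -> measurable_fun setT (fun s : 'rV[R]_n => H (x + s)).
Proof. by move=> mH; apply: measurableT_comp => //; exact: measurable_addr_rV. Qed.

Lemma mollify_bound P C x : measurable_fun setT P -> (forall y, `|P y| <= C) ->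
  `|mollify P x| <= C.
Proof. by move=> mP PC; apply: RrhoH => //; exact: mH_shift. Qed.

Lemma measurable_mollify H : measurable_fun setT H -> measurable_fun setT (mollify H).
Proof.
move=> mH; pose f (p : 'rV[R]_n * 'rV[R]_n) : R := rho p.2 * H (p.1 + p.2).
have mf : measurable_fun setT (EFin \o f).
  apply/measurable_EFinP; apply: measurable_funM.
    exact: (measurableT_comp mrho measurable_snd).
  by apply: (measurableT_comp mH); apply: measurable_funD_rV; [exact: measurable_fst|exact: measurable_snd].
apply: (measurableT_comp (fine_measurable measurableT)).
under eq_fun do rewrite integralE.
apply: emeasurable_funB.
  rewrite (_ : (fun x => _) = fun x => (\int[muN]_s ((EFin \o f)^\+ (x, s)))%E); last first.
    by apply/funext => x; apply: eq_integral => s _; rewrite !funeposE.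
  apply: (measurable_fun_fubini_tonelli_F _ (m2 := muN)) => //.
  exact: measurable_funepos.
rewrite (_ : (fun x => _) = fun x => (\int[muN]_s ((EFin \o f)^\- (x, s)))%E); last first.
  by apply/funext => x; apply: eq_integral => s _; rewrite !funenegE.
apply: (measurable_fun_fubini_tonelli_F _ (m2 := muN)) => //.
exact: measurable_funeneg.
Qed.

Lemma mollify_close F Lam x : 0 <= Lam -> (forall x y, `|F x - F y| <= Lam * `|x - y|) ->
  `|mollify F x - F x| <= Lam * d.
Proof.
move=> L0 lip; have mF : measurable_fun setT F.
  by apply: continuous_measurable_rV; exact: lipschitz_continuous lip.
have FC s : rho s != 0 -> `|F (x + s) - F x| <= Lam * d.
  move=> s0; apply: le_trans (lip _ _) _; rewrite ler_wpM2l// addrAC subrr add0r.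
  apply: ler_norm_rV; first exact: ltW.
  by move=> i; have /andP[h1 h2] := rhoS s0 i; rewrite ger0_norm.
rewrite (_ : mollify F x - F x = \int[muN]_s (rho s * (F (x + s) - F x))).
  by apply: RrhoH => //; apply: measurable_funB => //; exact: mH_shift.
have iF : muN.-integrable setT (EFin \o (fun s => rho s * F (x + s))).
  apply: (@integrable_mul_mollifier _ (Lam * d + `|F x|)); first exact: mH_shift.
  move=> s s0; rewrite -[F (x + s)](subrK (F x)).
  by rewrite (le_trans (ler_normD _ _))// lerD2r FC.
transitivity (\int[muN]_s (rho s * F (x + s) - F x * rho s)).
  by rewrite (RintegralB measurableT iF (irhoM (F x))) RrhoM.
by apply: eq_Rintegral => s _; rewrite mulrBr (mulrC (F x)).
Qed.

Let mdrho P x : measurable_fun setT P -> measurable_fun setT (fun s => rho (s - x) * P s).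
Proof.
move=> mP; apply: measurable_funM => //; apply: measurableT_comp => //.
by apply: measurable_funD_rV => //; exact: measurable_id.
Qed.

Let box : set 'rV[R]_n := [set s | forall i, `[0, d]%classic (s ord0 i)].

Let mbox : measurable box. Proof. exact: measurable_cube. Qed.

Let boxE : muN box = (d ^+ n)%:E.
Proof. by rewrite borel_lebesgue_rV_cube// subr0. Qed.

(** Translation moves [x] from [P] into the kernel; the two kernels differ by at most [Lr |x - y|]
    on the union of two cubes of volume [d ^+ n], and vanish elsewhere. As [P] is only bounded and
    measurable, this makes mollified partial derivatives Lipschitz. *)
Lemma mollify_lipschitz P C x y : 0 <= C -> measurable_fun setT P -> (forall y, `|P y| <= C) ->
  `|mollify P x - mollify P y| <= (C * Lr * (2 * d ^+ n)) * `|x - y|.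
Proof.
move=> C0 mP PC.
have ib z : muN.-integrable setT (EFin \o (fun s => \1_box (s - z))).
  have mb : measurable_fun setT (fun s : 'rV[R]_n => \1_box (s - z) : R).
    apply: (measurableT_comp (measurable_indic (D := setT) mbox)) => //.
    by apply: measurable_funD_rV => //; exact: measurable_id.
  apply/integrableP; split; first exact/measurable_EFinP.
  under eq_integral do rewrite /= ger0_norm//.
  rewrite (ge0_integral_translation (f := fun s => (\1_box s)%:E) (- z))//.
    rewrite integral_indic// setIT.
    have : (muN box < +oo)%E by rewrite boxE ltry.
    exact.
  exact/measurable_EFinP/measurable_indic.
have Rb z : \int[muN]_s (\1_box (s - z)) = d ^+ n.
  rewrite (integral_translation (f := \1_box) (- z)); last exact: measurable_indic.
  rewrite /Rintegral integral_indic// setIT.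
  by transitivity (fine (muN box)) => //; rewrite boxE.
have molE z : mollify P z = \int[muN]_s (rho (s - z) * P s).
  rewrite -(integral_translation z (mdrho z mP)).
  by apply: eq_Rintegral => s _; rewrite addrK addrC.
have iP z : muN.-integrable setT (EFin \o (fun s => rho (s - z) * P s)).
  have /integrableP[_ fin] : muN.-integrable setT (EFin \o (fun s => rho s * P (z + s))).
    by apply: (@integrable_mul_mollifier _ C) => //; exact: mH_shift.
  apply/integrableP; split; first by apply/measurable_EFinP; exact: mdrho.
  rewrite -(ge0_integral_translation z)//=; last first.
    by apply/measurable_EFinP; apply: measurableT_comp => //; exact: mdrho.
  move: fin; congr (_ < _)%E; apply: eq_integral => s _ /=.
  by rewrite addrK addrC.
rewrite !molE -RintegralB//.
have iB : muN.-integrable setT (EFin \o (fun s => rho (s - x) * P s - rho (s - y) * P s)).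
  exact: (@integrableB _ _ _ muN setT measurableT _ _ (iP x) (iP y)).
apply: le_trans (le_normr_Rintegral measurableT iB) _.
pose c := C * Lr * `|x - y|.
have iD : muN.-integrable setT (EFin \o (fun s => \1_box (s - x) + \1_box (s - y))).
  exact: (@integrableD _ _ _ muN setT measurableT _ _ (ib x) (ib y)).
rewrite (_ : _ * _ = \int[muN]_s (c * (\1_box (s - x) + \1_box (s - y)))); last first.
  by rewrite (RintegralZl _ measurableT iD) (RintegralD measurableT (ib x) (ib y)) !Rb /c; ring.
apply: le_Rintegral => //.
- by have := integrable_abse iB; apply: eq_integrable.
- exact: (@integrableZl _ _ _ muN setT measurableT c _ iD).
move=> s _; rewrite -mulrBl normrM.
have ge0b z : 0 <= (\1_box (s - z) : R) by [].
have rb z : rho (s - z) != 0 -> (\1_box (s - z) : R) = 1.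
  by move=> /rhoS h; rewrite indicE mem_set// => i /=; rewrite in_itv/=; exact: h.
have [b0|b0] := eqVneq (\1_box (s - x) + \1_box (s - y) : R) 0.
  have rz z : (\1_box (s - z) : R) = 0 -> rho (s - z) = 0.
    by move=> bz; apply/eqP/negPn/negP => /rb; rewrite bz => /eqP; rewrite eq_sym oner_eq0.
  move/eqP: b0; rewrite paddr_eq0// => /andP[/eqP/rz -> /eqP/rz ->].
  rewrite subrr normr0 mul0r mulr_ge0 ?addr_ge0// /c mulr_ge0// mulr_ge0//.
have b1 : 1 <= (\1_box (s - x) + \1_box (s - y) : R).
  move: b0; rewrite !indicE; do 2 case: (_ \in _) => //=; rewrite ?addr0 ?eqxx//; lra.
have rL := rhoL (s - x) (s - y).
have e : s - x - (s - y) = y - x by rewrite opprB addrC addrA subrK.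
rewrite e [`|y - x|]distrC in rL.
apply: le_trans (ler_pM (normr_ge0 _) (normr_ge0 _) rL (PC s)) _.
rewrite (_ : Lr * `|x - y| * C = c * 1); last by rewrite /c; ring.
by rewrite ler_wpM2l// /c mulr_ge0// mulr_ge0.
Qed.

(** Jensen's inequality, from the tangent line P^2 >= 2 a P - a^2 at the mean [a]. *)
Lemma mollify_sqr P C x : measurable_fun setT P -> (forall y, `|P y| <= C) ->
  mollify P x ^+ 2 <= mollify (fun y => P y ^+ 2) x.
Proof.
move=> mP PC; set a := mollify P x.
have mPx := mH_shift x mP.
have i1 : muN.-integrable setT (EFin \o (fun s => rho s * P (x + s))).
  exact: (@integrable_mul_mollifier _ C).
have i2 : muN.-integrable setT (EFin \o (fun s => 2 * a * (rho s * P (x + s)))).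
  exact: (@integrableZl _ _ _ muN setT measurableT (2 * a) _ i1).
have i3 : muN.-integrable setT (EFin \o (fun s => rho s * P (x + s) ^+ 2)).
  apply: (@integrable_mul_mollifier _ (C ^+ 2)); first exact: measurable_funX.
  by move=> s _; rewrite normrX lerXn2r ?nnegrE// (le_trans _ (PC x)).
have -> : a ^+ 2 = \int[muN]_s (2 * a * (rho s * P (x + s)) - a ^+ 2 * rho s).
  rewrite (RintegralB measurableT i2 (irhoM _)) RrhoM (RintegralZl _ measurableT i1).
  rewrite -/(mollify P x) -/a; ring.
apply: le_Rintegral => //.
  exact: (@integrableB _ _ _ muN setT measurableT _ _ i2 (irhoM _)).
move=> s _; rewrite -subr_ge0.
rewrite (_ : _ - _ = rho s * (P (x + s) - a) ^+ 2); last by ring.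
by rewrite mulr_ge0// sqr_ge0.
Qed.

End mollification.

Section interval_integral.
Context {R : realType}.
Local Notation mu := (@lebesgue_measure R).

Lemma integrable_itv_bounded (h : R -> R) (a b M : R) : measurable_fun setT h ->
  (forall s, a < s <= b -> `|h s| <= M) -> mu.-integrable `]a, b] (EFin \o h).
Proof.
move=> mh hM; apply: measurable_bounded_integrable => //.
- have : (mu `]a, b]%classic < +oo)%E.
    by rewrite lebesgue_measure_itv/=; case: ifP => _; rewrite ?ltry// -EFinB ltry.
  exact.
- exact: measurable_funTS.
exists M; split; first by rewrite num_real.
by move=> M' MM s Is /=; rewrite (le_trans _ (ltW MM))// hM//; move: Is; rewrite /= in_itv.
Qed.

Lemma normr_Rintegral_itv_le (h : R -> R) (t M : R) : 0 < t -> measurable_fun setT h ->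
  (forall s, 0 < s <= t -> `|h s| <= M) -> `|\int[mu]_(s in `]0, t]) h s| <= t * M.
Proof.
move=> t0 mh hM; have ih := integrable_itv_bounded mh hM.
have mI : measurable `]0, t]%classic by exact: measurable_itv.
apply: le_trans (@le_normr_Rintegral _ _ _ mu _ h mI ih) _.
apply: (@le_trans _ _ (\int[mu]_(s in `]0, t]) M)).
  apply: le_Rintegral => //.
  - by have := integrable_abse ih; apply: eq_integrable.
  - by apply: (@integrable_itv_bounded (cst M) 0 t `|M|).
rewrite Rintegral_cst// mulrC.
have -> : fine (mu `]0, t]%classic) = t.
  by rewrite lebesgue_measure_itv/= lte_fin t0 -EFinB subr0.
exact: lexx.
Qed.

End interval_integral.

Section mollified_lipschitz.
Context {R : realType} (n : nat).
Local Notation mu := (@lebesgue_measure R).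
Local Notation muN := (@borel_lebesgue_rV R n).
Implicit Types (x y s : 'rV[R]_n).
Variables (rho : 'rV[R]_n -> R) (d Lr : R).
Hypotheses (d0 : 0 < d) (Lr0 : 0 <= Lr) (rho0 : forall s, 0 <= rho s)
  (rhoS : forall s, rho s != 0 -> forall i, 0 <= s ord0 i <= d)
  (rhoL : forall x y, `|rho x - rho y| <= Lr * `|x - y|)
  (rho1 : (\int[muN]_s (rho s)%:E = 1)%E).

Let mrho : measurable_fun setT rho.
Proof. by apply: continuous_measurable_rV; exact: lipschitz_continuous rhoL. Qed.

Section derivative.
Variables (F : 'rV[R]_n -> R) (Lam : R) (k : 'I_n).
Hypotheses (L0 : 0 < Lam) (lip : forall x y, `|F x - F y| <= Lam * `|x - y|).

Let P := partial_on F k.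
Let mP : measurable_fun setT P. Proof. exact: (measurable_partial_on k lip). Qed.
Let PL x : `|P x| <= Lam. Proof. exact: (partial_on_bound k L0 lip). Qed.
Let g := mollify rho F.
Let A := mollify rho P.

Let iP x : muN.-integrable setT (EFin \o (fun s => rho s * P (x + s))).
Proof.
apply: (integrable_mul_mollifier rho0 rhoL rho1 (C := Lam)) => //.
by apply: measurableT_comp => //; exact: measurable_addr_rV.
Qed.

Let mF : measurable_fun setT F.
Proof. by apply: continuous_measurable_rV; exact: lipschitz_continuous lip. Qed.

Let iF x : muN.-integrable setT (EFin \o (fun s => rho s * F (x + s))).
Proof.
apply: (integrable_mul_mollifier rho0 rhoL rho1 (C := Lam * d + `|F x|)).
  by apply: measurableT_comp => //; exact: measurable_addr_rV.
move=> s s0; rewrite -[F (x + s)](subrK (F x)).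
rewrite (le_trans (ler_normD _ _))// lerD2r (le_trans (lip _ _))// ler_wpM2l ?(ltW L0)//.
rewrite addrAC subrr add0r; apply: ler_norm_rV; first exact: ltW.
by move=> i; have /andP[h1 h2] := rhoS s0 i; rewrite ger0_norm.
Qed.

Let Lm := Lam * Lr * (2 * d ^+ n).

Lemma mollify_partial_lipschitz x y : `|A x - A y| <= Lm * `|x - y|.
Proof. exact: (mollify_lipschitz d0 Lr0 rho0 rhoS rhoL rho1 _ _ (ltW L0) mP PL). Qed.

Let mAr x : measurable_fun setT (fun r : measurableTypeR R => A (shift_rV k r x)).
Proof.
apply: measurableT_comp; last by apply: measurable_shift_rV => //; exact: measurable_id.
by apply: continuous_measurable_rV; exact: lipschitz_continuous mollify_partial_lipschitz.
Qed.

(** [lipschitz_line_ftc] at every translate [x + s], averaged over [s]; Fubini exchanges the two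
    integrals, [t Lam] being a bound for the double integral. Thus [A] is the derivative of [g] in
    direction [k], in integrated form. *)
Lemma mollify_ftc x (t : R) : 0 < t ->
  g (shift_rV k t x) - g x = \int[mu]_(r in `]0, t]) A (shift_rV k r x).
Proof.
move=> t0; pose I := `]0, t]%classic : set (measurableTypeR R).
have mI : measurable I by exact: measurable_itv.
have muI : mu I = t%:E by rewrite /I lebesgue_measure_itv/= lte_fin t0 -EFinB subr0.
pose f (p : measurableTypeR R * 'rV[R]_n) : R :=
  \1_I p.1 * (rho p.2 * P (shift_rV k p.1 x + p.2)).
have mf : measurable_fun setT (EFin \o f).
  apply/measurable_EFinP; apply: measurable_funM.
    exact: (measurableT_comp (measurable_indic (D := setT) mI) measurable_fst).
  apply: measurable_funM; first exact: (measurableT_comp mrho measurable_snd).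
  apply: (measurableT_comp mP); apply: measurable_funD_rV; last exact: measurable_snd.
  by apply: measurable_shift_rV => //; exact: measurable_fst.
have irho : muN.-integrable setT (EFin \o (fun s => Lam * rho s)).
  apply: (@integrableZl _ _ _ muN setT measurableT Lam (EFin \o rho)).
  have := integrable_mul_mollifier rho0 rhoL rho1 (H := cst 1) (C := 1).
  under eq_fun do rewrite mulr1; apply => //; move=> s _; rewrite normr1//.
have intf : (mu \x muN)%E.-integrable setT (EFin \o f).
  apply/(integrable12ltyP mu muN mf).
  apply: (@le_lt_trans _ _ (\int[mu]_r ((\1_I r)%:E * Lam%:E)))%E; last first.
    rewrite ge0_integralZr ?lee_fin ?(ltW L0)//; last exact/measurable_EFinP/measurable_indic.
    have -> : (\int[mu]_r (\1_I r)%:E = t%:E)%E by rewrite integral_indic// setIT; exact: muI.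
    by rewrite -EFinM ltry.
  apply: ge0_le_integral => //.
  - by move=> r _; exact: integral_ge0.
  - apply: (@measurable_fun_fubini_tonelli_F _ _ _ _ _ muN (fun p => `|(EFin \o f) p|)%E) => //.
    exact: measurableT_comp.
  - by apply: emeasurable_funM => //; exact/measurable_EFinP/measurable_indic.
  move=> r _; rewrite -EFinM.
  have -> : ((\1_I r * Lam)%:E = \int[muN]_s (\1_I r * (Lam * rho s))%:E)%E.
    under eq_integral do rewrite EFinM.
    rewrite ge0_integralZl_EFin//; last 2 first.
    - by move=> s _; rewrite lee_fin mulr_ge0// ltW.
    - by apply/measurable_EFinP; exact: measurable_funM.
    under eq_integral do rewrite EFinM.
    rewrite ge0_integralZl_EFin ?rho1 ?mule1 ?(ltW L0)//.
      by move=> s _; rewrite lee_fin.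
    exact/measurable_EFinP.
  apply: ge0_le_integral => //.
  - have mafr := measurableT_comp mf (measurable_pair1 r).
    by apply: measurableT_comp => //; exact: mafr.
  - by apply/measurable_EFinP; apply: measurable_funM => //; exact: measurable_funM.
  move=> s _; rewrite /f /= lee_fin normrM ger0_norm// ler_wpM2l//.
  by rewrite normrM (ger0_norm (rho0 s)) mulrC ler_wpM2r.
have E1 r : (\int[muN]_s (EFin \o f) (r, s) = (\1_I r * A (shift_rV k r x))%:E)%E.
  rewrite /f /=; under eq_integral do rewrite EFinM.
  rewrite (integralZl measurableT (iP _)) EFinM /A /mollify /Rintegral fineK//.
  exact: (integrable_fin_num measurableT (iP _)).
have E2 s : (\int[mu]_r (EFin \o f) (r, s) =
    (rho s * (F (shift_rV k t x + s) - F (x + s)))%:E)%E.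
  have Ps : mu.-integrable I (EFin \o (fun r => P (shift_rV k r (x + s)))).
    apply: (@integrable_itv_bounded _ _ 0 t Lam); last by move=> r _; exact: PL.
    apply: (measurableT_comp mP).
    by apply: measurable_shift_rV => //; exact: measurable_id.
  have sc r : shift_rV k r x + s = shift_rV k r (x + s) by rewrite /shift_rV addrAC.
  rewrite sc (lipschitz_line_ftc k L0 lip (x + s) t0) EFinM.
  rewrite /Rintegral fineK; last exact: (integrable_fin_num mI Ps).
  rewrite -(integralZl mI Ps) integral_mkcond; apply: eq_integral => r _.
  rewrite /f/= patchE indicE; case: ifP => _; last by rewrite mul0r.
  by rewrite mul1r EFinM sc.
have := Fubini intf.
under eq_integral do rewrite E1.
under [in RHS]eq_integral do rewrite E2.
move=> e; rewrite /g /mollify -(RintegralB measurableT (iF _) (iF _)).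
rewrite (_ : \int[muN]_s _ = \int[muN]_s (rho s * (F (shift_rV k t x + s) - F (x + s)))); last first.
  by apply: eq_Rintegral => s _; rewrite mulrBr.
rewrite /Rintegral -e; congr fine; rewrite [RHS]integral_mkcond; apply: eq_integral => r _.
by rewrite patchE indicE; case: ifP => _; rewrite ?mul0r ?mul1r.
Qed.

Let modulus_pos x (t : R) (m : 'rV[R]_n) (r : R) : 0 < t ->
  (forall i, `|x ord0 i - m ord0 i| <= r) ->
  (forall i, `|shift_rV k t x ord0 i - m ord0 i| <= r) ->
  `|g (shift_rV k t x) - g x| <= t * (`|A m| + Lm * r).
Proof.
move=> t0 xm tm; rewrite mollify_ftc//.
have r0 : 0 <= r by exact: le_trans (normr_ge0 _) (xm k).
have Lm0 : 0 <= Lm by rewrite /Lm mulr_ge0 ?mulr_ge0 ?exprn_ge0 ?(ltW d0)// ltW.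
apply: (normr_Rintegral_itv_le t0 (mAr x)) => s /andP[s0 st].
rewrite -[A (shift_rV _ _ _)](subrK (A m)) addrC (le_trans (ler_normD _ _))//.
rewrite lerD2l (le_trans (mollify_partial_lipschitz _ _))// ler_wpM2l//.
apply: ler_norm_rV => // i; have := xm i; have := tm i; rewrite !mxE.
case: (i == k); rewrite ?andbT ?andbF /= ?mulr1 ?mulr0 ?addr0//.
rewrite !ler_norml => /andP[h1 h2] /andP[h3 h4]; apply/andP; split; lra.
Qed.

(** The modulus that [defect_of_modulus] asks for. The segment stays within [r] of [m] in every
    coordinate because its endpoints do, so along it [A] differs from [A m] by at most [Lm * r]. A
    negative [t] swaps the endpoints. *)
Lemma mollify_modulus x (t : R) (m : 'rV[R]_n) (r : R) :
  (forall i, `|x ord0 i - m ord0 i| <= r) ->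
  (forall i, `|shift_rV k t x ord0 i - m ord0 i| <= r) ->
  `|g (shift_rV k t x) - g x| <= `|t| * (`|A m| + Lm * r).
Proof.
move=> xm tm; case: (ltgtP t 0) => [t0|t0|->].
- have xE : x = shift_rV k (- t) (shift_rV k t x) by rewrite shift_rVD addNr shift_rV0.
  have := @modulus_pos (shift_rV k t x) (- t) m r.
  by rewrite -xE oppr_gt0 distrC (ltr0_norm t0) => h; exact: h.
- by rewrite (gtr0_norm t0); exact: modulus_pos.
- by rewrite shift_rV0 subrr !normr0 mul0r.
Qed.

(* The mollifier lives in the positive orthant, so [x_k <= (x + s)_k] on its
   support and the weight can be moved inside the convolution. *)
Lemma ge0_integral_mollify_le (D E : set 'rV[R]_n) : measurable D -> measurable E ->
  (forall x, D x -> 0 <= x ord0 k) ->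
  (forall x s, D x -> rho s != 0 -> E (x + s)) ->
  (\int[muN]_(x in D) (x ord0 k ^+ 2 * A x ^+ 2)%:E <=
   \int[muN]_(x in E) (x ord0 k ^+ 2 * P x ^+ 2)%:E)%E.
Proof.
move=> mD mE Dk DE.
(* The set [E] enters as an indicator, so that the integrand is defined everywhere and translations
   act on the whole space. *)
pose q x : R := \1_E x * (x ord0 k ^+ 2 * P x ^+ 2).
have q0 x : 0 <= q x by rewrite mulr_ge0// mulr_ge0// sqr_ge0.
have mq : measurable_fun setT q.
  apply: measurable_funM; first exact: measurable_indic.
  by apply: measurable_funM; apply: measurable_funX => //; exact: measurable_coord.
pose f (p : 'rV[R]_n * 'rV[R]_n) : \bar R := (rho p.2 * q (p.1 + p.2))%:E.
have mf : measurable_fun setT f.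
  apply/measurable_EFinP; apply: measurable_funM.
    exact: (measurableT_comp mrho measurable_snd).
  by apply: (measurableT_comp mq); apply: measurable_funD_rV; [exact: measurable_fst|exact: measurable_snd].
have f0 p : (0 <= f p)%E by rewrite /f lee_fin mulr_ge0.
have mfF : measurable_fun setT (fun x => \int[muN]_s f (x, s))%E.
  exact: (@measurable_fun_fubini_tonelli_F _ _ _ _ _ muN).
have mA : measurable_fun setT A.
  by apply: continuous_measurable_rV; exact: lipschitz_continuous mollify_partial_lipschitz.
apply: (@le_trans _ _ (\int[muN]_x \int[muN]_s f (x, s))%E).
  apply: (@le_trans _ _ (\int[muN]_(x in D) \int[muN]_s f (x, s))%E); last first.
    by apply: ge0_subset_integral => // x _; exact: integral_ge0.
  apply: ge0_le_integral => //.
  - by move=> x _; rewrite lee_fin mulr_ge0// sqr_ge0.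
  - apply: measurable_funTS; apply/measurable_EFinP.
    by apply: measurable_funM; apply: measurable_funX => //; exact: measurable_coord.
  - exact: measurable_funTS.
  move=> x Dx.
  have mPx : measurable_fun setT (fun s => P (x + s) ^+ 2).
    by apply: measurable_funX; apply: measurableT_comp => //; exact: measurable_addr_rV.
  have iP2 : muN.-integrable setT (EFin \o (fun s => rho s * P (x + s) ^+ 2)).
    apply: (integrable_mul_mollifier rho0 rhoL rho1 (C := Lam ^+ 2)) => // s _.
    by rewrite normrX lerXn2r ?nnegrE// ?(ltW L0).
  apply: (@le_trans _ _ ((x ord0 k ^+ 2)%:E * (mollify rho (fun y => P y ^+ 2) x)%:E)%E).
    rewrite -EFinM lee_fin ler_wpM2l ?sqr_ge0//.
    exact: (mollify_sqr rho0 rhoL rho1 x mP PL).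
  rewrite /mollify /Rintegral fineK; last exact: integrable_fin_num.
  rewrite -ge0_integralZl_EFin//; last 3 first.
  - by move=> s _; rewrite lee_fin mulr_ge0// sqr_ge0.
  - by apply/measurable_EFinP; exact: measurable_funM.
  - exact: sqr_ge0.
  apply: ge0_le_integral => //.
  - move=> s _; rewrite -EFinM lee_fin; apply: mulr_ge0; first exact: sqr_ge0.
    by apply: mulr_ge0 => //; exact: sqr_ge0.
  - by apply: emeasurable_funM => //; apply/measurable_EFinP; exact: measurable_funM.
  - exact: (measurableT_comp mf (measurable_pair1 x)).
  move=> s _; rewrite /f/= -EFinM lee_fin mulrCA.
  have [->|s0] := eqVneq (rho s) 0; first by rewrite !mul0r.
  rewrite ler_wpM2l// /q indicE mem_set ?mul1r; last exact: DE.
  have xs : (x + s) ord0 k = x ord0 k + s ord0 k by rewrite mxE.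
  have xk := Dk x Dx; have /andP[sk _] := rhoS s0 k.
  rewrite ler_wpM2r ?sqr_ge0// xs lerXn2r ?nnegrE//; first by rewrite addr_ge0.
  by rewrite lerDl.
(* With [x] integrated first, the inner integral does not depend on [s] by translation invariance,
   and [rho] has total mass 1. *)
rewrite (@fubini_tonelli _ _ _ _ _ muN muN f mf f0).
have mqE : measurable_fun setT (EFin \o q) by exact/measurable_EFinP.
under eq_integral => s _.
  rewrite /f/=; under eq_integral do rewrite EFinM.
  rewrite ge0_integralZl_EFin//; last 2 first.
  - by move=> x _; rewrite lee_fin.
  - apply/measurable_EFinP; apply: (measurableT_comp mq).
    by apply: measurable_funD_rV => //; exact: measurable_id.
  rewrite (ge0_integral_translation (f := EFin \o q))//.
  over.
rewrite ge0_integralZr//; last 3 first.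
- exact/measurable_EFinP.
- by move=> s _; rewrite lee_fin.
- by apply: integral_ge0 => x _; rewrite lee_fin.
have -> : (\int[muN]_(x in E) (x ord0 k ^+ 2 * P x ^+ 2)%:E = \int[muN]_x (EFin \o q) x)%E.
  rewrite integral_mkcond; apply: eq_integral => x _.
  by rewrite patchE /q /= indicE; case: ifP => _; rewrite ?mul0r ?mul1r.
by rewrite rho1 mul1e.
Qed.

End derivative.
End mollified_lipschitz.

Section mollifier_existence.
Context {R : realType} (n : nat).
Local Notation muN := (@borel_lebesgue_rV R n).

(** A tent over the cube [0, d]^n in the supremum norm, divided by its integral [Z]. [Z] is finite
    because the tent is at most [d / 2] and supported in the cube, and positive because it is at
    least [d / 4] on the concentric cube [b2] of half the side. *)
Lemma mollifier_exists (d : R) : 0 < d -> exists (rho : 'rV[R]_n -> R) (Lr : R),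
  [/\ 0 <= Lr, forall s, 0 <= rho s,
      forall s, rho s != 0 -> forall i, 0 <= s ord0 i <= d,
      forall x y, `|rho x - rho y| <= Lr * `|x - y| &
      (\int[muN]_s (rho s)%:E = 1)%E].
Proof.
move=> d0; pose c : 'rV[R]_n := const_mx (d / 2).
pose u (s : 'rV[R]_n) := d / 2 - `|s - c|.
pose t (s : 'rV[R]_n) := Num.max 0 (u s).
have t0 s : 0 <= t s by rewrite /t le_max lexx.
have tu s : t s != 0 -> t s = u s /\ 0 < u s.
  by rewrite /t; case: (ltP 0 (u s)) => [us _|_ /eqP//]; split.
have tS s : t s != 0 -> forall i, 0 <= s ord0 i <= d.
  move=> /tu[_]; rewrite /u subr_gt0 => sc i.
  have := le_lt_trans (ler_norm_coord (s - c) i) sc.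
  rewrite !mxE ltr_norml => /andP[h1 h2]; apply/andP; split; lra.
have tL x y : `|t x - t y| <= 1 * `|x - y|.
  have uL : `|u x - u y| <= `|x - y|.
    rewrite (_ : u x - u y = `|y - c| - `|x - c|); last by rewrite /u; ring.
    by apply: le_trans (ler_dist_dist _ _) _; rewrite opprB addrA subrK distrC.
  rewrite mul1r; apply: le_trans uL; rewrite /t.
  case: (ltP 0 (u x)) => ux; case: (ltP 0 (u y)) => uy //.
  - by rewrite subr0 !gtr0_norm//; lra.
  - by rewrite sub0r normrN gtr0_norm// ler_normr; apply/orP; right; lra.
  - by rewrite subrr normr0.
have mt : measurable_fun setT t.
  by apply: continuous_measurable_rV; exact: lipschitz_continuous tL.
have mtE : measurable_fun setT (EFin \o t) by exact/measurable_EFinP.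
pose Z := (\int[muN]_s (t s)%:E)%E.
pose b1 : set 'rV[R]_n := [set s | forall i, `[0, d]%classic (s ord0 i)].
pose b2 : set 'rV[R]_n := [set s | forall i, `[d / 4, 3 * d / 4]%classic (s ord0 i)].
have mb1 : measurable b1 by exact: measurable_cube.
have mb2 : measurable b2 by exact: measurable_cube.
have d4 : d / 4 < 3 * d / 4 by lra.
have ib (b : set 'rV[R]_n) (e : R) : measurable b -> 0 <= e ->
    (\int[muN]_s (e * \1_b s)%:E = e%:E * muN b)%E.
  move=> mb e0; under eq_integral do rewrite EFinM.
  rewrite ge0_integralZl_EFin//; first by rewrite integral_indic// setIT.
  by apply/measurable_EFinP; exact: measurable_indic.
have Zoo : (Z < +oo)%E.
  apply: (@le_lt_trans _ _ (\int[muN]_s (d / 2 * \1_b1 s)%:E)%E); last first.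
    by rewrite ib ?divr_ge0 ?(ltW d0)// borel_lebesgue_rV_cube// -EFinM ltry.
  apply: ge0_le_integral => //.
  - by move=> s _; rewrite lee_fin.
  - by apply/measurable_EFinP; apply: measurable_funM => //; exact: measurable_indic.
  move=> s _; rewrite lee_fin; have [->|ts] := eqVneq (t s) 0.
    by rewrite mulr_ge0// divr_ge0// ltW.
  rewrite indicE mem_set; last by move=> i; rewrite /= in_itv/=; exact: tS.
  by have [-> _] := tu s ts; rewrite mulr1 /u gerBl.
have Z0 : (0 < Z)%E.
  apply: (@lt_le_trans _ _ (\int[muN]_s (d / 4 * \1_b2 s)%:E)%E).
    rewrite ib ?divr_ge0 ?(ltW d0)// borel_lebesgue_rV_cube// -EFinM lte_fin.
    by rewrite mulr_gt0 ?divr_gt0// exprn_gt0// subr_gt0.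
  apply: ge0_le_integral => //.
  - by move=> s _; rewrite lee_fin mulr_ge0// divr_ge0// ltW.
  - by apply/measurable_EFinP; apply: measurable_funM => //; exact: measurable_indic.
  move=> s _; rewrite lee_fin indicE; have [sb|nsb] := pselect (b2 s); last by rewrite memNset// mulr0.
  rewrite mem_set// mulr1 /t le_max; apply/orP; right.
  have sc : `|s - c| <= d / 4.
    apply: ler_norm_rV; first by rewrite divr_ge0// ltW.
    move=> i; have := sb i; rewrite /= in_itv/= !mxE ler_norml => /andP[h1 h2].
    by apply/andP; split; lra.
  by rewrite /u; lra.
have Zfin : Z \is a fin_num by rewrite ge0_fin_numE// ltW.
pose z := fine Z.
have zE : Z = z%:E by rewrite /z fineK.
have z0 : 0 < z by rewrite -lte_fin -zE.
exists (fun s => z^-1 * t s), z^-1; split.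
- by rewrite invr_ge0 ltW.
- by move=> s; rewrite mulr_ge0// invr_ge0 ltW.
- by move=> s; rewrite mulf_eq0 negb_or => /andP[_]; exact: tS.
- move=> x y; rewrite -mulrBr normrM gtr0_norm ?invr_gt0//.
  by rewrite ler_wpM2l ?invr_ge0 ?(ltW z0)//; have := tL x y; rewrite mul1r.
under eq_integral do rewrite EFinM.
rewrite ge0_integralZl_EFin ?invr_ge0 ?(ltW z0)//.
  by rewrite -/Z zE -EFinM mulVf// gt_eqF.
by move=> s _; rewrite lee_fin.
Qed.

End mollifier_existence.

(** * The variance inequality for Lipschitz functions, by shrinking the mollifier *)

Section lipschitz_variance.
Context {R : realType} (l : nat) (l1 : (1 < l)%N) (n : nat).
Local Notation muN := (@borel_lebesgue_rV R n).
Local Notation L := (l%:R ^+ 2 / (l%:R - 1) : R).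

Let L0 : 0 < L.
Proof.
by rewrite divr_gt0 ?exprn_gt0 ?ltr0n ?(ltn_trans _ l1)// subr_gt0 ltr1n.
Qed.

Implicit Types (x y s : 'rV[R]_n) (d : R).
Variables (D E : set 'rV[R]_n) (F : 'rV[R]_n -> R) (Lam al B e0 : R).
Hypotheses (mD : measurable D) (mE : measurable E) (al0 : 0 < al) (alB : al <= B)
  (DB : forall x, D x -> forall i, al <= x ord0 i <= B)
  (Dmean : forall x y, D x -> D y -> D (rmean_rV l x y))
  (e00 : 0 < e0)
  (DE : forall x s, D x -> (forall i, 0 <= s ord0 i <= e0) -> E (x + s))
  (Lam0 : 0 < Lam) (lip : forall x y, `|F x - F y| <= Lam * `|x - y|).

Let V := fine (muN D).
Let C := `|F 0| + Lam * B.

Let D0B x : D x -> forall i, 0 < x ord0 i <= B.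
Proof. by move=> Dx i; have /andP[h1 h2] := DB Dx i; rewrite h2 (lt_le_trans al0). Qed.

Let muDoo : (muN D < +oo)%E.
Proof. exact: borel_lebesgue_rV_bounded mD D0B. Qed.

Let B0 : 0 < B. Proof. exact: lt_le_trans alB. Qed.

Let C0 : 0 <= C. Proof. by rewrite addr_ge0// mulr_ge0// ltW. Qed.

Let FC x : D x -> `|F x| <= C.
Proof.
move=> Dx; rewrite -[F x](subrK (F 0)) addrC (le_trans (ler_normD _ _))// lerD2l.
rewrite (le_trans (lip _ _))// ler_wpM2l ?(ltW Lam0)// subr0.
apply: ler_norm_rV; first exact: ltW.
by move=> i; have /andP[h1 h2] := D0B Dx i; rewrite gtr0_norm.
Qed.

Let integ (f : 'rV[R]_n -> R) M : measurable_fun setT f ->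
  (forall x, D x -> `|f x| <= M) -> muN.-integrable D (EFin \o f).
Proof.
move=> mf fM; apply: measurable_bounded_integrable => //.
  exact: measurable_funTS.
exists M; split; first by rewrite num_real.
by move=> M' MM' x Dx /=; rewrite (le_trans (fM x Dx))// ltW.
Qed.

Let V0 : 0 <= V. Proof. by rewrite fine_ge0. Qed.

Let mF : measurable_fun setT F.
Proof. by apply: continuous_measurable_rV; exact: lipschitz_continuous lip. Qed.

Let var (f : 'rV[R]_n -> R) :=
  V * \int[muN]_(x in D) (f x ^+ 2) - (\int[muN]_(x in D) f x) ^+ 2.

(** The difference of the squares and that of the squared integrals both factor, with one factor of
    size [eta] and the other controlled by [2 C + 1]; each contributes half of the error. *)
Let var_close (g : 'rV[R]_n -> R) eta : measurable_fun setT g -> 0 <= eta <= 1 ->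
  (forall x, D x -> `|g x - F x| <= eta) -> var F <= var g + 2 * V ^+ 2 * (2 * C + 1) * eta.
Proof.
move=> mg /andP[eta0 eta1] gF.
have gC x : D x -> `|g x| <= C + 1.
  move=> Dx; rewrite -[g x](subrK (F x)) addrC (le_trans (ler_normD _ _))// lerD ?FC//.
  by rewrite (le_trans (gF x Dx)).
have ig := integ mg gC; have iF := integ mF FC.
have sq (h : 'rV[R]_n -> R) M : (forall x, D x -> `|h x| <= M) ->
    forall x, D x -> `|h x ^+ 2| <= M ^+ 2.
  move=> hM x Dx; rewrite normrX lerXn2r ?nnegrE ?hM//.
  by rewrite (le_trans (normr_ge0 (h x)))// hM.
have ig2 := integ (measurable_funX 2 mg) (sq _ _ gC).
have iF2 := integ (measurable_funX 2 mF) (sq _ _ FC).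
have icst (k : R) : muN.-integrable D (EFin \o cst k) by apply: (@integ _ `|k|).
have cE (k : R) : \int[muN]_(x in D) k = k * V by rewrite Rintegral_cst.
have Fg x : D x -> F x ^+ 2 <= g x ^+ 2 + (2 * C + 1) * eta.
  move=> Dx; rewrite -lerBlDl.
  rewrite (_ : _ - _ = (F x - g x) * (F x + g x)); last by ring.
  apply: le_trans (ler_norm _) _; rewrite normrM mulrC distrC.
  apply: ler_pM => //; last exact: gF.
  by apply: le_trans (ler_normD _ _) _; have := FC Dx; have := gC x Dx; lra.
have h1 : \int[muN]_(x in D) (F x ^+ 2) <=
    \int[muN]_(x in D) (g x ^+ 2) + (2 * C + 1) * eta * V.
  rewrite -cE -(RintegralD mD ig2 (icst _)); apply: le_Rintegral => //.
  exact: (@integrableD _ _ _ muN D mD _ _ ig2 (icst _)).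
have bnd (h : 'rV[R]_n -> R) M : measurable_fun setT h -> (forall x, D x -> `|h x| <= M) ->
    `|\int[muN]_(x in D) h x| <= M * V.
  move=> mh hM; have ih := integ mh hM.
  apply: le_trans (le_normr_Rintegral mD ih) _; rewrite -cE.
  apply: le_Rintegral; [exact: mD| |exact: icst|exact: hM].
  by have := integrable_abse ih; apply: eq_integrable.
have h2 : `|\int[muN]_(x in D) g x - \int[muN]_(x in D) F x| <= eta * V.
  rewrite -(RintegralB mD ig iF); apply: bnd => //; exact: measurable_funB.
have h3 := bnd _ _ mg gC; have h4 := bnd _ _ mF FC.
have h5 : (\int[muN]_(x in D) g x) ^+ 2 - (\int[muN]_(x in D) F x) ^+ 2 <=
    eta * V * ((2 * C + 1) * V).
  rewrite subr_sqr; apply: le_trans (ler_norm _) _; rewrite normrM.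
  apply: ler_pM => //; apply: le_trans (ler_normD _ _) _.
  by rewrite (_ : (2 * C + 1) * V = (C + 1) * V + C * V) ?lerD//; ring.
have hV := ler_wpM2l V0 h1; rewrite [leRHS]mulrDr in hV.
have key (a b c e X Y : R) : a <= b + Y -> c - e <= X -> a - e <= b - c + (X + Y) by lra.
rewrite /var (_ : 2 * V ^+ 2 * _ * eta =
  eta * V * ((2 * C + 1) * V) + V * ((2 * C + 1) * eta * V)); first exact: key.
by move: (2 * C + 1) => c; ring.
Qed.

(** [variance_le_of_defect] for the mollified function, [q] being the weighted squares of the
    mollified partial derivatives. The Lipschitz constant of these depends on the kernel, but it
    only decides how small the exponent parameter has to be in [defect_of_modulus]; the error that
    survives is a multiple of [Lam * d]. *)
Let var_mollify (d : R) : 0 < d -> d <= e0 -> Lam * d <= 1 ->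
  ((var F)%:E <= V%:E * (L%:E * \sum_(k < n) \int[muN]_(x in E)
     (x ord0 k ^+ 2 * partial_on F k x ^+ 2)%:E) +
     (2 * V ^+ 2 * (2 * C + 1) * (Lam * d))%:E)%E.
Proof.
move=> d0 de Ld.
have [rho [Lr [Lr0 rho0 rhoS rhoL rho1]]] := mollifier_exists n d0.
pose g := mollify rho F; pose A k := mollify rho (partial_on F k).
have gF x : `|g x - F x| <= Lam * d.
  by apply: (mollify_close d0 rho0 rhoS rhoL rho1 x (ltW Lam0) lip).
have AL k x : `|A k x| <= Lam.
  apply: (mollify_bound rho0 rhoL rho1 x (measurable_partial_on k lip)).
  exact: partial_on_bound.
have mA k : measurable_fun setT (A k).
  apply: continuous_measurable_rV.
  apply: (@lipschitz_continuous _ _ _ (Lam * Lr * (2 * d ^+ n))) => x y.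
  exact: (@mollify_partial_lipschitz R n rho d Lr d0 Lr0 rho0 rhoS rhoL rho1 F Lam k Lam0 lip x y).
have mg : measurable_fun setT g.
  apply: measurable_mollify; last exact: mF.
  exact: rhoL.
have gC x : D x -> `|g x| <= C + 1.
  move=> Dx; rewrite -[g x](subrK (F x)) addrC (le_trans (ler_normD _ _))// lerD ?FC//.
  by rewrite (le_trans (gF x)).
pose q x := \sum_k L * (x ord0 k ^+ 2 * A k x ^+ 2).
pose Q := n%:R * (L * (B ^+ 2 * Lam ^+ 2)).
have Q0 : 0 <= Q.
  by apply: mulr_ge0 => //; apply: mulr_ge0 (ltW L0) _; apply: mulr_ge0; exact: sqr_ge0.
have mxA k : measurable_fun setT (fun x : 'rV[R]_n => x ord0 k ^+ 2 * A k x ^+ 2).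
  by apply: measurable_funM; apply: measurable_funX => //; exact: measurable_coord.
have mq : measurable_fun setT q.
  by apply: measurable_sum => k; apply: measurable_funM.
have q0 x : 0 <= q x.
  by apply: sumr_ge0 => k _; rewrite mulr_ge0 ?(ltW L0)// mulr_ge0// sqr_ge0.
have qQ x : D x -> q x <= Q.
  move=> Dx; rewrite /Q -[n in n%:R]card_ord -sum1_card natr_sum mulr_suml.
  apply: ler_sum => k _; rewrite mul1r ler_wpM2l ?(ltW L0)//.
  have /andP[x0 xB] := D0B Dx k.
  rewrite ler_pM ?sqr_ge0//; first by rewrite lerXn2r ?nnegrE ?(ltW x0) ?(ltW B0).
  by rewrite -[A k x ^+ 2]ger0_norm ?sqr_ge0// normrX lerXn2r ?nnegrE ?(ltW Lam0).
have varg : var g <= V * \int[muN]_(x in D) q x.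
  (* One constant, [C + 1 + Q], bounds both [g] and [q] on [D]. *)
  apply: (@variance_le_of_defect _ l (ltnW l1) n D g q B (C + 1 + Q)) => //.
  - by move=> x Dx; rewrite (le_trans (gC x Dx))// lerDl.
  - by move=> x Dx; rewrite q0 (le_trans (qQ x Dx))// lerDr addr_ge0.
  have C1 : 0 <= C + 1 by rewrite addr_ge0.
  have c0 : 0 <= Lam * Lr * (2 * d ^+ n).
    by rewrite !mulr_ge0 ?exprn_ge0 ?(ltW d0) ?(ltW Lam0).
  apply: (defect_of_modulus l1 al0 alB C1 (ltW Lam0) c0 DB gC AL).
  move=> k x t m r xm tm.
  exact: (mollify_modulus d0 Lr0 rho0 rhoS rhoL rho1 Lam0 lip xm tm).
have iq : muN.-integrable D (EFin \o q).
  by apply: (@integ _ Q) => // x Dx; rewrite ger0_norm// qQ.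
have qE : ((\int[muN]_(x in D) q x)%:E <= L%:E * \sum_(k < n) \int[muN]_(x in E)
     (x ord0 k ^+ 2 * partial_on F k x ^+ 2)%:E)%E.
  rewrite /Rintegral fineK; last exact: (integrable_fin_num mD iq).
  rewrite ge0_sume_distrr; last first.
    by move=> k _; apply: integral_ge0 => x _; rewrite lee_fin mulr_ge0// sqr_ge0.
  under eq_integral do rewrite /q -sumEFin.
  rewrite ge0_integral_sum//; last 2 first.
  - by move=> k; apply: measurable_funTS; apply/measurable_EFinP; exact: measurable_funM.
  - by move=> k x _; rewrite lee_fin mulr_ge0 ?(ltW L0)// mulr_ge0// sqr_ge0.
  apply: lee_sum => k _; under eq_integral do rewrite EFinM.
  rewrite ge0_integralZl_EFin ?(ltW L0)//; last 2 first.
  - by move=> x _; rewrite lee_fin mulr_ge0// sqr_ge0.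
  - by apply: measurable_funTS; exact/measurable_EFinP.
  apply: lee_wpmul2l; first by rewrite lee_fin ltW.
  apply: (ge0_integral_mollify_le d0 Lr0 rho0 rhoS rhoL rho1 Lam0 lip mD mE).
  - by move=> x Dx; have /andP[/ltW] := D0B Dx k.
  - move=> x s Dx s0; apply: DE => // i; have /andP[-> sd] := rhoS s s0 i.
    exact: le_trans de.
have Ld0 : 0 <= Lam * d <= 1 by rewrite Ld mulr_ge0// ltW.
have h := var_close mg Ld0 (fun x _ => gF x).
apply: (@le_trans _ _ ((var g)%:E + (2 * V ^+ 2 * (2 * C + 1) * (Lam * d))%:E)%E).
  by rewrite -EFinD lee_fin.
apply: leeD => //.
apply: (@le_trans _ _ (V * \int[muN]_(x in D) q x)%:E); first by rewrite lee_fin.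
by rewrite EFinM lee_wpmul2l.
Qed.

(** The main term of [var_mollify] does not involve [d], so [d] can tend to 0 with [D], [E] and [F]
    fixed. *)
Lemma variance_le_lipschitz :
  ((V * \int[muN]_(x in D) (F x ^+ 2) - (\int[muN]_(x in D) F x) ^+ 2)%:E <=
   V%:E * (L%:E * \sum_(k < n) \int[muN]_(x in E)
     (x ord0 k ^+ 2 * partial_on F k x ^+ 2)%:E))%E.
Proof.
apply/lee_addgt0Pr => e e_gt0.
pose M := 2 * V ^+ 2 * (2 * C + 1) * Lam.
have M0 : 0 <= M by rewrite !mulr_ge0 ?sqr_ge0 ?(ltW Lam0)// addr_ge0// mulr_ge0.
have M1 : 0 < M + 1 by rewrite ltr_wpDl.
(* [e0] keeps the shifted points in [E], [Lam^-1] gives the condition [Lam * d <= 1], and the last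
   bound makes the error at most [e]. *)
pose d := Num.min e0 (Num.min Lam^-1 (e / (M + 1))).
have d0 : 0 < d by rewrite !lt_min e00 invr_gt0 Lam0 divr_gt0.
have de : d <= e0 by rewrite ge_min lexx.
have dL : d <= Lam^-1 by rewrite /d !ge_min lexx orbT.
have dM : d <= e / (M + 1) by rewrite /d !ge_min lexx !orbT.
have Ld : Lam * d <= 1 by rewrite mulrC -ler_pdivlMr// div1r.
apply: le_trans (var_mollify d0 de Ld) _; rewrite leeD2l// lee_fin.
rewrite mulrA -/M; apply: le_trans (ler_wpM2l M0 dM) _.
by rewrite mulrA ler_pdivrMr// mulrDr mulr1 mulrC lerDl ltW.
Qed.

End lipschitz_variance.

(** * Geometry of p-convex sets *)

Section rV_nbhs_extra.
Context {R : realType} (n : nat).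
Implicit Types (x y z : 'rV[R]_n).

Lemma cvgP_nbhs_rV (f : 'rV[R]_n -> 'rV[R]_n) y :
  (forall e, 0 < e -> exists2 r, 0 < r & forall z, (forall i, `|y ord0 i - z ord0 i| < r) ->
     forall i, `|f y ord0 i - f z ord0 i| < e) -> {for y, continuous f}.
Proof.
move=> h A /nbhs_rVP[e e0 eA]; have [r r0 hr] := h e e0.
by apply/nbhs_rVP; exists r => // z yz; apply/eA/hr.
Qed.

(** Finitely many strict inequalities have a common slack; the neutral element 1 of the minimum
    covers the case of no coordinates. *)
Lemma uniform_gap (v : 'I_n -> R) c : (forall i, v i < c) ->
  exists2 e, 0 < e & forall i, v i + e < c.
Proof.
move=> vc; pose e := \big[Num.min/1]_i ((c - v i) / 2).
have e0 : 0 < e.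
  by rewrite /e; elim/big_ind: _ => // [a b a0 b0|i _]; [rewrite lt_min a0|rewrite divr_gt0// subr_gt0].
exists e => // i; have : e <= (c - v i) / 2 by exact: bigmin_le_cond.
by have := vc i; lra.
Qed.

Lemma open_positive_orthant : open (positive_orthant R n).
Proof.
rewrite openE => x x0; have [e e0 he] : exists2 e, 0 < e & forall i, - x ord0 i + e < 0.
  by apply: uniform_gap => i; rewrite oppr_lt0.
apply/nbhs_rVP; exists e => // y xy i; have := he i; have := xy i.
by rewrite ltr_norml => /andP[h1 h2]; lra.
Qed.

End rV_nbhs_extra.

Section p_convex_geometry.
Context {R : realType} (l : nat) (l0 : (0 < l)%N) (n : nat).
Implicit Types (x y z s w : 'rV[R]_n) (r e a b : R) (m : nat).

Lemma rootr_subadditive a b : 0 <= a -> 0 <= b -> rootr l (a + b) <= rootr l a + rootr l b.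
Proof.
move=> a0 b0; rewrite leNgt; apply/negP => h.
have ra := rootr_ge0 l a; have rb := rootr_ge0 l b.
have ab : (rootr l a + rootr l b) ^+ l < a + b.
  by rewrite -[ltRHS](rootrK l0) ?addr_ge0// ltrXn2r ?nnegrE ?addr_ge0 ?rootr_ge0// -lt0n.
move: ab; rewrite ltNge => /negP; apply.
rewrite -{1}(rootrK l0 a0) -{1}(rootrK l0 b0); case: (l) l0 => // k _.
rewrite [leRHS]exprS mulrDl; apply: lerD; rewrite exprS ler_wpM2l ?rootr_ge0//.
  by rewrite lerXn2r ?nnegrE ?addr_ge0 ?rootr_ge0// lerDl rootr_ge0.
by rewrite lerXn2r ?nnegrE ?addr_ge0 ?rootr_ge0// lerDr rootr_ge0.
Qed.

(** Subadditivity makes the root uniformly continuous down to 0, which converts a radius [r] in root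
    coordinates into the radius [r ^+ l] in the original ones. *)
Lemma rootr_dist_lt a b r : 0 < r -> 0 <= a -> 0 <= b -> `|a - b| < r ^+ l ->
  `|rootr l a - rootr l b| < r.
Proof.
move=> r0; wlog ab : a b / b <= a.
  by move=> wl a0 b0; case: (leP b a) => [|/ltW] h; [exact: wl|rewrite distrC (distrC (rootr l a)); exact: wl].
move=> a0 b0; rewrite ger0_norm ?subr_ge0// => h.
have rab : rootr l b <= rootr l a by rewrite ler_rootr ?rootr_ge0// rootrK.
rewrite ger0_norm ?subr_ge0//.
have := @rootr_subadditive (a - b) b; rewrite subr_ge0 subrK => /(_ ab b0) h1.
have : rootr l (a - b) < r by rewrite ltr_rootr ?subr_ge0// ltW.
lra.
Qed.

Definition powX_rV (y : 'rV[R]_n) : 'rV[R]_n := \row_i (y ord0 i ^+ l).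
Definition rootr_rV (x : 'rV[R]_n) : 'rV[R]_n := \row_i rootr l (x ord0 i).

Lemma rootr_rVK x : positive_orthant R n x -> powX_rV (rootr_rV x) = x.
Proof. by move=> x0; apply/rowP => i; rewrite !mxE rootrK// ltW. Qed.

Lemma powX_rVK y : positive_orthant R n y -> rootr_rV (powX_rV y) = y.
Proof. by move=> y0; apply/rowP => i; rewrite !mxE exprnK// ltW. Qed.

Lemma rootr_rV_positive x : positive_orthant R n x -> positive_orthant R n (rootr_rV x).
Proof. by move=> x0 i; rewrite mxE rootr_gt0. Qed.

Lemma powX_rV_positive y : positive_orthant R n y -> positive_orthant R n (powX_rV y).
Proof. by move=> y0 i; rewrite mxE exprn_gt0. Qed.

Lemma rmean_rVE x y : rmean_rV l x y = powX_rV (2^-1 *: (rootr_rV x + rootr_rV y)).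
Proof. by apply/rowP => i; rewrite !mxE /rmean mulrC. Qed.

Lemma powX_rV_continuous : continuous powX_rV.
Proof.
move=> y; apply/cvgP_nbhs_rV => e e0.
pose M := `|y| + 1; have M0 : 0 < M by rewrite ltr_wpDl.
pose c := l%:R * (2 * M) ^+ l.-1; have c0 : 0 <= c by rewrite mulr_ge0// exprn_ge0// mulr_ge0// ltW.
exists (Num.min 1 (e / (c + 1))); first by rewrite lt_min ltr01 divr_gt0// ltr_wpDl.
move=> z yz i; rewrite !mxE; have := yz i; rewrite lt_min => /andP[h1].
rewrite ltr_pdivlMr ?ltr_wpDl// => h2; apply: le_lt_trans h2.
have yM : `|y ord0 i| <= M by rewrite (le_trans (ler_norm_coord y i))// lerDl.
have zM : `|z ord0 i| <= 2 * M.
  rewrite -[z ord0 i](subrK (y ord0 i)) (le_trans (ler_normD _ _))// distrC.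
  have : 1 <= M by rewrite lerDr.
  lra.
have y2M : `|y ord0 i| <= 2 * M by apply: le_trans yM _; lra.
apply: le_trans (ler_dist_expr _ y2M zM) _.
by rewrite ler_wpM2l// /c lerDl.
Qed.

Variable K : set 'rV[R]_n.
Hypotheses (Kpos : K `<=` positive_orthant R n) (Kconv : p_convex l%:R^-1 K).

Let V : set 'rV[R]_n := [set y | positive_orthant R n y /\ K (powX_rV y)].
Definition root_interior : set 'rV[R]_n :=
  [set y | positive_orthant R n y /\ K° (powX_rV y)].
Local Notation W := root_interior.

Let WV : W `<=` V.
Proof. by move=> y [y0 Ky]; split => //; exact: interior_subset. Qed.

(** The one place where p-convexity is unfolded, at weight 1/2. *)
Let V_mid y z : V y -> V z -> V (2^-1 *: (y + z)).
Proof.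
move=> [y0 Ky] [z0 Kz].
have im w : positive_orthant R n w -> K (powX_rV w) -> (powR_rV l%:R^-1 @` K) w.
  by move=> w0 Kw; exists (powX_rV w) => //; exact: powX_rVK.
have h0 : (0 : R) <= 2^-1 by rewrite invr_ge0.
have h1 : (2^-1 : R) <= 1 by rewrite invf_le1// ler1n.
have := Kconv (Itv01 h0 h1) (mem_set (im _ y0 Ky)) (mem_set (im _ z0 Kz)).
rewrite inE => -[x Kx xE].
have -> : 2^-1 *: (y + z) = rootr_rV x.
  transitivity (powR_rV l%:R^-1 x); last by apply/rowP => i; rewrite !mxE.
  rewrite xE scalerDr; congr (_ + _ *: _).
  by rewrite /unstable.onem /=; lra.
by split; [apply/rootr_rV_positive/Kpos|rewrite rootr_rVK//; exact: Kpos].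
Qed.

Lemma root_interior_nbhs y : W y ->
  exists2 r, 0 < r & forall z, (forall i, `|y ord0 i - z ord0 i| < r) -> W z.
Proof.
move=> [y0 Ky].
have /nbhs_rVP[r1 r10 h1] : nbhs y (powX_rV @^-1` K°).
  by apply: powX_rV_continuous; apply: open_nbhs_nbhs; split => //; exact: open_interior.
have /nbhs_rVP[r2 r20 h2] : nbhs y (positive_orthant R n).
  by apply: open_nbhs_nbhs; split => //; exact: open_positive_orthant.
exists (Num.min r1 r2); first by rewrite lt_min r10.
move=> z yz; split; [apply: h2|apply: h1] => i; have := yz i; rewrite lt_min => /andP[//].
Qed.

(** By [rootr_dist_lt], the ball of radius [r ^+ l] around [powX_rV y] has its roots in the given
    ball, hence lies in [K]. *)
Lemma root_interior_ball y r : 0 < r ->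
  (forall z, (forall i, `|y ord0 i - z ord0 i| < r) -> V z) -> W y.
Proof.
move=> r0 Vr.
have [y0 Ky] : V y by apply: Vr => i; rewrite subrr normr0.
split=> //; rewrite /interior /=; apply/nbhs_rVP.
(* If [y_i < r], lowering all coordinates by [y_i] would give a point of the ball with i-th
   coordinate 0, which cannot be in [V]. *)
have yr i : r <= y ord0 i.
  rewrite leNgt; apply/negP => h.
  have [/(_ i)] : V (y - y ord0 i *: const_mx 1).
    by apply: Vr => j; rewrite !mxE opprB addrCA subrr addr0 mulr1 gtr0_norm.
  by rewrite !mxE mulr1 subrr ltxx.
exists (r ^+ l); first exact: exprn_gt0.
move=> x xy.
have x0 : positive_orthant R n x.
  move=> i; have := xy i; rewrite mxE.
  have : r ^+ l <= y ord0 i ^+ l by rewrite lerXn2r ?nnegrE ?yr// ltW.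
  rewrite ltr_norml => h1 /andP[h2 h3]; lra.
suff [] : V (rootr_rV x) by rewrite rootr_rVK.
apply: Vr => i; rewrite mxE -{1}[y ord0 i](exprnK l0) ?(ltW (y0 i))//.
apply: rootr_dist_lt => //; first by rewrite exprn_ge0// ltW.
  exact: ltW.
by have := xy i; rewrite mxE.
Qed.

(** Each [w] near the midpoint is itself the midpoint of [v] and [2 w - v], and the latter is within
    [2 (r / 4) + r / 2 = r] of [z]. Here [y] need only be approximated by points of [V], so closure
    points are covered. *)
Let W_mid_approx y z r : 0 < r ->
  (forall w, (forall i, `|z ord0 i - w ord0 i| < r) -> W w) ->
  (exists2 v, V v & forall i, `|y ord0 i - v ord0 i| < r / 2) -> W (2^-1 *: (y + z)).
Proof.
move=> r0 Wr [v Vv yv]; apply: (@root_interior_ball _ (r / 4)); first by rewrite divr_gt0.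
move=> w mw; rewrite (_ : w = 2^-1 *: (v + (2 *: w - v))); last first.
  by rewrite addrC subrK scalerA mulVf ?scale1r.
apply: V_mid => //; apply/WV/Wr => i; have := mw i; have := yv i; rewrite !mxE.
by rewrite !ltr_norml => /andP[h1 h2] /andP[h3 h4]; apply/andP; split; lra.
Qed.

(** This feeds the comparison of the indicators of the closure and of the interior. Positivity of
    [x] is asked separately because the closure may reach the boundary of the orthant. *)
Lemma rmean_rV_interior_closure x x' : positive_orthant R n x -> closure K x -> K° x' ->
  K° (rmean_rV l x x').
Proof.
move=> x0 clx Kx'.
have x'0 : positive_orthant R n x' by apply: Kpos; exact: interior_subset.
have Wx' : W (rootr_rV x') by split; [exact: rootr_rV_positive|rewrite rootr_rVK].
have [r r0 Wr] := root_interior_nbhs Wx'.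
rewrite rmean_rVE; apply: (proj2 (W_mid_approx r0 Wr _)).
have r2 : 0 < (r / 2) ^+ l by rewrite exprn_gt0// divr_gt0.
have /clx[v [Kv xv]] : nbhs x [set v | forall i, `|x ord0 i - v ord0 i| < (r / 2) ^+ l].
  by apply/nbhs_rVP; exists ((r / 2) ^+ l).
have v0 := Kpos Kv.
exists (rootr_rV v); first by split; [exact: rootr_rV_positive|rewrite rootr_rVK].
move=> i; rewrite !mxE; apply: rootr_dist_lt; rewrite ?divr_gt0 ?(ltW (x0 i)) ?(ltW (v0 i))//.
Qed.

(* The points at distance at least [1 / (m + 1)] from the complement of the
   interior, in the coordinates [x_i^(1/l)] where this is a convex condition. *)
Definition root_core m : set 'rV[R]_n := [set y | (forall i, `|y ord0 i| <= m.+1%:R) /\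
  forall w, (forall i, `|y ord0 i - w ord0 i| < m.+1%:R^-1) -> W w].

Definition core m : set 'rV[R]_n :=
  [set x | positive_orthant R n x /\ root_core m (rootr_rV x)].

Lemma core_interior m : core m `<=` K°.
Proof.
move=> x [x0 [_ /(_ (rootr_rV x))[]]]; first by move=> i; rewrite subrr normr0 invr_gt0.
by rewrite rootr_rVK.
Qed.

Let root_core_W m : root_core m `<=` W.
Proof. by move=> y [_]; apply => i; rewrite subrr normr0 invr_gt0. Qed.

Lemma coreE m : core m = powX_rV @` root_core m.
Proof.
apply/seteqP; split => [x [x0 cx]|_ [y cy <-]].
  by exists (rootr_rV x) => //; exact: rootr_rVK.
have [y0 _] := root_core_W cy; split; first exact: powX_rV_positive.
by rewrite powX_rVK.
Qed.

(** In root coordinates the core is bounded, and closed because the points with some [w] outside [W]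
    strictly within the radius form an open set; its image under the continuous power map is then
    compact. *)
Lemma compact_core m : compact (core m).
Proof.
rewrite coreE; apply: continuous_compact.
  by apply: continuous_subspaceT; exact: powX_rV_continuous.
have cB : compact [set v : 'rV[R]_n | forall i, `[- m.+1%:R, m.+1%:R]%classic (v ord0 i)].
  have := @rV_compact R n (fun=> `[- m.+1%:R, m.+1%:R]%classic) (fun=> @segment_compact R _ _).
  exact.
apply: (subclosed_compact _ cB).
- rewrite (_ : root_core m = [set y | forall i, `|y ord0 i| <= m.+1%:R] `&`
    ~` [set y | exists2 w, ~ W w & forall i, `|y ord0 i - w ord0 i| < m.+1%:R^-1]).
    apply: closedI.
      rewrite (_ : [set _ | _] = ~` [set y | exists i, m.+1%:R < `|y ord0 i|]).
        apply: open_closedC; rewrite openE => y /= [i yi]; apply/nbhs_rVP.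
        exists (`|y ord0 i| - m.+1%:R); first by rewrite subr_gt0.
        move=> z /(_ i) yz; exists i; have := ler_dist_dist (y ord0 i) (z ord0 i).
        by have := ler_norm (`|y ord0 i| - `|z ord0 i|); lra.
      apply/seteqP; split => y /= h; first by move=> [i]; rewrite ltNge h.
      by move=> i; rewrite leNgt; apply/negP => yi; apply: h; exists i.
    apply: open_closedC; rewrite openE => y /= [w nW yw]; apply/nbhs_rVP.
    have [e e0 he] : exists2 e, 0 < e & forall i, `|y ord0 i - w ord0 i| + e < m.+1%:R^-1.
      exact: uniform_gap.
    exists e => // z yz; exists w => // i; apply: le_lt_trans (he i).
    rewrite (_ : z ord0 i - w ord0 i = (y ord0 i - w ord0 i) - (y ord0 i - z ord0 i)); last by ring.
    by rewrite (le_trans (ler_normB _ _))// lerD2l ltW.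
  apply/seteqP; split => y /=.
    by move=> [h1 h2]; split => // -[w nW yw]; apply/nW/h2.
  by move=> [h1 h2]; split => // w yw; apply: contrapT => nW; apply: h2; exists w.
- by move=> y [yb _] i /=; rewrite in_itv/= -ler_norml.
Qed.

Lemma measurable_core m : measurable (core m).
Proof.
apply: closed_measurable_rV; apply: (compact_closed _ (@compact_core m)).
exact: norm_hausdorff.
Qed.

Lemma core_bounds m x : core m x -> forall i,
  (m.+1%:R^-1 / 2) ^+ l <= x ord0 i <= m.+1%:R ^+ l.
Proof.
move=> [x0 [xb xW]] i; apply/andP; split; last first.
  rewrite -[leLHS](rootrK l0) ?(ltW (x0 i))// lerXn2r ?nnegrE ?rootr_ge0//.
  by have := xb i; rewrite mxE ger0_norm ?rootr_ge0.
have d0 : 0 < m.+1%:R^-1 :> R by rewrite invr_gt0.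
(* Lowering all coordinates by half the radius stays in [W], hence in the positive orthant. *)
have [/(_ i)] : W (rootr_rV x - (m.+1%:R^-1 / 2) *: const_mx 1).
  apply: xW => j; rewrite !mxE opprB addrCA subrr addr0 mulr1 gtr0_norm ?divr_gt0//.
  by rewrite ltr_pdivrMr// ltr_pMr// ltr1n.
rewrite !mxE mulr1 subr_gt0 => h _; rewrite -ler_rootr ?(ltW (x0 i)) ?(ltW h)//.
Qed.

(** A point [w] near the midpoint of the roots is displaced from it by some [s]; it is then the
    midpoint of the two roots, each displaced by the same [s], and these are in [W]. *)
Lemma core_rmean m x y : core m x -> core m y -> core m (rmean_rV l x y).
Proof.
move=> [x0 [xb xW]] [y0 [yb yW]].
have mpos : positive_orthant R n (2^-1 *: (rootr_rV x + rootr_rV y)).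
  by move=> i; rewrite !mxE mulr_gt0 ?addr_gt0 ?rootr_gt0 ?invr_gt0.
rewrite rmean_rVE; split; first exact: powX_rV_positive.
rewrite powX_rVK//; split.
  move=> i; have := xb i; have := yb i; rewrite !mxE normrM ger0_norm ?invr_ge0// => h1 h2.
  have := ler_normD (rootr l (x ord0 i)) (rootr l (y ord0 i)); lra.
move=> w mw; pose s := w - 2^-1 *: (rootr_rV x + rootr_rV y).
have sd i : `|s ord0 i| < m.+1%:R^-1.
  by have := mw i; rewrite distrC; congr (`|_| < _); rewrite !mxE.
have ball (u : 'rV[R]_n) : (forall i, `|u ord0 i - (u + s) ord0 i| < m.+1%:R^-1).
  by move=> i; rewrite mxE opprD addrA subrr sub0r normrN.
have Wx := xW _ (ball (rootr_rV x)); have Wy := yW _ (ball (rootr_rV y)).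
have [r r0 Wr] := root_interior_nbhs Wy.
rewrite (_ : w = 2^-1 *: ((rootr_rV x + s) + (rootr_rV y + s))); last first.
  by apply/rowP => i; rewrite !mxE; field.
apply: (W_mid_approx r0 Wr); exists (rootr_rV x + s); first exact: WV.
by move=> i; rewrite subrr normr0 divr_gt0.
Qed.

(** Index [2 m + 1] has radius 1 / (2 m + 2), half the radius of index [m]: the step from [x] to [y]
    uses one half and leaves the other. The power [l] comes from [rootr_dist_lt]. *)
Lemma core_step m x y : core m x -> positive_orthant R n y ->
  (forall i, `|x ord0 i - y ord0 i| < ((m.*2).+2%:R^-1) ^+ l) -> core (m.*2).+1 y.
Proof.
move=> [x0 [xb xW]] y0 xy.
have d0 : 0 < (m.*2).+2%:R^-1 :> R by rewrite invr_gt0.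
have rxy i : `|rootr l (x ord0 i) - rootr l (y ord0 i)| < (m.*2).+2%:R^-1.
  by apply: rootr_dist_lt; rewrite ?(ltW (x0 i)) ?(ltW (y0 i)).
have m2 : (m.*2).+2%:R = 2 * m.+1%:R :> R by rewrite -natrM mul2n doubleS.
have dE : m.+1%:R^-1 = 2 * (m.*2).+2%:R^-1 :> R by rewrite m2 invfM mulrA divff ?mul1r.
split=> //; split.
  move=> i; have := xb i; rewrite !mxE m2 => h1.
  have h2 : (m.*2).+2%:R^-1 <= 1 :> R by rewrite invf_le1// ler1n.
  have m1 : 1 <= m.+1%:R :> R by rewrite ler1n.
  have h3 := ler_norm (`|rootr l (y ord0 i)| - `|rootr l (x ord0 i)|).
  have h4 := ler_dist_dist (rootr l (y ord0 i)) (rootr l (x ord0 i)).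
  move: h1 h2 m1 h3 h4 (rxy i); rewrite (distrC (rootr l (y ord0 i))).
  by move: (_^-1) (m.+1%:R) => d M; lra.
move=> w yw; apply: xW => i; have := yw i; have := rxy i; rewrite !mxE dE => h1 h2.
rewrite (_ : _ - w ord0 i = (rootr l (x ord0 i) - rootr l (y ord0 i)) +
  (rootr l (y ord0 i) - w ord0 i)); last by ring.
by rewrite mulr_natl mulr2n; exact: (le_lt_trans (ler_normD _ _) (ltrD h1 h2)).
Qed.

Lemma core_nondecreasing : {homo core : p q / (p <= q)%N >-> p `<=` q}.
Proof.
move=> p q pq x [x0 [xb xW]]; split => //; split.
  by move=> i; rewrite (le_trans (xb i))// ler_nat.
move=> w xw; apply: xW => i; apply: lt_le_trans (xw i) _.
by rewrite lef_pV2 ?posrE// ler_nat.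
Qed.

Lemma bigcup_core : \bigcup_m core m = K°.
Proof.
apply/seteqP; split => [x [m _]|x Kx]; first exact: core_interior.
have x0 : positive_orthant R n x by apply: Kpos; exact: interior_subset.
have Wx : W (rootr_rV x) by split; [exact: rootr_rV_positive|rewrite rootr_rVK].
have [r r0 Wr] := root_interior_nbhs Wx.
pose m := maxn (Num.bound r^-1) (Num.bound `|rootr_rV x|).
exists m; [by []|split; [exact: x0|split]].
  move=> i; apply: le_trans (ler_norm_coord _ i) _; apply/ltW.
  apply: lt_le_trans (archi_boundP (normr_ge0 _)) _.
  by rewrite ler_nat leqW// leq_maxr.
move=> w xw; apply: Wr => i; apply: lt_le_trans (xw i) _.
rewrite -[leRHS]invrK lef_pV2 ?posrE ?invr_gt0//.
apply/ltW; apply: lt_le_trans (archi_boundP _) _; first by rewrite invr_ge0 ltW.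
by rewrite ler_nat leqW// leq_maxl.
Qed.

End p_convex_geometry.

(** * From locally Lipschitz on [K] to globally Lipschitz *)

Section lipschitz_extension.
Context {R : realType} (V : normedModType R).
Implicit Types (A : set V) (f : V -> R).

Lemma lipschitz_extension A f (Lam : R) : 0 <= Lam ->
  (forall x y, A x -> A y -> `|f x - f y| <= Lam * `|x - y|) ->
  exists2 F : V -> R, (forall x y, `|F x - F y| <= Lam * `|x - y|) &
    forall x, A x -> F x = f x.
Proof.
move=> L0 fL; have [[a Aa]|A0] := pselect (A !=set0); last first.
  exists (cst 0) => [x y|x Ax]; first by rewrite subrr normr0 mulr_ge0.
  by exfalso; apply: A0; exists x.
pose S x := [set f y + Lam * `|x - y| | y in A].
have S0 x : S x !=set0 by exists (f a + Lam * `|x - a|), a.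
have lbS x : has_lbound (S x).
  exists (f a - Lam * `|x - a|) => _ [y Ay <-].
  have := fL a y Aa Ay; rewrite ler_norml => /andP[_ h].
  have := ler_wpM2l L0 (ler_distD x a y); rewrite mulrDr (distrC a x); lra.
pose F x := inf (S x).
have F1 x y : F x - F y <= Lam * `|x - y|.
  rewrite lerBlDr -lerBlDl; apply: lb_le_inf => // _ [z Az <-]; rewrite lerBlDl.
  apply: (@le_trans _ _ (f z + Lam * `|x - z|)).
    by apply: ge_inf => //; exists z.
  by have := ler_wpM2l L0 (ler_distD y x z); rewrite mulrDr; lra.
exists F => [x y|x Ax].
  by rewrite ler_norml F1 andbT lerNl opprB distrC F1.
apply/le_anti/andP; split.
  by apply: ge_inf => //; exists x => //; rewrite subrr normr0 mulr0 addr0.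
apply: lb_le_inf => // _ [y Ay <-].
have := fL x y Ax Ay; rewrite ler_norml => /andP[_]; lra.
Qed.

(** The hypothesis gives a Lipschitz bound near each pair of points of [K], not only near the
    diagonal, so compactness of the square of [A] yields one constant for close and distant points
    alike. *)
Lemma locally_lipschitz_compact (K A : set V) f : compact A -> A `<=` K ->
  [locally [lipschitz f x | x in K]] ->
  exists2 Lam : R, 0 < Lam & forall x y, A x -> A y -> `|f x - f y| <= Lam * `|x - y|.
Proof.
move=> cA AK fK.
have /compact_near_coveringP cov := compact_setX cA cA.
pose P (M : R) (p : V * V) := (K `*` K) p -> `|f p.1 - f p.2| <= M * `|p.1 - p.2|.
have : \forall M \near +oo, A `*` A `<=` P M.
  apply: cov => p [Ap1 Ap2].
  have [N [Nreal hN]] := fK p (conj (AK _ Ap1) (AK _ Ap2)).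
  exists ([set q | (K `*` K) q -> `|f q.1 - f q.2| <= (N + 1) * `|q.1 - q.2|], [set M | N + 1 < M]).
    split; last by exists (N + 1); split; [exact: num_real|].
    by apply: hN; rewrite ltrDl.
  move=> [q M] [/= h1 h2] /h1 h; apply: le_trans h _.
  by rewrite ler_wpM2r// ltW.
move=> [N [_ hN]]; exists (`|N| + 1); first by rewrite ltr_wpDl.
move=> x y Ax Ay; apply: (hN (`|N| + 1) _ (x, y)) => //.
  by rewrite (le_lt_trans (ler_norm N))// ltrDl.
by split; exact: AK.
Qed.

End lipschitz_extension.

(** * The boundary of [K] is null, and the variance inequality on a core *)

Section boundary.
Context {R : realType} (l : nat) (l1 : (1 < l)%N) (n : nat).
Local Notation muN := (@borel_lebesgue_rV R n).
Let l0 : (0 < l)%N := ltnW l1.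
Variable K : set 'rV[R]_n.
Hypotheses (Kpos : K `<=` positive_orthant R n) (Kconv : p_convex l%:R^-1 K)
  (K0 : K° !=set0).
Implicit Types (x y : 'rV[R]_n) (b : nat).

(** Cutting by a box makes the measures finite, and the box is stable under [rmean_rV] ([P_rmean]),
    so that it does not disturb Prekopa-Leindler. *)
Let P b : set 'rV[R]_n := [set x | forall i, `]0, b.+1%:R]%classic (x ord0 i)].

Let mP b : measurable (P b).
Proof. by apply: (@measurable_box_rV _ _ (fun=> `]0, b.+1%:R]%classic)) => i; exact: measurable_itv. Qed.

Let C b := closure K `&` P b.
Let U b := K° `&` P b.

Let mC b : measurable (C b).
Proof. by apply: measurableI => //; apply: closed_measurable_rV; exact: closed_closure. Qed.

Let mU b : measurable (U b).
Proof. by apply: measurableI => //; apply: open_measurable_rV; exact: open_interior. Qed.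

Let UC b : U b `<=` C b.
Proof. by move=> x [Kx Px]; split => //; exact: (subset_closure (interior_subset Kx)). Qed.

Let PE b x : P b x -> forall i, 0 < x ord0 i <= b.+1%:R.
Proof. by move=> Px i; have := Px i; rewrite /= in_itv. Qed.

Let P_rmean b x y : P b x -> P b y -> P b (rmean_rV l x y).
Proof.
move=> /PE Px /PE Py i; have /andP[x0 xb] := Px i; have /andP[y0 yb] := Py i.
rewrite /= in_itv/= mxE rmean_gt0//= /rmean.
rewrite -[leRHS](rootrK l0)// lerXn2r ?nnegrE ?rootr_ge0//.
  by rewrite divr_ge0// addr_ge0// rootr_ge0.
have rle (t : R) : 0 < t -> t <= b.+1%:R -> rootr l t <= rootr l b.+1%:R.
  by move=> t0 tb; rewrite ler_rootr ?rootr_ge0// rootrK// ltW.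
have := rle _ x0 xb; have := rle _ y0 yb; lra.
Qed.

Let rdefect_rV_ge1 x y : positive_orthant R n x -> positive_orthant R n y ->
  1 <= rdefect_rV l x y.
Proof.
move=> x0 y0; rewrite /rdefect_rV; elim/big_ind: _ => // [a c a1 c1|i _].
  by rewrite -[1]mulr1 ler_pM.
apply: le_trans (rdefect_lower l1 (x0 i) (y0 i)).
have L1 : 0 <= l%:R - 1 :> R by rewrite subr_ge0 ler1n.
by rewrite -[leLHS]expR0 ler_expR; exact: mulr_ge0 L1 (sqr_ge0 _).
Qed.

(** Prekopa-Leindler for the indicators of [C b], [U b] and again [U b]: the mean of a closure point
    and an interior point is interior, and the defect is at least 1. *)
Let muCU b : (muN (C b) * muN (U b) <= muN (U b) * muN (U b))%E.
Proof.
have indE (A : set 'rV[R]_n) : measurable A -> muN A = (\int[muN]_x (\1_A x)%:E)%E.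
  by move=> mA; rewrite integral_indic// setIT.
rewrite !indE//; apply: (@prekopa_leindler _ l l0 n _ _ _ b.+1%:R).
- exact/measurable_EFinP/measurable_indic.
- exact/measurable_EFinP/measurable_indic.
- exact/measurable_EFinP/measurable_indic.
- by move=> x; rewrite !lee_fin indicE; case: (_ \in _); rewrite ?ler01 ?ler1n ?lexx//= ler0n.
- by move=> x; rewrite !lee_fin indicE; case: (_ \in _); rewrite ?ler01 ?ler1n ?lexx//= ler0n.
- move=> x; rewrite indicE eqe pnatr_eq0 eqb0 negbK inE => -[_]; exact: PE.
- move=> x; rewrite indicE eqe pnatr_eq0 eqb0 negbK inE => -[_]; exact: PE.
- by move=> x; rewrite lee_fin.
move=> x y x0 y0; rewrite -!EFinM lee_fin.
have d0 : 0 <= rdefect_rV l x y by apply: le_trans (rdefect_rV_ge1 x0 y0).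
have [[clx Px]|nCx] := pselect (C b x); last first.
  by rewrite [\1_(C b) x]indicE memNset// mul0r mulr_ge0.
have [[Ky Py]|nUy] := pselect (U b y); last first.
  by rewrite [\1_(U b) y]indicE memNset// mulr0 mulr_ge0.
have Um : U b (rmean_rV l x y).
  by split; [exact: (rmean_rV_interior_closure l0 Kpos Kconv)|exact: P_rmean].
have -> : \1_(U b) (rmean_rV l x y) = 1 :> R by rewrite indicE mem_set.
rewrite !mulr1.
apply: le_trans (rdefect_rV_ge1 x0 y0).
by rewrite !indicE; do 2 case: (_ \in _); rewrite ?mulr1 ?mulr0.
Qed.

Let muUoo b : (muN (U b) < +oo)%E.
Proof. by apply: (@borel_lebesgue_rV_bounded _ _ _ b.+1%:R) => // x [_]; exact: PE. Qed.

Let muCoo b : (muN (C b) < +oo)%E.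
Proof. by apply: (@borel_lebesgue_rV_bounded _ _ _ b.+1%:R) => // x [_]; exact: PE. Qed.

(** All large boxes contain a fixed cube around an interior point, so that [muCU] can be divided by
    the measure of [U b]. *)
Let muU_gt0 : exists b0, forall b, (b0 <= b)%N -> (0 < muN (U b))%E.
Proof.
have [x Kx] := K0.
have /nbhs_rVP[e e0 he] : nbhs x K° by apply: open_nbhs_nbhs; split => //; exact: open_interior.
pose b0 := Num.bound (`|x| + e); exists b0 => b bb.
pose c : 'I_n -> set (measurableTypeR R) :=
  fun i => `[x ord0 i - e / 2, x ord0 i + e / 2]%classic.
have cU : [set y : 'rV[R]_n | forall i, c i (y ord0 i)] `<=` U b.
  move=> y yc; have Ky : K° y.
    apply: he => i; have := yc i; rewrite /c/= in_itv/= => /andP[h1 h2].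
    by rewrite ltr_norml; apply/andP; split; lra.
  split => // i; rewrite /= in_itv/= (Kpos (interior_subset Ky))/=.
  have := yc i; rewrite /c/= in_itv/= => /andP[_ h2].
  apply: (@le_trans _ _ (`|x| + e)).
    by have := ler_norm_coord x i; have := ler_norm (x ord0 i); lra.
  apply/ltW/(lt_le_trans (archi_boundP _)); first by rewrite addr_ge0// ltW.
  by rewrite ler_nat leqW.
have mc i : measurable (c i) by exact: measurable_itv.
apply: (@lt_le_trans _ _ (muN [set y : 'rV[R]_n | forall i, c i (y ord0 i)])).
  rewrite (borel_lebesgue_rV_box mc); elim/big_ind: _ => // [p q p0 q0|i _].
    exact: mule_gt0.
  have lt : x ord0 i - e / 2 < x ord0 i + e / 2 by lra.
  by rewrite lebesgue_measure_itv/= lte_fin lt -EFinB lte_fin; lra.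
apply: le_measure; rewrite ?inE//; exact: measurable_box_rV.
Qed.

Lemma boundary_negligible : exists N : set 'rV[R]_n,
  [/\ measurable N, muN N = 0%E & K `\` K° `<=` N].
Proof.
have [b0 hb0] := muU_gt0.
have null b : (b0 <= b)%N -> muN (C b `\` U b) = 0%E.
  move=> bb; have U0 := hb0 b bb.
  have Ufin : muN (U b) \is a fin_num by rewrite ge0_fin_numE.
  have Cfin : muN (C b) \is a fin_num by rewrite ge0_fin_numE.
  have CU : (muN (C b) <= muN (U b))%E.
    have := muCU b; rewrite -(fineK Ufin) -(fineK Cfin) -!EFinM !lee_fin ler_pM2r//.
    by rewrite -lte_fin fineK.
  have CUU : C b `&` U b = U b.
    by apply/seteqP; split => [x []//|x Ux]; split => //; exact: UC.
  have -> : muN (C b `\` U b) = (muN (C b) - muN (C b `&` U b))%E by exact: (measureD (mC b) (mU b) (muCoo b)).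
  rewrite CUU; apply/eqP; rewrite eq_le; apply/andP; split.
    by rewrite lee_subel_addr// add0e.
  by rewrite sube_ge0 ?Ufin// le_measure ?inE//; exact: UC.
exists (\bigcup_b (C (b0 + b) `\` U (b0 + b))); split.
- by apply: bigcupT_measurable => b; exact: measurableD.
- have mN : measurable (\bigcup_b (C (b0 + b) `\` U (b0 + b))).
    by apply: bigcupT_measurable => b; exact: measurableD.
  apply/(negligibleP muN mN); apply: negligible_bigcup => b.
  apply/negligibleP; first exact: measurableD.
  by apply: null; exact: leq_addr.
move=> x [Kx nKx]; have x0 := Kpos Kx.
pose b := Num.bound `|x|; exists b => //.
have Px : P (b0 + b) x.
  move=> i; rewrite /= in_itv/= x0/=.
  apply: le_trans (ler_norm _) _; apply: le_trans (ler_norm_coord _ i) _.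
  apply/ltW/(lt_le_trans (archi_boundP _)) => //.
  by rewrite ler_nat leqW// leq_addl.
by split; [split => //; exact: subset_closure|move=> []].
Qed.

Let cst_ge0 : 0 <= l%:R ^+ 2 / (l%:R - 1) :> R.
Proof. by rewrite divr_ge0 ?sqr_ge0// subr_ge0 ler1n. Qed.

(** A globally Lipschitz [F] stands in for [f]: the variance lives on the core [m], the gradient on
    the larger core [2 m + 1] that the mollifier reaches. The squared partial derivatives are
    compared in one direction only, because [partial_on] is 0 where [partial k f] is junk. *)
Lemma core_variance (f : 'rV[R]_n -> R) m : [locally [lipschitz f x | x in K]] ->
  exists F : 'rV[R]_n -> R,
  [/\ measurable_fun setT F /\ forall k, measurable_fun setT (partial_on F k),
      exists C, forall x, core l K m x -> `|F x| <= C,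
      forall x, core l K m x -> F x = f x,
      forall k x, core l K m.*2.+1 x -> partial_on F k x ^+ 2 <= `|partial k f x| ^+ 2 &
      ((fine (muN (core l K m)) * \int[muN]_(x in core l K m) (F x ^+ 2) -
         (\int[muN]_(x in core l K m) F x) ^+ 2)%:E <=
       (fine (muN (core l K m)))%:E * ((l%:R ^+ 2 / (l%:R - 1))%:E *
         \sum_(k < n) \int[muN]_(x in core l K m.*2.+1)
           (x ord0 k ^+ 2 * partial_on F k x ^+ 2)%:E))%E].
Proof.
(* Two enlargements: one leaves room for the mollifier, the other makes [F = f] near every point of
   the core [2 m + 1], so that the partial derivatives agree there. *)
move=> fK; pose M := (m.*2.+1).*2.+1.
have coreK p : core l K p `<=` K.
  by move=> x /(core_interior l0) /interior_subset.
have [Lam L0 fL] := locally_lipschitz_compact (@compact_core _ _ l0 _ K M) (coreK M) fK.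
have [F FL Ff] := lipschitz_extension (ltW L0) fL.
have mono p q : (p <= q)%N -> core l K p `<=` core l K q by exact: core_nondecreasing.
exists F; split.
- split=> [|k]; last exact: (measurable_partial_on k FL).
  by apply: continuous_measurable_rV; exact: lipschitz_continuous FL.
- exists (`|F 0| + Lam * m.+1%:R ^+ l) => x Dx.
  rewrite -[F x](subrK (F 0)) addrC (le_trans (ler_normD _ _))// lerD2l.
  rewrite (le_trans (FL _ _))// ler_wpM2l ?(ltW L0)// subr0.
  apply: ler_norm_rV; first exact: exprn_ge0.
  by move=> i; have /andP[_] := core_bounds l0 Dx i; rewrite gtr0_norm//; case: Dx.
- have dbl k : (k <= k.*2.+1)%N by rewrite -addnn leqW// leq_addr.
  by move=> x Dx; apply: Ff; apply: mono Dx; exact: leq_trans (dbl m) (dbl _).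
- move=> k x Ex; rewrite /partial_on; case: ifPn => [_|_]; last by rewrite expr0n sqr_ge0.
  suff -> : partial k F x = partial k f x by rewrite real_normK// num_real.
  apply: near_eq_derive.
  have x0 : positive_orthant R n x by case: Ex.
  have d0 : 0 < M.+1%:R^-1 ^+ l :> R by rewrite exprn_gt0// invr_gt0.
  have nx : nbhs x (positive_orthant R n).
    by apply: open_nbhs_nbhs; split => //; exact: open_positive_orthant.
  have nb : nbhs x [set y : 'rV[R]_n | forall i, `|x ord0 i - y ord0 i| < M.+1%:R^-1 ^+ l].
    by apply/nbhs_rVP; exists (M.+1%:R^-1 ^+ l).
  by near=> y; apply: Ff; apply: (core_step l0 Ex); near: y.
(* Half the radius of [core_step], since displacements up to and including [e0] must satisfy a
   strict inequality there. *)
have e0 : 0 < (m.*2).+2%:R^-1 ^+ l / 2 :> R by rewrite divr_gt0 ?exprn_gt0 ?invr_gt0.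
have al0 : 0 < (m.+1%:R^-1 / 2) ^+ l :> R by rewrite exprn_gt0// divr_gt0// invr_gt0.
have alB : (m.+1%:R^-1 / 2) ^+ l <= m.+1%:R ^+ l :> R.
  have m1 : 1 <= m.+1%:R :> R by rewrite ler1n.
  have mi : m.+1%:R^-1 <= 1 :> R by rewrite invf_le1.
  have m0 : 0 <= m.+1%:R^-1 :> R by rewrite invr_ge0.
  have m2 : m.+1%:R^-1 / 2 <= m.+1%:R :> R.
    by apply: le_trans (le_trans mi m1); rewrite ler_pdivrMr// ler_peMr// ler1n.
  by rewrite lerXn2r ?nnegrE// divr_ge0.
have DE x (s : 'rV[R]_n) : core l K m x -> (forall i, 0 <= s ord0 i <= (m.*2).+2%:R^-1 ^+ l / 2) ->
    core l K m.*2.+1 (x + s).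
  move=> Dx se; apply: (core_step l0 Dx).
    by move=> i; rewrite mxE; have /andP[s0 _] := se i; rewrite ltr_wpDr//; case: Dx.
  move=> i; rewrite mxE opprD addrA subrr sub0r normrN; have /andP[s0 s1] := se i.
  by rewrite ger0_norm// (le_lt_trans s1)// ltr_pdivrMr// ltr_pMr ?ltr1n// exprn_gt0// invr_gt0.
have mcore p : measurable (core l K p) by exact: measurable_core.
have bounds x : core l K m x -> forall i, (m.+1%:R^-1 / 2) ^+ l <= x ord0 i <= m.+1%:R ^+ l.
  by move=> Dx; exact: (core_bounds l0 Dx).
have rm x y : core l K m x -> core l K m y -> core l K m (rmean_rV l x y).
  exact: (core_rmean l0 Kpos Kconv).
exact: (variance_le_lipschitz l1 (mcore m) (mcore _) al0 alB bounds rm e0 DE L0 FL).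
Unshelve. all: by end_near. Qed.

End boundary.

(** * Passage to the limit *)

Section completion_transfer.
Local Open Scope ereal_scope.

(* [g] need not be measurable: it will be a squared partial derivative with
   junk values. *)
Lemma ge0_le_integral_restrict d (T : measurableType d) (R : realType)
    (mu : {measure set T -> \bar R}) (A B : set T) (f g : T -> \bar R) :
  (forall x, A x -> 0 <= f x) -> (forall x, B x -> 0 <= g x) ->
  (forall x, A x -> B x /\ f x <= g x) ->
  \int[mu]_(x in A) f x <= \int[mu]_(x in B) g x.
Proof.
move=> f0 g0 fg; rewrite !ge0_integralE//; apply: le_ereal_sup => _ [h hf <-].
exists h => // x; apply: le_trans (hf x) _; rewrite !patchE.
case: ifPn => [|_]; last by case: ifPn => // /set_mem /g0.
by move=> /set_mem /fg[Bx fgx]; rewrite mem_set.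
Qed.

Context {R : realType} (n : nat).
Local Notation muN := (@borel_lebesgue_rV R n).
Local Notation muL := (@lebesgue_rV R n).

(** A second name for the row vectors, with the Caratheodory sigma-algebra, so that Borel and
    Lebesgue measurability can be stated side by side. *)
Definition rV_completion : measurableType _ := caratheodory_type (muN^*)%mu.

Lemma measurable_completion (A : set 'rV[R]_n) : measurable A ->
  measurable (A : set rV_completion).
Proof. exact: caratheodory_measurable_mu_ext. Qed.

Lemma measurable_fun_completion d (T : measurableType d) (f : 'rV[R]_n -> T) :
  measurable_fun setT f -> measurable_fun setT (f : rV_completion -> T).
Proof.
by move=> mf _ Y mY; apply: measurable_completion; exact: mf.
Qed.

(** The Borel measure is the image of the completed one under the identity, which is measurable from
    the completion to the Borel structure. *)
Lemma ge0_integral_completion (A : set 'rV[R]_n) (f : 'rV[R]_n -> \bar R) :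
  measurable A -> measurable_fun setT f -> (forall x, 0 <= f x) ->
  \int[muL]_(x in A) f x = \int[muN]_(x in A) f x.
Proof.
move=> mA mf f0.
pose phi : rV_completion -> 'rV[R]_n := id.
have mphi : measurable_fun setT phi by apply: measurable_fun_completion; exact: measurable_id.
pose nu : {measure set 'rV[R]_n -> \bar R} := pushforward (muL : {measure set rV_completion -> \bar R}) phi.
rewrite [RHS](eq_measure_integral (nu mphi)); last first.
  by move=> B mB _; rewrite /nu/= /pushforward; apply/esym; exact: lebesgue_rVE.
by rewrite ge0_integral_pushforward//; exact: measurable_funTS.
Qed.

Lemma negligible_completion (N A : set 'rV[R]_n) : measurable N -> muN N = 0 -> A `<=` N ->
  measurable (A : set rV_completion) /\ muL A = 0.
Proof.
move=> mN N0 AN.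
have mLN : measurable (N : set rV_completion) by exact: measurable_completion.
have LN0 : muL N = 0 by rewrite lebesgue_rVE.
have mA : measurable (A : set rV_completion).
  apply: (@measure_is_complete_caratheodory R 'rV[R]_n (muN^*)%mu); exists N; split => //.
split => //; apply/eqP; rewrite eq_le measure_ge0 andbT -LN0.
by apply: le_measure; rewrite ?inE.
Qed.

End completion_transfer.

(** * Exhaustion of [K] by cores *)

Section weighted_poincare.
Context {R : realType} (l : nat) (l1 : (1 < l)%N) (n : nat).
Local Notation muN := (@borel_lebesgue_rV R n).
Local Notation muL := (@lebesgue_rV R n).
Local Notation T := (@rV_completion R n).
Let l0 : (0 < l)%N := ltnW l1.
Variables (K : set 'rV[R]_n) (f : 'rV[R]_n -> R).
Hypotheses (Kpos : K `<=` positive_orthant R n) (Kconv : p_convex l%:R^-1 K)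
  (K0 : K° !=set0) (fK : [locally [lipschitz f x | x in K]])
  (fint : muL.-integrable K (EFin \o f))
  (f0 : (\int[muL]_(x in K) (f x)%:E = 0)%E).

Let D m : set T := core l K m.
Let U : set T := K°.

Let mD m : measurable (D m).
Proof. by apply: measurable_completion; exact: measurable_core. Qed.

Let UE : U = \bigcup_m D m.
Proof. by rewrite /U -(bigcup_core l0 Kpos). Qed.

Let mU : measurable U.
Proof. by rewrite UE; exact: bigcupT_measurable. Qed.

Let ndD : {homo D : p q / (p <= q)%N >-> (p <= q)%O}.
Proof. by move=> p q pq; apply/subsetPset; exact: core_nondecreasing. Qed.

Let UK : U `<=` K. Proof. exact: interior_subset. Qed.

Let DU m : D m `<=` U. Proof. by move=> x; exact: core_interior. Qed.

Let KU_null : measurable (K `\` U : set T) /\ muL (K `\` U) = 0%E.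
Proof.
have [N [mN N0 sub]] := boundary_negligible l1 Kpos Kconv K0.
exact: negligible_completion mN N0 sub.
Qed.

(** [K] is its interior together with a subset of a Borel null set: measurable in the completion,
    though perhaps not Borel. *)
Let mK : measurable (K : set T).
Proof. by rewrite -(setDUK UK); apply: measurableU => //; case: KU_null. Qed.

Let mf : measurable_fun (K : set T) (EFin \o f : T -> \bar R).
Proof. by case/integrableP: fint. Qed.

Let mfU : measurable_fun U (EFin \o f : T -> \bar R).
Proof. exact: measurable_funS mf. Qed.

Let mfD m : measurable_fun (D m) (EFin \o f : T -> \bar R).
Proof. by apply: measurable_funS mfU => //; exact: DU. Qed.

Let mf2 : measurable_fun (K : set T) ((fun x => (f x ^+ 2)%:E) : T -> \bar R).
Proof. by apply/measurable_EFinP; apply: measurable_funX; exact/measurable_EFinP. Qed.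

Let KDU : K `\` (K `\` U) = U.
Proof. by rewrite setDD setIidr. Qed.

Let intU0 : (\int[muL]_(x in U) (f x)%:E = 0)%E.
Proof.
have [mN N0] := KU_null.
by rewrite -f0 [RHS](negligible_integral mN mK fint N0) KDU.
Qed.

(** On a single core the integral of [f] need not vanish; it does so in the limit, by monotone
    convergence for the positive and negative parts, whose integrals are finite. *)
Let cvg_intD : (\int[muL]_(x in D m) (f x)%:E)%E @[m --> \oo] --> 0%E.
Proof.
have iU : muL.-integrable U (EFin \o f) by exact: integrableS fint.
have cp : (\int[muL]_(x in D m) ((EFin \o f)^\+ x))%E @[m --> \oo] -->
    (\int[muL]_(x in U) ((EFin \o f)^\+ x))%E.
  rewrite UE; apply: (ge0_nondecreasing_set_cvg_integral ndD mD) => m.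
    exact: measurable_funepos.
  by move=> x _; exact: funepos_ge0.
have cn : (\int[muL]_(x in D m) ((EFin \o f)^\- x))%E @[m --> \oo] -->
    (\int[muL]_(x in U) ((EFin \o f)^\- x))%E.
  rewrite UE; apply: (ge0_nondecreasing_set_cvg_integral ndD mD) => m.
    exact: measurable_funeneg.
  by move=> x _; exact: funeneg_ge0.
have fp : (\int[muL]_(x in U) ((EFin \o f)^\+ x))%E \is a fin_num.
  exact: integrable_fin_num (integrable_funepos mU iU).
have fn : (\int[muL]_(x in U) ((EFin \o f)^\- x))%E \is a fin_num.
  exact: integrable_fin_num (integrable_funeneg mU iU).
rewrite -intU0 integralE; under eq_fun do rewrite integralE.
by apply: (cvgeB _ cp cn); apply: fin_num_adde_defr.
Qed.

Let E : \bar R := ((l%:R ^+ 2 / (l%:R - 1))%:E *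
   \sum_(i < n) \int[muL]_(x in K) (x ord0 i ^+ 2 * `|partial i f x| ^+ 2)%:E)%E.

Let cst_ge0 : 0 <= l%:R ^+ 2 / (l%:R - 1) :> R.
Proof. by rewrite divr_ge0 ?sqr_ge0// subr_ge0 ler1n. Qed.

Let E0 : (0 <= E)%E.
Proof.
apply: mule_ge0; first by rewrite lee_fin.
apply: sume_ge0 => i _; apply: integral_ge0 => x _.
by rewrite lee_fin mulr_ge0// sqr_ge0.
Qed.

(** [core_variance] restated for [f] and the completed measure. [S] is the integral of [F^2] over
    the core, hence a real number although [f] is not assumed square integrable; the third clause
    serves the cores of measure zero, where division by the volume is impossible. *)
Let core_ineq m : exists S : R,
  [/\ (\int[muL]_(x in D m) (f x ^+ 2)%:E = S%:E)%E,
      0 <= fine (muN (core l K m)), (fine (muN (core l K m)) = 0 -> S = 0) &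
      ((fine (muN (core l K m)) * S - fine (\int[muL]_(x in D m) (f x)%:E)%E ^+ 2)%:E <=
       (fine (muN (core l K m)))%:E * E)%E].
Proof.
have [F [[mF mP] [C FC] Ff Pf ineq]] := core_variance l1 Kpos Kconv m fK.
have mcore : measurable (core l K m) by exact: measurable_core.
have muoo : (muN (core l K m) < +oo)%E.
  apply: (@borel_lebesgue_rV_bounded _ _ _ (m.+1%:R ^+ l)) => // x Dx i.
  by have /andP[_ ->] := core_bounds l0 Dx i; rewrite andbT; case: Dx.
have integ (g : 'rV[R]_n -> R) M : measurable_fun setT g ->
    (forall x, core l K m x -> `|g x| <= M) -> muN.-integrable (core l K m) (EFin \o g).
  move=> mg gM; apply: measurable_bounded_integrable => //; first exact: measurable_funTS.
  exists M; split; first by rewrite num_real.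
  by move=> M' MM' x Dx /=; rewrite (le_trans (gM x Dx))// ltW.
have iF2 : muN.-integrable (core l K m) (EFin \o (fun x => F x ^+ 2)).
  apply: (@integ _ (C ^+ 2)) => [|x Dx]; first exact: measurable_funX.
  by rewrite normrX lerXn2r ?nnegrE ?FC// (le_trans (normr_ge0 (F x)))// FC.
have mcore_ge0 := measure_ge0 muN (core l K m).
exists (\int[muN]_(x in core l K m) (F x ^+ 2)); split.
- rewrite /Rintegral fineK; last exact: integrable_fin_num iF2.
  rewrite -ge0_integral_completion//; last 2 first.
  + by apply/measurable_EFinP; exact: measurable_funX.
  + by move=> x; rewrite lee_fin sqr_ge0.
  by apply: eq_integral => x /set_mem Dx; rewrite Ff.
- exact: fine_ge0.
- move=> V0; have muD0 : muN (core l K m) = 0%E.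
    by rewrite -[LHS]fineK ?V0// ge0_fin_numE.
  rewrite /Rintegral null_set_integral//.
  by apply: measurable_funTS; apply/measurable_EFinP; exact: measurable_funX.
have -> : fine (\int[muL]_(x in D m) (f x)%:E)%E = \int[muN]_(x in core l K m) F x.
  rewrite /Rintegral; congr fine.
  have -> : (\int[muL]_(x in D m) (f x)%:E = \int[muL]_(x in D m) (F x)%:E)%E.
    by apply: eq_integral => x /set_mem Dx; rewrite Ff.
  have mFE : measurable_fun setT (EFin \o F) by exact/measurable_EFinP.
  rewrite [LHS]integralE [RHS]integralE; congr (_ - _)%E.
    exact: (ge0_integral_completion mcore (measurable_funepos mFE) (funepos_ge0 _)).
  exact: (ge0_integral_completion mcore (measurable_funeneg mFE) (funeneg_ge0 _)).
apply: le_trans ineq _; apply: lee_wpmul2l; first by rewrite lee_fin fine_ge0.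
apply: lee_wpmul2l; first by rewrite lee_fin.
apply: lee_sum => i _; rewrite -ge0_integral_completion; last 3 first.
- exact: measurable_core.
- apply/measurable_EFinP; apply: measurable_funM; last exact: measurable_funX.
  by apply: measurable_funX; exact: measurable_coord.
- by move=> x; rewrite lee_fin mulr_ge0// sqr_ge0.
apply: ge0_le_integral_restrict => x.
- by move=> _; rewrite lee_fin mulr_ge0// sqr_ge0.
- by move=> _; rewrite lee_fin mulr_ge0// sqr_ge0.
move=> Dx; split; first exact/UK/(DU Dx).
by rewrite lee_fin ler_wpM2l ?sqr_ge0// Pf.
Qed.

(** With [V] the volume of a core and [a] the integral of [f] over it, [core_ineq] reads
    [V S - a^2 <= V E]. The volumes are eventually at least some [V m0 > 0] while [a] tends to 0, so
    that [a^2 <= e V], and division by [V] leaves [S <= E + e]. *)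
Lemma weighted_poincare : (\int[muL]_(x in K) (f x ^+ 2)%:E <= E)%E.
Proof.
have [mN N0] := KU_null.
rewrite (ge0_negligible_integral mN mK mf2 _ N0); last by move=> x _; rewrite lee_fin sqr_ge0.
rewrite KDU.
have [->|Efin] := eqVneq E +oo%E; first exact: leey.
have [r rE] : exists r, E = r%:E.
  by exists (fine E); rewrite fineK// ge0_fin_numE// ltey.
have cI : (\int[muL]_(x in D m) (f x ^+ 2)%:E)%E @[m --> \oo] -->
    (\int[muL]_(x in U) (f x ^+ 2)%:E)%E.
  rewrite UE; apply: (ge0_nondecreasing_set_cvg_integral ndD mD) => [m|m x _].
    by apply: measurable_funS mf2 => // x /DU/UK.
  by rewrite lee_fin sqr_ge0.
apply/lee_addgt0Pr => e e0.
rewrite -(cvg_lim _ cI)//; apply: lime_le; first by apply/cvg_ex; eexists; exact: cI.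
pose V m := fine (muN (core l K m)).
(* If every core is null, the integrals over the cores all vanish and so does their limit. *)
have [[m0 Vm0]|V0] := pselect (exists m0, 0 < V m0); last first.
  near=> m; have [S [-> V_ge0 S0 _]] := core_ineq m; rewrite S0 ?adde_ge0 ?lee_fin ?(ltW e0)//.
  apply/eqP; rewrite eq_le V_ge0 andbT leNgt; apply/negP => Vm; apply: V0; by exists m.
have muoo m : (muN (core l K m) < +oo)%E.
  apply: (@borel_lebesgue_rV_bounded _ _ _ (m.+1%:R ^+ l)); first exact: measurable_core.
  move=> x Dx i; have /andP[_ ->] := core_bounds l0 Dx i; rewrite andbT; case: Dx => //.
have Vmono m : (m0 <= m)%N -> V m0 <= V m.
  move=> mm; rewrite /V fine_le ?ge0_fin_numE//.
  by apply: le_measure; rewrite ?inE; [exact: measurable_core|exact: measurable_core|exact: core_nondecreasing].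
pose a m := fine (\int[muL]_(x in D m) (f x)%:E)%E.
have ca : a m @[m --> \oo] --> (0 : R) by exact: fine_cvg cvg_intD.
(* The tolerance for [a m], chosen so that its square is [e * V m0]. *)
have s0 : 0 < Num.sqrt (e * V m0) by rewrite sqrtr_gt0 mulr_gt0.
have ha : \forall m \near \oo, `|0 - a m| < Num.sqrt (e * V m0) by exact: cvgr_dist_lt.
near=> m.
have am : a m ^+ 2 <= e * V m0.
  rewrite -[leRHS]sqr_sqrtr ?mulr_ge0 ?(ltW e0) ?(ltW Vm0)//.
  rewrite -[leLHS]real_normK ?num_real// lerXn2r ?nnegrE ?(ltW s0)//.
  have : `|0 - a m| < Num.sqrt (e * V m0) by near: m; exact: ha.
  by rewrite sub0r normrN => /ltW.
have mm : (m0 <= m)%N by near: m; exact: nbhs_infty_ge.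
have [S [-> V_ge0 _]] := core_ineq m; rewrite -/(V m) -/(a m) rE -EFinM -EFinD !lee_fin => h.
have Vm : 0 < V m by exact: lt_le_trans (Vmono m mm).
rewrite -(ler_pM2l Vm) mulrDr.
have := ler_wpM2l (ltW e0) (Vmono m mm); rewrite [V m * e]mulrC; lra.
Unshelve. all: by end_near. Qed.

End weighted_poincare.

Theorem corollary1p2 (R : realType) (n l : nat) (K : set 'rV[R]_n)
    (f : 'rV[R]_n -> R) :
  (1 <= n)%N -> (1 < l)%N ->
  K `<=` positive_orthant R n ->
  p_convex (l%:R^-1) K ->
  K° !=set0 ->
  [locally [lipschitz f x | x in K]] ->
  (lebesgue_rV n).-integrable K (fun x => (f x)%:E) ->
  (\int[lebesgue_rV n]_(x in K) (f x)%:E = 0)%E ->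
  (\int[lebesgue_rV n]_(x in K) (f x ^+ 2)%:E <=
   (l%:R ^+ 2 / (l%:R - 1))%:E *
   \sum_(i < n) \int[lebesgue_rV n]_(x in K)
     (x ord0 i ^+ 2 * `|partial i f x| ^+ 2)%:E)%E.
Proof.
move=> _ l1 Kpos Kconv K0 fK fint f0; exact: (weighted_poincare l1 Kpos Kconv K0 fK fint f0).
Qed.
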